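(* Let $X$ be a Harris ergodic Markov chain on $\mathsf{X}$ with invariant distribution $\pi$ and kernel $P$ satisfying the minorization $P(x,A)\ge s(x)Q(A)$ for all $x\in\mathsf{X}$ and $A\in\mathcal{B}(\mathsf{X})$, where $s:\mathsf{X}\to[0,1]$ satisfies $E_\pi s>0$ and $Q$ is a probability measure. Let the associated split chain be started with $X_0\sim Q$ and run for $R$ tours, up to the $R$th regeneration time $\tau_R$. Let $j=j_R$ be integers in $\{1,\ldots,\tau_R\}$ with $j=\tau_Rq+o(\sqrt{\tau_R})$ as $R\to\infty$, and let $Y_{\tau_R(j)}$ be the $j$th order statistic of $Y_0,\ldots,Y_{\tau_R-1}$. If $X$ is polynomially ergodic of order $m>1$, then, as $R\to\infty$, \[ \sqrt{R}\left(Y_{\tau_R(j)}-\xi_q\right)\stackrel{d}{\to}\mathrm{N}\left(0,\ \Gamma(\xi_q)/f_V^2(\xi_q)\right). \]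
   Context: $\pi$ is a probability distribution with support $\mathsf{X}\subseteq\mathbb{R}^d$, $d\ge1$; $P^n(x,A)=\Pr(X_{k+n}\in A\mid X_k=x)$, $P=P^1$. Harris ergodic means $\pi$-irreducible, aperiodic and positive Harris recurrent. $X$ is polynomially ergodic of order $m>0$ if there is $M:\mathsf{X}\to\mathbb{R}^+$ with $E_\pi M<\infty$ such that $\|P^n(x,\cdot)-\pi(\cdot)\|\le M(x)n^{-m}$ for all $x\in\mathsf{X}$, $n\in\{1,2,\ldots\}$, where $\|\cdot\|$ is the total variation norm. The function $g:\mathsf{X}\to\mathbb{R}$ is measurable, $V=g(W)$ with $W\sim\pi$, $F_V$ is the distribution function of $V$, $0<q<1$, and $\xi_q=\inf\{v:F_V(v)\ge q\}$. It is assumed that $F_V$ is absolutely continuous with continuous density $f_V$ satisfying $0<f_V(\xi_q)<\infty$. Set $Y_i=g(X_i)$. Residual measure: $\mathsf{R}(x,dy)=\dfrac{P(x,dy)-s(x)Q(dy)}{1-s(x)}$ if $s(x)<1$ and $\mathsf{R}(x,dy)=Q(dy)$ if $s(x)=1$. The split chain $X'=\{(X_0,\delta_0),(X_1,\delta_1),\ldots\}$ on $\mathsf{X}\times\{0,1\}$ evolves as follows: given $X_i=x$, draw $\delta_i\sim\mathrm{Bernoulli}(s(x))$; if $\delta_i=1$ draw $X_{i+1}\sim Q$, otherwise draw $X_{i+1}\sim\mathsf{R}(x,\cdot)$. $E_Q$ denotes expectation when the split chain is started with $X_0\sim Q$. The regeneration times are $\tau_0=0$ and $\tau_{t+1}=\min\{i>\tau_t:\delta_{i-1}=1\}$;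 $N_t=\tau_t-\tau_{t-1}$ and $S_t(y)=\sum_{i=\tau_{t-1}}^{\tau_t-1}I(Y_i\le y)$ for $t\ge1$. For $y\in\mathbb{R}$, \[ \Gamma(y)=E_Q\left[(S_1(y)-F_V(y)N_1)^2\right]/[E_Q(N_1)]^2 . \] The condition $j=\tau_Rq+o(\sqrt{\tau_R})$ means $(j_R-\tau_Rq)/\sqrt{\tau_R}\to0$ with probability 1 as $R\to\infty$. $\mathrm{N}(0,0)$ is read as the point mass at $0$. *)

(* Defs.v *)
From HB Require Import structures.
From mathcomp Require Import all_boot all_order all_algebra.
From mathcomp Require Import all_classical all_reals all_analysis.
Set Implicit Arguments.
Unset Strict Implicit.
Unset Printing Implicit Defensive.
Import Order.TTheory GRing.Theory Num.Theory.
Import numFieldNormedType.Exports.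

Local Open Scope classical_set_scope.
Local Open Scope ring_scope.

(* A nonempty subset D of a measurable space as a measurable space of its own,
   with the trace sigma-algebra.  Nonemptiness is a parameter because
   measurable types are pointed; the chosen point plays no role. *)
Definition subspace_type d (T : measurableType d) (D : set T)
  (D0 : D !=set0) : Type := {x : T | D x}.

Section subspace_type.
Context d (T : measurableType d) (D : set T) (D0 : D !=set0).

HB.instance Definition _ := gen_eqMixin (subspace_type D0).
HB.instance Definition _ := gen_choiceMixin (subspace_type D0).
HB.instance Definition _ := isPointed.Build (subspace_type D0) (cid D0).

Definition subspace_val (x : subspace_type D0) : T := sval x.

Definition trace_space : measurableType (preimage_display subspace_val) :=
  g_sigma_algebra_preimageType subspace_val.

End subspace_type.

Section kernels.
Context d (S : measurableType d) (R : realType).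
Implicit Types (P : R.-pker S ~> S) (pi Q : probability S R) (s : S -> R).
Local Open Scope ereal_scope.

Fixpoint kernel_iter P (n : nat) (x : S) (A : set S) : \bar R :=
  if n is n'.+1 then \int[P x]_y kernel_iter P n' y A else \d_x A.

(* first_passage P A n x is the probability, for the chain started at x, that
   the first visit to A at a positive time happens at time n.+1. *)
Fixpoint first_passage P (A : set S) (n : nat) (x : S) : \bar R :=
  if n is n'.+1 then \int[P x]_(y in ~` A) first_passage P A n' y else P x A.

(* Pr(X_n \in A for some n >= 1 | X_0 = x). *)
Definition hitting_prob P (x : S) (A : set S) : \bar R :=
  \sum_(0 <= n <oo) first_passage P A n x.

Definition invariant P pi := forall A : set S, measurable A ->
  \int[pi]_x P x A = pi A.

Definition irreducible P pi := forall (x : S) (A : set S), measurable A ->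
  0 < pi A -> exists2 n : nat, (0 < n)%N & 0 < kernel_iter P n x A.

(* There is no cycle of length k >= 2: no pairwise disjoint measurable sets
   D 0, ..., D (k-1) of positive pi-measure visited in cyclic order with
   probability 1. *)
Definition aperiodic P pi := ~ exists (k : nat) (D : nat -> set S),
  [/\ (1 < k)%N,
      forall i, (i < k)%N -> measurable (D i) /\ 0 < pi (D i),
      trivIset `I_k D &
      forall i x, (i < k)%N -> D i x -> P x (D (i.+1 %% k)%N) = 1].

Definition harris_recurrent P pi := forall (x : S) (A : set S), measurable A ->
  0 < pi A -> hitting_prob P x A = 1.

(* Positivity is the existence of the invariant probability measure pi. *)
Definition harris_ergodic P pi :=
  [/\ invariant P pi, irreducible P pi, aperiodic P pi & harris_recurrent P pi].

(* The norm sup_A |mu A - nu A|; taking twice this value instead would only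
   rescale the function M below. *)
Definition tv_dist (mu nu : set S -> \bar R) : \bar R :=
  ereal_sup [set `|mu A - nu A| | A in measurable].

Definition polynomially_ergodic P pi (m : R) := (0 < m)%R /\
  exists M : S -> R, [/\ forall x, (0 <= M x)%R,
    pi.-integrable setT (EFin \o M) &
    forall x n, (0 < n)%N ->
      tv_dist (kernel_iter P n x) pi <= (M x * n%:R `^ (- m))%:E].

Definition minorization P pi s Q :=
  [/\ measurable_fun setT s, forall x, (0 <= s x <= 1)%R,
      0 < \int[pi]_x (s x)%:E &
      forall x (A : set S), measurable A -> (s x)%:E * Q A <= P x A].

Definition residual P s Q (x : S) (A : set S) : \bar R :=
  if (s x < 1)%R then (P x A - (s x)%:E * Q A) / (1 - s x)%:E else Q A.

End kernels.

Section split_chain.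
Context d (S : measurableType d) (R : realType).
Context d' (Omega : measurableType d') (Pr : probability Omega R).
Variables (X : nat -> {RV Pr >-> S}) (delta : nat -> {RV Pr >-> bool}).
Local Open Scope ereal_scope.

(* The sigma-algebra generated by X_0, ..., X_i, delta_0, ..., delta_(k-1). *)
Definition history (i k : nat) : set (set Omega) :=
  <<s (\bigcup_(l in [set l | (l <= i)%N])
         preimage_set_system setT (X l) measurable) `|`
      (\bigcup_(l in [set l | (l < k)%N])
         preimage_set_system setT (delta l) measurable) >>.

(* The conditional laws
     Pr(delta_i = 1 | X_0, ..., X_i, delta_0, ..., delta_(i-1)) = s(X_i),
     Pr(X_(i+1) \in A | X_0, ..., X_i, delta_0, ..., delta_i)
       = Q(A) if delta_i = 1, R(X_i, A) otherwise,
   in the integrated form that defines conditional probabilities, with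
   initial law X_0 ~ nu. *)
Definition split_chain (P : R.-pker S ~> S) (s : S -> R) (Q nu : probability S R) :=
  [/\ forall A, measurable A -> distribution Pr (X 0%N) A = nu A,
      forall i E, history i i E ->
        Pr (E `&` [set w | delta i w]) = \int[Pr]_(w in E) (s (X i w))%:E &
      forall i E A, history i i.+1 E -> measurable A ->
        Pr (E `&` X i.+1 @^-1` A) =
        \int[Pr]_(w in E)
          (if delta i w then Q A else residual P s Q (X i w) A)].

End split_chain.

Section tours.
Variable delta : nat -> bool.

(* min {i > k : delta_(i-1) = 1}, with the dummy value k if there is no such i
   (an event of probability 0 for the split chain of a Harris chain). *)
Definition next_regeneration (k : nat) : nat :=
  match pselect (exists i, (k < i)%N && delta i.-1) with
  | left ex => ex_minn ex
  | right _ => k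
  end.

Definition regeneration_time (t : nat) : nat := iter t next_regeneration 0%N.

Definition tour_length (t : nat) : nat :=
  (regeneration_time t - regeneration_time t.-1)%N.

Definition tour_count (R : realType) (Y : nat -> R) (t : nat) (y : R) : nat :=
  \sum_(regeneration_time t.-1 <= i < regeneration_time t) (Y i <= y)%R.

End tours.

Section asymptotic_variance.
Context (R : realType) d' (Omega : measurableType d') (Pr : probability Omega R).

(* Pr is to be the law of a space carrying the split chain with X_0 ~ Q, so
   that the expectations are E_Q; Y i = g(X_i), and F stands for F_V. *)
Definition Gamma (delta : nat -> Omega -> bool) (Y : nat -> Omega -> R)
    (F : R -> R) (y : R) : \bar R :=
  let N1 w : R := (tour_length (delta ^~ w) 1)%:R in
  let S1 w : R := (tour_count (delta ^~ w) (Y ^~ w) 1 y)%:R in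
  let D1 w : R := S1 w - F y * N1 w in
  ('E_Pr[fun w => (D1 w ^+ 2)%R] / 'E_Pr[N1] ^+ 2)%E.

End asymptotic_variance.

Section real_distributions.
Context (R : realType).

Definition cdfR d (T : measurableType d) (P : probability T R)
  (V : {RV P >-> R}) (v : R) : R := fine (cdf V v).

Definition quantile (F : R -> R) (q : R) : R := inf [set v | q <= F v].

Definition has_continuous_density (F f : R -> R) :=
  [/\ continuous f, forall x, 0 <= f x &
      forall v, (F v)%:E = (\int[lebesgue_measure]_(t in `]-oo, v]) (f t)%:E)%E].

(* The j-th smallest (1 <= j <= n) of Y_0, ..., Y_(n-1). *)
Definition order_statistic (Y : nat -> R) (n j : nat) : R :=
  nth 0 (sort <=%R [seq Y i | i <- iota 0 n]) j.-1.

(* N(0, v); normal_prob 0 0 is not a point mass in the library, and its second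
   parameter is the standard deviation. *)
Definition centered_normal (v : R) : set R -> \bar R :=
  if v == 0 then \d_(0 : R) else normal_prob 0 (Num.sqrt v).

(* Convergence of the distribution functions at the continuity points of the
   limiting one. *)
Definition cvg_in_distribution d (T : measurableType d) (P : probability T R)
    (Z : nat -> T -> R) (mu : set R -> \bar R) :=
  forall z : R, {for z, continuous (fun y : R => mu `]-oo, y]%classic)} ->
    P [set w | Z n w <= z] @[n --> \oo] --> mu `]-oo, z]%classic.

End real_distributions.

(* Main.v *)
From Pilot Require Import Defs.
From HB Require Import structures.
From mathcomp Require Import all_boot all_order all_algebra.
From mathcomp Require Import all_classical all_reals all_analysis.
From mathcomp Require Import measurable_realfun gauss_integral.
From mathcomp Require Import finmap.
From mathcomp Require Import ring lra.

(** The proof compares the order statistic with the empirical distribution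
    function and reduces the limit theorem to sums over tours, which are
    independent and identically distributed.

    _Tours._ From a renewal on, the split chain evolves independently of the past
    as if started from [Q] ([excursion_law], [tour_law]); hence the pairs formed
    by the length of a tour and its number of visits to a fixed set are
    independent and identically distributed ([tours_independent]). What has to be
    shown about a single tour is that its length has a finite second moment and
    that the mean occupation of a tour is [pi / beta], with [beta] the [pi]-mean of
    [s]. Both come from the renewal equation. Let [v n] be the probability of a
    renewal at time [n] and [h k] the probability that no coin shows 1 before time
    [k]; decomposing at the last renewal, the convolution of [h] and [v] is 1
    ([renewal_equation]). As [pi] dominates [beta * Q], the function [M] of the
    ergodicity hypothesis has a finite [Q]-mean, and so [v n] tends to [beta] at
    the rate [n ^ (- m)], which is summable because [m > 1]. An elementary
    argument on finite sums then shows that the sum of [h] is [beta ^ -1] and that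
    [k * h k] is summable ([renewal_sum], [renewal_moment]), which are the first
    and second moment of the length of a tour. Iterating the invariance of [pi]
    bounds [pi] from below by [beta] times the occupation of a tour, and the two
    measures have the same total mass ([occupation_cvg]).

    _Central limit theorem._ The level at which the tours are evaluated moves with
    their number, so a triangular array is needed. It is proved by Lindeberg's
    replacement of the increments by normal variables, one at a time
    ([lindeberg_swap], [triangular_clt]). The test functions are the logistic
    functions: they are smooth with bounded derivatives, satisfy an algebraic
    differential equation, and approximate indicators of half lines, so that they
    determine convergence in distribution ([logistic_cvg_in_distribution]). With
    limiting variance 0 the same theorem gives the law of large numbers for the
    renewal times ([regeneration_time_lln]).

    _Inversion._ The event that [sqrt r * (order statistic - xi) <= z] means that
    at least [j r] of the observations are at most [y = xi + z / sqrt r]. The count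
    of these observations is [F y * tau] plus a centred sum over tours; the latter
    satisfies the central limit theorem, its variance tending to the one at [xi]
    by continuity of [F], whereas [F y * tau - j r] is asymptotically
    [sqrt r * fV xi * z / beta] by the law of large numbers, differentiability of
    [F] at [xi] and the hypothesis on [j]. Dividing by [fV xi / beta] gives the
    limit law; the variance at [xi] divided by [(fV xi / beta) ^+ 2] is
    [Gamma / fV xi ^+ 2] since the mean length of a tour is [beta ^ -1]. *)

Set Implicit Arguments.
Unset Strict Implicit.
Unset Printing Implicit Defensive.
Import Order.TTheory GRing.Theory Num.Theory.
Import numFieldNormedType.Exports.

Local Open Scope classical_set_scope.
Local Open Scope ring_scope.

(** * Summability in the renewal equation *)

Lemma sum_natmul_tail (R : realType) (h : nat -> R) (n : nat) :
  \sum_(0 <= k < n) k%:R * h k =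
  \sum_(0 <= i < n) (\sum_(0 <= k < n) h k - \sum_(0 <= k < i.+1) h k).
Proof.
elim: n => [|n IHn]; first by rewrite !big_geq.
rewrite big_nat_recr//= IHn [RHS]big_nat_recr//= subrr addr0.
rewrite [in RHS](eq_bigr (fun i =>
  (\sum_(0 <= k < n) h k - \sum_(0 <= k < i.+1) h k) + h n)); last first.
  by move=> i _; rewrite (big_nat_recr n)//=; ring.
by rewrite [RHS]big_split/= sumr_const_nat subn0 mulr_natl.
Qed.

Lemma convolution_bound (R : realType) (h u : nat -> R) (n : nat) :
  (forall k, 0 <= h k) -> (forall k, 0 <= u k) ->
  \sum_(0 <= i < n) \sum_(0 <= k < i.+1) h k * u (i - k)%N <=
  (\sum_(0 <= k < n) h k) * \sum_(0 <= k < n) u k.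
Proof.
move=> h0 u0.
rewrite (eq_big_nat _ _ (F2 := fun i =>
  \sum_(0 <= k < n | (k < i.+1)%N) h k * u (i - k)%N)); last first.
  by move=> i /andP[_ lin]; rewrite (big_nat_widen 0 i.+1 n).
rewrite (exchange_big_dep_nat xpredT)//= mulr_suml.
apply: ler_sum_nat => k /andP[_ kn].
rewrite -mulr_sumr ler_wpM2l//.
rewrite -(big_nat_widenl k 0 n xpredT (fun i => u (i - k)%N))//.
rewrite -{1}[k]add0n big_addn.
rewrite (eq_bigr u); last by move=> i _; rewrite addnK.
rewrite [leRHS](big_cat_nat (n := (n - k)%N))//= ?leq_subr//.
by rewrite lerDl sumr_ge0.
Qed.

(** Here [v n] stands for the probability of a renewal at time [n] and [h k] for
    the probability that no renewal occurs during [k] steps; the equation is the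
    decomposition at the last renewal up to time [n], and [b] is the limiting
    renewal probability. *)
Section renewal.
Context (R : realType) (b : R) (h v : nat -> R).
Hypothesis b0 : 0 < b.
Hypothesis h01 : forall k, 0 <= h k <= 1.
Hypothesis renewal : forall n, \sum_(0 <= k < n.+1) h k * v (n - k)%N = 1.
Variable c : R.
Hypothesis vb : forall n, \sum_(0 <= k < n) `|v k - b| <= c.

Let h0 k : 0 <= h k. Proof. by case/andP: (h01 k). Qed.

Let e n := 1 - b * \sum_(0 <= k < n.+1) h k.

Let eE n : e n = \sum_(0 <= k < n.+1) h k * (v (n - k)%N - b).
Proof.
rewrite /e -(renewal n) mulr_sumr -sumrB.
by apply: eq_bigr => k _; ring.
Qed.

Let c0 : 0 <= c. Proof. by have := vb 0%N; rewrite big_geq. Qed.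

Let conv_le n : \sum_(0 <= k < n.+1) `|v (n - k)%N - b| <= c.
Proof.
by rewrite big_nat_rev/= (le_trans _ (vb n.+1))// ler_sum_nat// => k /andP[_ kn];
  rewrite add0n subSS subKn.
Qed.

Let sum_h_le n : \sum_(0 <= k < n) h k <= (1 + c) / b.
Proof.
case: n => [|n]; first by rewrite big_geq// divr_ge0// ?addr_ge0// ltW.
rewrite ler_pdivlMr// mulrC.
have -> : b * \sum_(0 <= k < n.+1) h k = 1 - e n by rewrite /e; ring.
rewrite lerD2l (le_trans (ler_norm _))// normrN eE (le_trans (ler_norm_sum _ _ _))//.
rewrite (le_trans _ (conv_le n))// ler_sum// => k _.
by rewrite normrM ger0_norm// ler_piMl//; case/andP: (h01 k).
Qed.

Let sum_e_le n : \sum_(0 <= i < n) `|e i| <= (1 + c) / b * c.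
Proof.
apply: (@le_trans _ _ (\sum_(0 <= i < n) \sum_(0 <= k < i.+1)
    h k * `|v (i - k)%N - b|)).
  apply: ler_sum => i _; rewrite eE (le_trans (ler_norm_sum _ _ _))//.
  by apply: ler_sum => k _; rewrite normrM ger0_norm.
rewrite (le_trans (convolution_bound (u := fun k => `|v k - b|) _ _ _))//.
by apply: ler_pM => //; exact: sumr_ge0.
Qed.

Let e_nincr : nonincreasing_seq e.
Proof.
apply/nonincreasing_seqP => n; rewrite /e lerD2l lerN2 ler_pM2l//.
by rewrite [leRHS]big_nat_recr//= lerDl.
Qed.

Let cvg_e : e @ \oo --> (0 : R).
Proof.
apply/norm_cvg0P; apply: cvg_series_cvg_0.
apply: nondecreasing_is_cvgn.
  apply/nondecreasing_seqP => n; rewrite /series/= [leRHS]big_nat_recr//=.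
  by rewrite lerDl.
by exists ((1 + c) / b * c) => _ [n _ <-]; exact: sum_e_le.
Qed.

(** The deficit [1 - b * (h 0 + ... + h n)] is the convolution of [h] with
    [v - b]; both being summable, so is the deficit, and as it decreases it has
    to vanish in the limit. *)
Lemma renewal_sum : \sum_(0 <= k < n) h k @[n --> \oo] --> b^-1.
Proof.
rewrite -(cvg_shiftn 1).
have -> : (fun n => \sum_(0 <= k < n + 1) h k) = (fun n => (1 - e n) * b^-1).
  by apply/funext => n; rewrite addn1 /e; field; exact: lt0r_neq0.
suff : (1 - e n) / b @[n --> \oo] --> (1 - 0) / b by rewrite subr0 mul1r.
by apply: cvgM; [apply: cvgB => //; exact: cvg_cst|exact: cvg_cst].
Qed.

(** The first moment of [h] is the sum of its tails, and a tail of [h] is the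
    nonnegative deficit divided by [b], whose sum is already bounded. *)
Lemma renewal_moment n : \sum_(0 <= k < n) k%:R * h k <= (1 + c) / b * c / b.
Proof.
rewrite sum_natmul_tail ler_pdivlMr// mulr_suml.
rewrite (le_trans _ (sum_e_le n))//; apply: ler_sum_nat => i /andP[_ lin].
rewrite mulrBl !(mulrC _ b).
have en0 : 0 <= e n.-1.
  rewrite -(cvg_lim (@Rhausdorff R) cvg_e).
  by apply: nonincreasing_cvgn_ge => //; exact: cvgP cvg_e.
apply: le_trans (ler_norm _); move: en0; rewrite /e prednK ?(leq_trans _ lin)//.
by rewrite subr_ge0; lra.
Qed.
End renewal.

(** * Integrals of nonnegative functions *)

Import HBNNSimple.

(** Lifts relations between measures from events to nonnegative functions: only
    indicators, scaling, sums and increasing limits have to be checked. *)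
Lemma ge0_measurable_ind d (T : measurableType d) (R : realType)
    (P : (T -> \bar R) -> Prop) :
  (forall A, measurable A -> P (fun x => (\1_A x)%:E)) ->
  (forall (k : R) (f : T -> \bar R), 0 <= k -> measurable_fun setT f -> (forall x, 0 <= f x)%E ->
    P f -> P (fun x => k%:E * f x)%E) ->
  (forall f g : T -> \bar R, measurable_fun setT f -> (forall x, 0 <= f x)%E -> P f ->
    measurable_fun setT g -> (forall x, 0 <= g x)%E -> P g ->
    P (fun x => f x + g x)%E) ->
  (forall u : (T -> \bar R)^nat, (forall n, measurable_fun setT (u n)) ->
    (forall n x, 0 <= u n x)%E -> (forall x, nondecreasing_seq (u ^~ x)) ->
    (forall n, P (u n)) -> P (fun x => limn (u ^~ x))) ->
  forall f : T -> \bar R, measurable_fun setT f ->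
    (forall x, 0 <= f x)%E -> P f.
Proof.
move=> Pindic Pscale Padd Plim f mf f0.
have P0 : P (fun x => 0%E).
  have -> : (fun x : T => 0%E : \bar R) = (fun x => (\1_(set0 : set T) x)%:E).
    by apply/funext => x; rewrite indicE in_set0.
  exact: Pindic.
have Pnn (g : {nnsfun T >-> R}) : P (fun x => (g x)%:E).
  have -> : (fun x => (g x)%:E) = (fun x => \sum_(y <- fset_set (range g))
      (y%:E * (\1_(g @^-1` [set y]) x)%:E))%E.
    apply/funext => x /=; rewrite [g x]fimfunE fsbig_finite//= -sumEFin.
    by apply: eq_bigr => y _; rewrite EFinM.
  have mI (y : R) : measurable_fun setT (fun x => (\1_(g @^-1` [set y]) x : R)%:E).
    exact/measurable_EFinP/measurable_indic.
  have y0 (y : R) : y \in (fset_set (range g) : seq R) -> 0 <= y.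
    change (y \in fset_set (range g) -> 0 <= y).
    by rewrite in_fset_set; [move=> /set_mem[x _ <-]|exact: fimfunP].
  elim: (fset_set (range g) : seq R) y0 => [|y s IHs] s0.
    by under eq_fun do rewrite big_nil.
  under eq_fun do rewrite big_cons.
  have ys0 : 0 <= y by apply: s0; rewrite inE eqxx.
  have s0' z : z \in s -> 0 <= z by move=> zs; apply: s0; rewrite inE zs orbT.
  have ge0 z x : 0 <= z -> (0 <= z%:E * (\1_(g @^-1` [set y]) x : R)%:E)%E.
    by move=> z0; rewrite -EFinM lee_fin mulr_ge0.
  apply: Padd.
  - exact: measurable_funeM.
  - by move=> x; rewrite -EFinM lee_fin mulr_ge0.
  - by apply: Pscale => //; exact: Pindic.
  - by apply: emeasurable_sum => z; exact: measurable_funeM.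
  - move=> x; rewrite big_seq; apply: sume_ge0 => z zs.
    by rewrite -EFinM lee_fin mulr_ge0// s0'.
  - exact: IHs.
have [g [ndg gf]] := approximation measurableT mf (fun x _ => f0 x).
have -> : f = (fun x => limn ((fun n x => (g n x)%:E) ^~ x)).
  by apply/funext => x; apply/esym/cvg_lim => //; exact: gf.
apply: Plim.
- by move=> n; exact/measurable_EFinP.
- by move=> n x /=; rewrite lee_fin.
- by move=> x m n mn; rewrite lee_fin; exact/lefP/ndg.
- by move=> n; exact: Pnn.
Qed.

Lemma integral_preimage_indic d (S : measurableType d) d' (T : measurableType d')
    (R : realType) (mu : {measure set T -> \bar R}) (E : set T) (Y : T -> S) A :
  measurable E -> measurable_fun setT Y -> measurable A ->
  (\int[mu]_(w in E) (\1_A (Y w))%:E = mu (E `&` Y @^-1` A))%E.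
Proof.
move=> mE mY mA; rewrite setIC -(integral_indic _ mE) => [|].
  by apply: eq_integral => w _; rewrite !indicE.
by rewrite -[X in measurable X]setTI; exact: mY.
Qed.

(** Compares the laws of [Y1] on [E1] and of [Y2] on [E2], up to a density on the
    second space: a constant factor, the probability of a coin showing 0, or the
    density of a measure, with [Y1] and [Y2] the identity. *)
Lemma integral_law_density d (S : measurableType d) (R : realType)
    d1 (T1 : measurableType d1) (mu1 : {measure set T1 -> \bar R})
    d2 (T2 : measurableType d2) (mu2 : {measure set T2 -> \bar R})
    (E1 : set T1) (E2 : set T2) (Y1 : T1 -> S) (Y2 : T2 -> S) (p : T2 -> R) :
  measurable E1 -> measurable E2 -> measurable_fun setT Y1 -> measurable_fun setT Y2 ->
  measurable_fun setT p -> (forall w, 0 <= p w) ->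
  (forall A, measurable A ->
    mu1 (E1 `&` Y1 @^-1` A) = \int[mu2]_(w in E2 `&` Y2 @^-1` A) (p w)%:E)%E ->
  forall f : S -> \bar R, measurable_fun setT f -> (forall x, 0 <= f x)%E ->
  (\int[mu1]_(w in E1) f (Y1 w) = \int[mu2]_(w in E2) (f (Y2 w) * (p w)%:E))%E.
Proof.
move=> mE1 mE2 mY1 mY2 mp p0 H.
have pE0 w : (0 <= (p w)%:E)%E by rewrite lee_fin.
have mc (f : S -> \bar R) (D : set T1) :
    measurable_fun setT f -> measurable_fun D (fun w => f (Y1 w)).
  by move=> mf; apply: measurable_funTS; exact: measurableT_comp.
have mcp (f : S -> \bar R) (D : set T2) :
    measurable_fun setT f -> measurable_fun D (fun w => f (Y2 w) * (p w)%:E)%E.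
  move=> mf; apply: measurable_funTS; apply: emeasurable_funM.
    exact: measurableT_comp.
  exact/measurable_EFinP.
apply: ge0_measurable_ind.
- move=> A mA; rewrite integral_preimage_indic// H// integral_mkcondr.
  apply: eq_integral => w _; rewrite patchE indicE.
  by rewrite (_ : (w \in Y2 @^-1` A) = (Y2 w \in A))//; case: ifP => _;
    rewrite ?mul1e ?mul0e.
- move=> k f k0 mf f0 IH; rewrite ge0_integralZl_EFin//; last exact: mc.
  rewrite IH -ge0_integralZl_EFin//; [|by move=> w _; rewrite mule_ge0|exact: mcp].
  by apply: eq_integral => w _; rewrite muleA.
- move=> f g mf f0 IHf mg g0 IHg; rewrite ge0_integralD//; [|exact: mc..].
  rewrite IHf IHg -ge0_integralD//; try exact: mcp.
  + by apply: eq_integral => w _; rewrite ge0_muleDl.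
  + by move=> w _; rewrite mule_ge0.
  + by move=> w _; rewrite mule_ge0.
- move=> u mu_ u0 ndu IH.
  rewrite (@monotone_convergence _ _ _ _ E1 mE1 (fun n w => u n (Y1 w)))//;
    [|first [by move=> w _; exact: ndu|by move=> n; exact: mc]..].
  under eq_fun do rewrite IH.
  rewrite -(@monotone_convergence _ _ _ _ E2 mE2 (fun n w => u n (Y2 w) * (p w)%:E)%E)//.
  + apply: eq_integral => w _; rewrite limeMr//.
    by apply: ereal_nondecreasing_is_cvgn; exact: ndu.
  + by move=> n; exact: mcp.
  + by move=> n w _; rewrite mule_ge0.
  + by move=> w _ m n mn; rewrite lee_wpmul2r//; exact: ndu.
Qed.

Lemma le_measure_integral d (T : measurableType d) (R : realType)
    (mu nu : {measure set T -> \bar R}) (f : T -> \bar R) :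
  (forall A, measurable A -> mu A <= nu A)%E ->
  measurable_fun setT f -> (forall x, 0 <= f x)%E ->
  (\int[mu]_x f x <= \int[nu]_x f x)%E.
Proof.
move=> mn; move: f; apply: ge0_measurable_ind.
- by move=> A mA; rewrite !integral_indic//= setIT mn.
- move=> k f k0 mf f0 IH; rewrite !ge0_integralZl// ?lee_fin//.
  by rewrite lee_wpmul2l// lee_fin.
- by move=> f g mf f0 IHf mg g0 IHg; rewrite !ge0_integralD// leeD.
- move=> u mu_ u0 ndu IH.
  have ndi (m : {measure set T -> \bar R}) :
      nondecreasing_seq (fun n => \int[m]_x u n x)%E.
    by move=> p q pq; apply: ge0_le_integral => // x _; exact: ndu.
  have ndu' (x : T) : [set: T] x -> nondecreasing_seq (u ^~ x) by move=> _; exact: ndu.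
  rewrite !monotone_convergence//.
  apply: lee_lim; [exact: ereal_nondecreasing_is_cvgn..|].
  by near=> n; exact: IH.
Unshelve. all: by end_near. Qed.

(** * Moments and convolution of normal laws *)

Section standard_normal.
Context (R : realType).
Notation mu := (@lebesgue_measure R).
Notation phi := (normal_pdf (0 : R) 1).
Notation gam := (normal_prob (0 : R) 1).

Let phiE x : phi x = normal_peak (1 : R) * expR (- x ^+ 2 / 2).
Proof.
by rewrite normal_pdfE ?oner_neq0// /normal_fun subr0 expr1n.
Qed.

Lemma integral_normal_prob (m s : R) (f : R -> \bar R) :
  measurable_fun setT f -> (forall x, 0 <= f x)%E ->
  (\int[normal_prob m s]_x f x = \int[mu]_x (f x * (normal_pdf m s x)%:E))%E.
Proof.
move=> mf f0; apply: (@integral_law_density _ _ _ _ _ (normal_prob m s) _ _ mu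
  setT setT id id (normal_pdf m s)) => //.
- exact: measurable_normal_pdf.
- by move=> x; exact: normal_pdf_ge0.
Qed.

Let is_derive_phi (x : R) : is_derive x 1 phi (- x * phi x).
Proof.
have -> : phi = (fun x => normal_peak (1 : R) * expR (- x ^+ 2 / 2)).
  exact/funext/phiE.
apply: is_derive_eq.
by rewrite /GRing.scale/= !mulr1; field.
Qed.

Let is_derive_xphi (x : R) :
  is_derive x 1 (fun x => x * phi x) ((1 - x ^+ 2) * phi x).
Proof.
apply: is_derive_eq; first exact: (is_deriveM (is_derive_id x 1) (is_derive_phi x)).
by rewrite /GRing.scale/=; ring.
Qed.

Let cts_phi : continuous phi.
Proof. by apply: continuous_normal_pdf; exact: oner_neq0. Qed.

Let cts_xphi : continuous (fun x : R => x * phi x).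
Proof. by move=> x; apply: cvgM; [exact: cvg_id|exact: cts_phi]. Qed.

Let cts_xxphi : continuous (fun x : R => x ^+ 2 * phi x).
Proof.
by move=> x; apply: cvgM; [exact: sqr_continuous|exact: cts_phi].
Qed.

Let phi_ge0 (x : R) : 0 <= phi x. Proof. exact: normal_pdf_ge0. Qed.

Let xxphi_ge0 (x : R) : 0 <= x ^+ 2 * phi x.
Proof. by rewrite mulr_ge0// sqr_ge0. Qed.

Let cvg_xphi : x * phi x @[x --> +oo%R] --> (0 : R).
Proof.
apply: (@squeeze_cvgr _ _ _ _ (cst 0) (fun x => 2 * normal_peak 1 * x^-1)).
- near=> x; rewrite phiE.
  have x0 : 0 < x by near: x; exact: nbhs_pinfty_gt.
  rewrite mulr_ge0 ?mulr_ge0 ?(ltW x0) ?expR_ge0 ?normal_peak_ge0//=.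
  rewrite mulrCA [2 * _]mulrC -mulrA ler_wpM2l ?normal_peak_ge0//.
  rewrite ler_pdivlMr// mulrAC -expr2 mulNr expRN ler_pdivrMr ?expR_gt0//.
  rewrite -ler_pdivrMl// mulrC.
  by apply: le_trans (expR_ge1Dx _); rewrite lerDr.
- exact: cvg_cst.
- have -> : (0 : R) = 2 * normal_peak 1 * 0 by rewrite mulr0.
  apply: cvgM; first exact: cvg_cst.
  by apply/gtr0_cvgV0; [near=> x; near: x; exact: nbhs_pinfty_gt|exact: cvg_id].
Unshelve. all: by end_near. Qed.

Let mphi (A : set R) : measurable_fun A (fun x : R => (phi x)%:E).
Proof.
by apply: measurable_funTS; apply/measurable_EFinP; exact: measurable_normal_pdf.
Qed.

Let mxxphi (A : set R) : measurable_fun A (fun x : R => (x ^+ 2 * phi x)%:E).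
Proof.
apply: measurable_funTS; apply/measurable_EFinP.
by apply: measurable_funM; [exact: measurable_funX|exact: measurable_normal_pdf].
Qed.

(* The primitive x * phi x turns the second moment on each piece into the mass
   of that piece, up to a boundary term that cancels between the pieces. *)
Let second_moment01 : (\int[mu]_(x in `[0%R, 1%R]) (phi x)%:E =
  (phi 1)%:E + \int[mu]_(x in `[0%R, 1%R]) (x ^+ 2 * phi x)%:E)%E.
Proof.
have := @continuous_FTC2 R (fun x => (1 - x ^+ 2) * phi x) (fun x => x * phi x)
  0 1 ltr01.
rewrite mul0r sube0 mul1r => <-.
- rewrite -ge0_integralD//=.
  + by apply: eq_integral => x _; rewrite -EFinD; congr EFin; ring.
  + move=> x; rewrite in_itv/= => /andP[x0 x1].
    by rewrite lee_fin mulr_ge0// subr_ge0 expr_le1.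
  + apply: measurable_funTS; apply/measurable_EFinP.
    apply: measurable_funM; last exact: measurable_normal_pdf.
    by apply: measurable_funB => //; exact: measurable_funX.
  + by move=> x _; rewrite lee_fin.
  + exact: mxxphi.
- apply: continuous_subspaceT => /= x; apply: cvgM; last exact: cts_phi.
  by apply: cvgB; [exact: cvg_cst|exact: sqr_continuous].
- split => [x _| |].
  + exact: (@ex_derive _ _ _ _ _ _ _ (is_derive_xphi x)).
  + by apply: cvg_at_right_filter; exact: cts_xphi.
  + by apply: cvg_at_left_filter; exact: cts_xphi.
- by move=> x _; rewrite derive1E (@derive_val _ _ _ _ _ _ _ (is_derive_xphi x)).
Qed.

Let second_moment1y : (\int[mu]_(x in `[1%R, +oo[) (x ^+ 2 * phi x)%:E =
  (phi 1)%:E + \int[mu]_(x in `[1%R, +oo[) (phi x)%:E)%E.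
Proof.
have dF (x : R) : is_derive x 1 (fun x => - (x * phi x)) ((x ^+ 2 - 1) * phi x).
  by apply: is_derive_eq; first exact: (is_deriveN (is_derive_xphi x));
     rewrite -mulNr opprB.
have := @ge0_continuous_FTC2y R (fun x => (x ^+ 2 - 1) * phi x)
  (fun x => - (x * phi x)) 1 (- 0).
rewrite oppr0 mul1r sub0e EFinN oppeK => <-.
- rewrite -ge0_integralD//=.
  + by apply: eq_integral => x _; rewrite -EFinD; congr EFin; ring.
  + move=> x; rewrite in_itv/= andbT => x1.
    by rewrite lee_fin mulr_ge0// subr_ge0 expr_ge1// (le_trans _ x1).
  + apply: measurable_funTS; apply/measurable_EFinP.
    apply: measurable_funM; last exact: measurable_normal_pdf.
    by apply: measurable_funB => //; exact: measurable_funX.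
  + by move=> x _; rewrite lee_fin.
  + exact: mphi.
- by move=> x x1; rewrite mulr_ge0// subr_ge0 expr_ge1// (le_trans _ x1).
- apply: continuous_subspaceT => /= x; apply: cvgM; last exact: cts_phi.
  by apply: cvgB; [exact: sqr_continuous|exact: cvg_cst].
- have : - (x * phi x) @[x --> +oo%R] --> - (0 : R) by exact: cvgN cvg_xphi.
  by rewrite oppr0.
- by move=> x _; exact: (@ex_derive _ _ _ _ _ _ _ (dF x)).
- apply: cvg_at_right_filter; have /cvgN := @cts_xphi 1.
  by rewrite /= mul1r.
- by move=> x _; rewrite derive1E (@derive_val _ _ _ _ _ _ _ (dF x)).
Qed.

Lemma normal_second_moment : (\int[gam]_x (x ^+ 2)%:E = 1)%E.
Proof.
rewrite integral_normal_prob; last 2 first.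
  by apply/measurable_EFinP; exact: measurable_funX.
  by move=> x; rewrite lee_fin sqr_ge0.
under eq_integral do rewrite -EFinM.
have sp x : phi (- x) = phi x by rewrite !phiE sqrrN.
have halves (f : R -> R) : (forall A : set R, measurable_fun A (fun x : R => (f x)%:E)) ->
    (forall x, 0 <= f x) ->
    (\int[mu]_(x in [set x | (0 <= x)%R]) (f x)%:E =
     \int[mu]_(x in `[0%R, 1%R]) (f x)%:E + \int[mu]_(x in `[1%R, +oo[) (f x)%:E)%E.
  move=> mf f0; rewrite -set_itvcy -integral_itv_bndo_bndc; last exact: mf.
  rewrite -ge0_integral_setU//=.
  - by rewrite -itv_bndbnd_setU// bnd_simp.
  - exact: mf.
  - by move=> x _; rewrite lee_fin.
  - apply/disj_setPS => x [] /=; rewrite !in_itv/= andbT => /andP[_ x1].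
    by rewrite leNgt x1.
have spp : (fun x => x ^+ 2 * phi x) =1 (fun x => x ^+ 2 * phi x) \o -%R.
  by move=> x /=; rewrite sp sqrrN.
rewrite (ge0_symfun_integralT xxphi_ge0 cts_xxphi spp).
rewrite -(integral_normal_pdf 0 1) (ge0_symfun_integralT phi_ge0 cts_phi); last first.
  by move=> x /=; rewrite sp.
congr (_ * _)%E; rewrite halves// halves// second_moment01 second_moment1y.
by rewrite addeCA addeA.
Qed.

Lemma normal_integralN (f : R -> \bar R) :
  measurable_fun setT f -> (forall x, 0 <= f x)%E ->
  (\int[gam]_x f (- (x : R))%R = \int[gam]_x f x)%E.
Proof.
move=> mf f0; rewrite (integral_normal_prob 0 1 mf f0)
  (integral_normal_prob 0 1 (f := fun x => f (- x)%R))//; last exact: measurableT_comp.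
have -> : (\int[mu]_x (f (- (x : R))%R * (phi x)%:E) =
    \int[mu]_x ((fun y : R => f y * (phi y)%:E) (- (x : R))%R))%E.
  by apply: eq_integral => x _ /=; rewrite !phiE sqrrN.
pose G (y : measurableTypeR R) := (f y * (phi y)%:E)%E.
have mG : measurable_fun setT G by apply: emeasurable_funM => //; exact: mphi.
have mN : measurable_fun setT (-%R : measurableTypeR R -> measurableTypeR R).
  exact: oppr_measurable.
have G0 : {in setT, forall y, (0 <= G y)%E}.
  by move=> y _; rewrite mule_ge0// lee_fin.
have := ge0_integral_pushforward mN mu measurableT mG G0.
rewrite preimage_setT /= => <-.
by apply: eq_measure_integral => A mA _; exact: lebesgue_measureN.
Qed.

Lemma integrable_normal_id : gam.-integrable setT (fun x : R => x%:E).
Proof.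
apply: (@le_integrable _ _ _ gam setT measurableT _ (fun x => (1 + x ^+ 2)%:E)).
- exact/measurable_EFinP.
- move=> x _ /=; rewrite lee_fin [leRHS]ger0_norm ?addr_ge0 ?sqr_ge0//.
  by rewrite real_ler_norml ?num_real//; apply/andP; split; nra.
- under eq_fun do rewrite EFinD.
  apply: integrableD => //; first exact: finite_measure_integrable_cst.
  apply/integrableP; split; first by apply/measurable_EFinP; exact: measurable_funX.
  under eq_integral do rewrite gee0_abs ?lee_fin ?sqr_ge0//.
  by rewrite normal_second_moment ltry.
Qed.

Lemma normal_mean : (\int[gam]_x x%:E = 0)%E.
Proof.
have gi := integrable_normal_id.
rewrite integralE.
have -> : (\int[gam]_x (EFin^\- x) = \int[gam]_x (EFin^\+ x))%E.
  transitivity (\int[gam]_x (EFin^\+ (- (x : R))%R))%E.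
    by apply: eq_integral => x _; rewrite funeposE funenegE EFinN.
  apply: (@normal_integralN EFin^\+%E); last by move=> x; exact: funepos_ge0.
  by apply: measurable_funepos; apply/measurable_EFinP.
rewrite subee//; apply: integrable_pos_fin_num => //.
Qed.

Lemma integral_affine (m s : R) (f : R -> \bar R) : 0 < s ->
  measurable_fun setT f -> (forall x, 0 <= f x)%E ->
  (\int[mu]_x f x = s%:E * \int[mu]_x f (m + s * x)%R)%E.
Proof.
move=> s0 mf f0.
pose F (x : R) := (m + s * x : measurableTypeR R).
have mF : measurable_fun setT F.
  by apply: measurable_funD => //; exact: measurable_funM.
pose nu : {measure set (measurableTypeR R) -> \bar R} :=
  mscale (NngNum (ltW s0)) (pushforward mu F).
transitivity (\int[nu mF]_x f x)%E; last first.
  rewrite ge0_integral_mscale//=; congr (_ * _)%E.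
  by rewrite ge0_integral_pushforward.
apply: eq_measure_integral => //= A mA _; apply: lebesgue_measure_unique => //= _ [[a b]] _ <-.
rewrite /nu /mscale/= /pushforward.
have -> : F @^-1` [set` `]a, b]] = `](a - m) / s, (b - m) / s]%classic.
  apply/seteqP; split => x /=; rewrite !in_itv/= /F.
    by rewrite ltr_pdivrMr// ler_pdivlMr// mulrC => /andP[? ?]; lra.
  by rewrite ltr_pdivrMr// ler_pdivlMr// mulrC => /andP[? ?]; lra.
rewrite !lebesgue_measure_itv/= !lte_fin ltr_pM2r ?invr_gt0// ltrD2r.
case: ifP => _; last by rewrite mule0.
by rewrite -EFinD -EFinM; congr EFin; field; exact: lt0r_neq0.
Qed.

Lemma normal_peakE (s : R) : 0 < s -> normal_peak s = s^-1 * normal_peak 1.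
Proof.
move=> s0; rewrite /normal_peak expr1n mul1r -mulrnAr sqrtrM ?sqr_ge0//.
by rewrite sqrtr_sqr gtr0_norm// invfM.
Qed.

(** A normal variable is an affine image of a standard one. *)
Lemma integral_normal_affine (m s : R) (f : R -> \bar R) : 0 < s ->
  measurable_fun setT f -> (forall x, 0 <= f x)%E ->
  (\int[normal_prob m s]_x f x = \int[gam]_x f (m + s * x)%R)%E.
Proof.
move=> s0 mf f0; rewrite (integral_normal_prob m s mf f0).
have mF : measurable_fun setT (fun x : R => m + s * x).
  by apply: measurable_funD => //; exact: measurable_funM.
have mfF : measurable_fun setT (fun x : R => f (m + s * x)).
  exact: (measurableT_comp mf mF).
have fF0 (x : R) : (0 <= f (m + s * x)%R)%E by exact: f0.
rewrite (integral_normal_prob 0 1 mfF fF0).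
have mp : measurable_fun setT (fun x => (normal_pdf m s x)%:E).
  by apply/measurable_EFinP; exact: measurable_normal_pdf.
rewrite (integral_affine m s0); last 2 first.
  exact: emeasurable_funM.
  by move=> x; rewrite mule_ge0// lee_fin normal_pdf_ge0.
rewrite -ge0_integralZl//=; last 3 first.
- by apply: emeasurable_funM => //; exact: (measurableT_comp mp mF).
- by move=> x _; rewrite mule_ge0// lee_fin normal_pdf_ge0.
- by rewrite lee_fin ltW.
apply: eq_integral => x _; rewrite muleCA -EFinM; congr (_ * _%:E)%E.
rewrite phiE normal_pdfE ?lt0r_neq0// normal_peakE// /normal_fun.
rewrite !mulrA divff ?lt0r_neq0// mul1r; congr (_ * expR _).
by field; exact: lt0r_neq0.
Qed.

Let normal_pdf_mul (a b x y z : R) : 0 < a -> 0 < b ->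
  normal_pdf x a y * normal_pdf y b z =
  normal_pdf x (Num.sqrt (a ^+ 2 + b ^+ 2)) z *
  normal_pdf ((x * b ^+ 2 + z * a ^+ 2) / (a ^+ 2 + b ^+ 2))
    (a * b / Num.sqrt (a ^+ 2 + b ^+ 2)) y.
Proof.
move=> a0 b0; set s := Num.sqrt _.
have ss : s ^+ 2 = a ^+ 2 + b ^+ 2 by rewrite sqr_sqrtr// addr_ge0// sqr_ge0.
have s0 : 0 < s by rewrite sqrtr_gt0 addr_gt0// exprn_gt0.
have t0 : 0 < a * b / s by rewrite divr_gt0// mulr_gt0.
rewrite !normal_pdfE ?lt0r_neq0// (normal_peakE a0) (normal_peakE b0).
rewrite (normal_peakE s0) (normal_peakE t0) /normal_fun mulrACA -expRD.
rewrite [RHS]mulrACA -expRD; congr (_ * expR _).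
  by field; rewrite !lt0r_neq0.
rewrite -ss.
have aE : a ^+ 2 = s ^+ 2 - b ^+ 2 by rewrite ss; ring.
have : s ^+ 2 - b ^+ 2 != 0 by rewrite ss addrK expf_neq0// lt0r_neq0.
move=> h.
have -> : (a * b / s) ^+ 2 = (s ^+ 2 - b ^+ 2) * b ^+ 2 / s ^+ 2.
  by rewrite -aE; field; exact: lt0r_neq0.
rewrite aE; by field; rewrite h !lt0r_neq0.
Qed.

(** Completing the square in the product of two normal densities leaves the
    normal density with the added variances, times one that integrates out. *)
Lemma normal_convolution (x a b : R) (f : R -> \bar R) : 0 < a -> 0 < b ->
  measurable_fun setT f -> (forall x, 0 <= f x)%E ->
  (\int[gam]_u \int[gam]_v f (x + a * u + b * v)%R =
   \int[gam]_u f (x + Num.sqrt (a ^+ 2 + b ^+ 2) * u)%R)%E.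
Proof.
move=> a0 b0 mf f0; set s := Num.sqrt _.
have s0 : 0 < s by rewrite sqrtr_gt0 addr_gt0// exprn_gt0.
have mpdf : measurable_fun setT (fun p : R * R => (normal_pdf p.1 b p.2)%:E).
  apply/measurable_EFinP.
  under eq_fun do rewrite normal_pdfE ?lt0r_neq0// /normal_fun.
  apply: measurable_funM => //; apply: measurableT_comp => //.
  apply: measurable_funM => //; apply: measurableT_comp => //.
  by apply: measurable_funX; exact: measurable_funB.
pose H (p : R * R) := (f p.2 * (normal_pdf p.1 b p.2)%:E)%E.
have mH : measurable_fun setT H.
  by apply: emeasurable_funM => //; exact: measurableT_comp.
have H0 p : (0 <= H p)%E by rewrite mule_ge0// lee_fin normal_pdf_ge0.
pose h y := (\int[mu]_z H (y, z))%E.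
have mh : measurable_fun setT h by exact: measurable_fun_fubini_tonelli_F.
have h0 y : (0 <= h y)%E by apply: integral_ge0 => z _; exact: H0.
transitivity (\int[gam]_u h (x + a * u)%R)%E.
  apply: eq_integral => u _.
  by rewrite -(integral_normal_affine (x + a * u) b0 mf f0) (integral_normal_prob _ _ mf f0).
rewrite -(integral_normal_affine x a0 mh h0) (integral_normal_prob x a mh h0).
rewrite -(integral_normal_affine x s0 mf f0) (integral_normal_prob x s mf f0).
pose K (p : R * R) := (H p * (normal_pdf x a p.1)%:E)%E.
have mK : measurable_fun setT K.
  apply: emeasurable_funM => //; apply/measurable_EFinP.
  by apply: (measurableT_comp (measurable_normal_pdf x a)).
have K0 p : (0 <= K p)%E by rewrite mule_ge0// lee_fin normal_pdf_ge0.
transitivity (\int[mu]_y \int[mu]_z K (y, z))%E.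
  apply: eq_integral => y _; rewrite /h -ge0_integralZr//.
  - by apply: (measurableT_comp mH); exact: measurable_pair1.
  - by rewrite lee_fin normal_pdf_ge0.
etransitivity; first exact: (@fubini_tonelli _ _ (measurableTypeR R) (measurableTypeR R) R mu mu K mK K0).
apply: eq_integral => z _.
rewrite /K /H/=.
under eq_integral do rewrite -muleA -EFinM [(_ * normal_pdf x a _)%R]mulrC normal_pdf_mul// EFinM muleA.
rewrite ge0_integralZl//; last 3 first.
- by apply/measurable_EFinP; exact: measurable_normal_pdf.
- by move=> y _; rewrite lee_fin normal_pdf_ge0.
- by rewrite mule_ge0// lee_fin normal_pdf_ge0.
by rewrite integral_normal_pdf mule1.
Qed.

End standard_normal.

(** * Second order Taylor expansions *)

Section taylor.
Context (R : realType).
Implicit Types f g : R -> R.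

Let isdB f g (x a b : R) : is_derive x 1 f a -> is_derive x 1 g b ->
  is_derive x 1 (fun t : R => f t - g t) (a - b).
Proof. by move=> df dg; exact: (is_deriveB df dg). Qed.

Let isdM f g (x a b : R) : is_derive x 1 f a -> is_derive x 1 g b ->
  is_derive x 1 (fun t : R => f t * g t) (f x * b + g x * a).
Proof. by move=> df dg; exact: (is_deriveM df dg). Qed.

Let isdC (c x : R) : is_derive x 1 (fun _ : R => c) (0 : R).
Proof. exact: is_derive_cst. Qed.

Let isdI (x : R) : is_derive x 1 (fun t : R => t) (1 : R).
Proof. exact: is_derive_id. Qed.

Let isd_shift g g' (x t : R) : (forall x : R, is_derive x 1 g (g' x)) ->
  is_derive t 1 (fun t : R => g (x + t)) (g' (x + t)).
Proof.
move=> dg.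
have dx : is_derive t 1 (fun t : R => x + t) (0 + 1).
  exact: (is_deriveD (isdC x t) (isdI t)).
have := @is_derive1_comp _ g (fun t => x + t) t (g' (x + t)) (0 + 1) (dg _) dx.
by rewrite add0r mulr1.
Qed.

Lemma mvt_bound g g' (B h : R) : (forall t : R, is_derive t 1 g (g' t)) ->
  g 0 = 0 -> (forall t, `|t| <= `|h| -> `|g' t| <= B) -> `|g h| <= B * `|h|.
Proof.
move=> dg g0 Bg.
have cg (A : set R) : {within A, continuous g}.
  apply: continuous_subspaceT => t; apply: differentiable_continuous.
  by apply/derivable1_diffP; exact: ex_derive.
have [h0|h0] := leP 0 h.
  have [//|c + gc] := @MVT_segment _ g g' 0 h h0.
  rewrite in_itv/= => /andP[c0 ch].
  have := gc; rewrite g0 !subr0 => ->; rewrite normrM ler_wpM2r//.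
  by apply: Bg; rewrite !ger0_norm.
have [//|c + gc] := @MVT_segment _ g g' h 0 (ltW h0).
rewrite in_itv/= => /andP[hc c0].
have := gc; rewrite g0 !sub0r => gh.
rewrite -normrN gh normrM normrN ler_wpM2r//.
by apply: Bg; rewrite !ler0_norm// ?lerN2// ltW.
Qed.

Definition omega (h : R) : R := Num.min (h ^+ 2) (`|h| ^+ 3).

(** The uniform form of a second order expansion that survives averaging over
    translates, with [f1] and [f2] in the place of the derivatives. *)
Definition taylor2 (C : R) f f1 f2 := forall x h,
  `|f (x + h) - f x - f1 x * h - f2 x * (h ^+ 2 / 2)| <= C * omega h.

Lemma derive_taylor2 (C : R) f f1 f2 f3 :
  (forall x : R, is_derive x 1 f (f1 x)) -> (forall x : R, is_derive x 1 f1 (f2 x)) ->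
  (forall x : R, is_derive x 1 f2 (f3 x)) ->
  (forall x, `|f2 x| <= C) -> (forall x, `|f3 x| <= C) -> 
  taylor2 (2 * C) f f1 f2.
Proof.
move=> d1 d2 d3 C2 C3 x h.
have C0 : 0 <= C by exact: le_trans (C2 0).
have lip g g' (t : R) : (forall x : R, is_derive x 1 g (g' x)) ->
    (forall x, `|g' x| <= C) -> `|g (x + t) - g x| <= C * `|t|.
  move=> dg Cg; apply: (@mvt_bound (fun t => g (x + t) - g x) (fun t => g' (x + t))).
  - by move=> u; apply: is_derive_eq (isdB (isd_shift _ _ dg) (isdC _ _)) (subr0 _).
  - by rewrite addr0 subrr.
  - by move=> u _.
have step g g1 g2 (t : R) : (forall x : R, is_derive x 1 g (g1 x)) ->
    (forall x : R, is_derive x 1 g1 (g2 x)) -> (forall x, `|g2 x| <= C) ->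
    `|g (x + t) - g x - g1 x * t| <= C * t ^+ 2.
  move=> dg dg1 Cg2; rewrite -real_normK ?num_real// expr2 mulrA.
  apply: (@mvt_bound (fun t => g (x + t) - g x - g1 x * t)
                     (fun t => g1 (x + t) - g1 x)).
  - move=> u; apply: (is_derive_eq (isdB (isdB (isd_shift _ _ dg) (isdC _ _))
      (isdM (isdC _ _) (isdI _)))).
    by ring.
  - by rewrite addr0 subrr mulr0 subr0.
  - by move=> u ut; apply: le_trans (lip g1 g2 u dg1 Cg2) _; rewrite ler_wpM2l.
rewrite /omega /Num.min; case: ifP => _.
  have -> : 2 * C * h ^+ 2 = C * h ^+ 2 + C * h ^+ 2 by ring.
  apply: (le_trans (ler_normB _ _)); rewrite lerD//; first exact: step.
  rewrite normrM ler_pM// ger0_norm ?divr_ge0 ?sqr_ge0//.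
  by rewrite ler_pdivrMr// ler_peMr ?sqr_ge0// ler1n.
apply: (@le_trans _ _ (C * h ^+ 2 * `|h|)).
  apply: (@mvt_bound (fun h => f (x + h) - f x - f1 x * h - f2 x * (h ^+ 2 / 2))
    (fun h => f1 (x + h) - f1 x - f2 x * h)).
  - move=> t.
    have dsq : is_derive t 1 (fun t : R => t ^+ 2 / 2) t.
      apply: (is_derive_eq (isdM (isdM (isdI _) (isdI _)) (isdC _ _))).
      by field.
    apply: (is_derive_eq (isdB (isdB (isdB (isd_shift _ _ d1) (isdC _ _))
      (isdM (isdC _ _) (isdI _))) (isdM (isdC _ _) dsq))).
    by ring.
  - by rewrite addr0 subrr mulr0 expr0n/= mul0r mulr0 !subr0.
  - move=> t th; apply: (le_trans (step f1 f2 f3 t d2 d3 C3)).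
    by rewrite ler_wpM2l// -[leLHS]real_normK ?num_real//
      -[leRHS]real_normK ?num_real// lerXn2r.
rewrite -[h ^+ 2]real_normK ?num_real// -mulrA -exprSr ler_wpM2r ?exprn_ge0//.
by rewrite ler_peMl// ler1n.
Qed.

(** Smooth approximations [logistic l b] of the indicator of [[b, +oo[]. *)
Definition logistic (l b x : R) : R := (1 + expR (- (l * (x - b))))^-1.

Let den_gt0 (y : R) : 0 < 1 + expR y.
Proof. by rewrite addr_gt0// expR_gt0. Qed.

Lemma logistic_ge0 l b x : 0 <= logistic l b x.
Proof. by rewrite invr_ge0 ltW. Qed.

Lemma logistic_le1 l b x : logistic l b x <= 1.
Proof. by rewrite invf_le1// lerDl expR_ge0. Qed.

Let is_derive_logistic (l b x : R) : is_derive x 1 (logistic l b)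
  (l * (logistic l b x - logistic l b x ^+ 2)).
Proof.
rewrite /logistic.
have dlin : is_derive x 1 (fun x : R => - (l * (x - b))) (- l).
  by apply: is_derive_eq; rewrite /GRing.scale/=; ring.
have dexp : is_derive x 1 (fun x : R => 1 + expR (- (l * (x - b))))
    (expR (- (l * (x - b))) * - l).
  have de := @is_derive1_comp _ expR _ x _ _ (is_derive_expR _) dlin.
  exact: (is_derive_eq (is_deriveD (isdC 1 x) de) (add0r _)).
have ne0 : 1 + expR (- (l * (x - b))) != 0 by rewrite lt0r_neq0.
have dV := @is_deriveV R (fun x : R => 1 + expR (- (l * (x - b)))) x _ 1 ne0 dexp.
apply: (is_derive_eq dV).
by rewrite /GRing.scale/=; field.
Qed.

Lemma continuous_logistic l b : continuous (logistic l b).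
Proof.
move=> x; apply: differentiable_continuous; apply/derivable1_diffP.
exact: (@ex_derive _ _ _ _ _ _ _ (is_derive_logistic l b x)).
Qed.

Lemma measurable_logistic l b : measurable_fun setT (logistic l b).
Proof. by apply: continuous_measurable_fun; exact: continuous_logistic. Qed.

Definition logistic1 (l b x : R) := l * (logistic l b x - logistic l b x ^+ 2).
Definition logistic2 (l b x : R) :=
  l ^+ 2 * (logistic l b x - logistic l b x ^+ 2) * (1 - 2 * logistic l b x).

Lemma logistic_taylor2 (l b : R) : 0 < l ->
  taylor2 (2 * (l ^+ 2 + l ^+ 3)) (logistic l b) (logistic1 l b) (logistic2 l b).
Proof.
move=> l0.
pose f := logistic l b.
have f01 x : 0 <= f x <= 1 by rewrite logistic_ge0 logistic_le1.
have d0 x := is_derive_logistic l b x.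
pose f3 x := l ^+ 3 * (f x - f x ^+ 2) * (1 - 6 * f x + 6 * f x ^+ 2).
have df (x : R) : is_derive x 1 f (l * (f x - f x ^+ 2)) by exact: d0.
have d1 (x : R) : is_derive x 1 (logistic1 l b) (logistic2 l b x).
  apply: (is_derive_eq (isdM (isdC l x) (isdB (df x) (isdM (df x) (df x))))).
  by rewrite /logistic2 -/(f x); ring.
have d2 (x : R) : is_derive x 1 (logistic2 l b) (f3 x).
  apply: (is_derive_eq (isdM (isdM (isdC (l ^+ 2) x) (isdB (df x)
    (isdM (df x) (df x)))) (isdB (isdC 1 x) (isdM (isdC 2 x) (df x))))).
  by rewrite /f3; ring.
have := @derive_taylor2 (l ^+ 2 + l ^+ 3) f _ _ f3 df d1 d2; apply.
- move=> x; rewrite /logistic2 -/(f x); have := f01 x; move: (f x) => y /andP[y0 y1].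
  rewrite -mulrA normrM gtr0_norm ?exprn_gt0//.
  apply: (@le_trans _ _ (l ^+ 2)); last by rewrite lerDl exprn_ge0// ltW.
  rewrite ler_piMr ?exprn_ge0// ?(ltW l0)// ler_norml; apply/andP; split; nra.
- move=> x; rewrite /f3; have := f01 x; move: (f x) => y /andP[y0 y1].
  rewrite -mulrA normrM gtr0_norm ?exprn_gt0//.
  apply: (@le_trans _ _ (l ^+ 3)); last by rewrite lerDr exprn_ge0// ltW.
  rewrite ler_piMr ?exprn_ge0// ?(ltW l0)//.
  have z0 : 0 <= y - y ^+ 2 by nra.
  have z1 : y - y ^+ 2 <= 4^-1 by have := sqr_ge0 (y - 2^-1); nra.
  have -> : 1 - 6 * y + 6 * y ^+ 2 = 1 - 6 * (y - y ^+ 2) by ring.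
  move: (y - y ^+ 2) z0 z1 => z z0 z1.
  rewrite ler_norml; apply/andP; split; nra.
Qed.

Lemma logistic_lip (l b x y : R) : 0 < l ->
  `|logistic l b x - logistic l b y| <= l * `|x - y|.
Proof.
move=> l0.
have := @mvt_bound (fun t => logistic l b (y + t) - logistic l b y)
  (fun t => logistic1 l b (y + t)) l (x - y).
rewrite subrKC; apply.
- move=> t.
  exact: is_derive_eq (isdB (isd_shift _ _ (is_derive_logistic l b)) (isdC _ _)) (subr0 _).
- by rewrite addr0 subrr.
- move=> t _; rewrite /logistic1.
  have := logistic_ge0 l b (y + t); have := logistic_le1 l b (y + t).
  move: (logistic l b (y + t)) => z z1 z0.
  rewrite normrM gtr0_norm// ler_piMr// ?(ltW l0)// ler_norml.
  by apply/andP; split; nra.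
Qed.

Lemma logistic_le (l b x e : R) : 0 < l -> 0 < e -> x <= b - e ->
  logistic l b x <= (l * e)^-1.
Proof.
move=> l0 e0 xb; rewrite lef_pV2 ?posrE ?mulr_gt0//.
have : l * e <= - (l * (x - b)) by rewrite -mulrN ler_pM2l//; lra.
by have := expR_ge1Dx (- (l * (x - b))); lra.
Qed.

Lemma logistic_ge (l b x e : R) : 0 < l -> 0 < e -> b + e <= x ->
  1 - (l * e)^-1 <= logistic l b x.
Proof.
move=> l0 e0 xb.
have -> : logistic l b x = 1 - logistic l (- b) (- x).
  rewrite /logistic.
  have -> : - (l * (- x - - b)) = - - (l * (x - b)) by ring.
  rewrite [expR (- - _)]expRN.
  by field; rewrite !lt0r_neq0 ?expR_gt0// addrC.
by rewrite lerD2l lerN2; apply: logistic_le => //; lra.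
Qed.

End taylor.

(** * Averages of bounded functions *)

Lemma bounded_integrable d (T : measurableType d) (R : realType)
    (P : probability T R) (f : T -> R) (C : R) :
  measurable_fun setT f -> (forall x, `|f x| <= C) ->
  P.-integrable setT (EFin \o f).
Proof.
move=> mf fC; apply: measurable_bounded_integrable => //.
  exact: le_lt_trans (probability_le1 P measurableT) (ltry _).
by exists C; split => //; [exact: num_real|move=> M CM x _; apply: le_trans (ltW CM)].
Qed.

Lemma le_integrable_bound d (T : measurableType d) (R : realType)
    (P : {measure set T -> \bar R}) (f g : T -> R) :
  measurable_fun setT f -> (forall x, `|f x| <= g x) ->
  P.-integrable setT (EFin \o g) -> P.-integrable setT (EFin \o f).
Proof.
move=> mf fg; apply: le_integrable => //; first exact/measurable_EFinP.
by move=> x _ /=; rewrite lee_fin (le_trans (fg x))// ler_norm.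
Qed.

Section integrable_real.
Context d (T : measurableType d) (R : realType) (mu : {measure set T -> \bar R}).
Implicit Types f g : T -> R.

Lemma integrable_mulrl (c : R) f : mu.-integrable setT (EFin \o f) ->
  mu.-integrable setT (EFin \o (fun t => c * f t)).
Proof. by move=> fi; have := integrableZl measurableT c fi. Qed.

Lemma integrable_mulrr (c : R) f : mu.-integrable setT (EFin \o f) ->
  mu.-integrable setT (EFin \o (fun t => f t * c)).
Proof. by move=> fi; have := integrableZr measurableT c fi. Qed.

Lemma integrable_addr f g : mu.-integrable setT (EFin \o f) ->
  mu.-integrable setT (EFin \o g) ->
  mu.-integrable setT (EFin \o (fun t => f t + g t)).
Proof. by move=> fi gi; have := integrableD measurableT fi gi. Qed.

Lemma integrable_subr f g : mu.-integrable setT (EFin \o f) ->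
  mu.-integrable setT (EFin \o g) ->
  mu.-integrable setT (EFin \o (fun t => f t - g t)).
Proof. by move=> fi gi; have := integrableB measurableT fi gi. Qed.

End integrable_real.

Section averages.
Context d (T : measurableType d) (R : realType) (P : probability T R).
Implicit Types f D : T -> R.

Lemma Rintegral_prob_cst (c : R) : \int[P]_x c = c.
Proof. rewrite Rintegral_cst//.
rewrite [X in _ * X](_ : _ = 1) ?mulr1//; exact: (congr1 fine (probability_setT P)). Qed.

Lemma EFin_Rintegral f : P.-integrable setT (EFin \o f) ->
  ((\int[P]_x f x)%:E = \int[P]_x (f x)%:E)%E.
Proof. by move=> fi; rewrite /Rintegral fineK// integrable_fin_num. Qed.

Lemma integrable_sqr D : measurable_fun setT D ->
  P.-integrable setT (fun t => (D t ^+ 2)%:E) -> P.-integrable setT (EFin \o D).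
Proof.
move=> mD iD; apply: (@le_integrable_bound _ _ _ _ _ (fun t => 1 + D t ^+ 2)) => //.
  by move=> x; rewrite ler_norml; apply/andP; split; nra.
rewrite (_ : _ \o _ = (cst 1%:E \+ (fun t => (D t ^+ 2)%:E)))%E//.
by apply: integrableD => //; exact: finite_measure_integrable_cst.
Qed.

Lemma measurable_omega D : measurable_fun setT D ->
  measurable_fun setT (fun t => omega (D t)).
Proof.
move=> mD; apply: measurable_minr; first exact: measurable_funX.
by apply: measurable_funX; exact: measurableT_comp.
Qed.

Lemma omega_ge0 (h : R) : 0 <= omega h.
Proof. by rewrite /omega le_min sqr_ge0 exprn_ge0. Qed.

Lemma integrable_omega D : measurable_fun setT D ->
  P.-integrable setT (fun t => (D t ^+ 2)%:E) ->
  P.-integrable setT (EFin \o (fun t => omega (D t))).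
Proof.
move=> mD; apply: le_integrable_bound; first exact: measurable_omega.
by move=> x; rewrite ger0_norm ?omega_ge0// /omega ge_min lexx.
Qed.

(** For centred increments the linear term of the expansion averages out. *)
Lemma taylor2_mean D (C : R) (f f1 f2 : R -> R) (x : R) :
  measurable_fun setT f -> (forall y, `|f y| <= 1) -> taylor2 C f f1 f2 ->
  measurable_fun setT D -> P.-integrable setT (fun t => (D t ^+ 2)%:E) ->
  \int[P]_t D t = 0 ->
  `|\int[P]_t f (x + D t) - f x - f2 x * ((\int[P]_t D t ^+ 2) / 2)| <=
  C * \int[P]_t omega (D t).
Proof.
move=> mf f1' tf mD iDD D0.
have iD := integrable_sqr mD iDD.
have mfD : measurable_fun setT (fun t => f (x + D t)).
  by apply: (measurableT_comp mf); exact: measurable_funD.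
have ifD : P.-integrable setT (EFin \o (fun t => f (x + D t))).
  by apply: (@bounded_integrable _ _ _ P _ 1 mfD) => t; exact: f1'.
have icst (c : R) : P.-integrable setT (EFin \o (fun _ : T => c)).
  exact: finite_measure_integrable_cst.
have iZ := integrable_mulrl (mu := P); have iB := integrable_subr (mu := P).
have iDD2 : P.-integrable setT (EFin \o (fun t => D t ^+ 2 / 2)).
  rewrite (_ : (fun t => _) = (fun t => 2^-1 * D t ^+ 2)); first exact: iZ.
  by apply/funext => t; rewrite mulrC.
have iom := integrable_omega mD iDD.
pose rem t := f (x + D t) - f x - f1 x * D t - f2 x * (D t ^+ 2 / 2).
have j1 := iB _ _ ifD (icst (f x)).
have irem : P.-integrable setT (EFin \o rem).
  exact: (iB _ _ (iB _ _ j1 (iZ _ _ iD)) (iZ _ _ iDD2)).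
have -> : \int[P]_t f (x + D t) - f x - f2 x * ((\int[P]_t D t ^+ 2) / 2) =
    \int[P]_t rem t.
  rewrite /rem (RintegralB measurableT (iB _ _ j1 (iZ _ _ iD)) (iZ _ _ iDD2)).
  rewrite (RintegralB measurableT j1 (iZ _ _ iD)) (RintegralB measurableT ifD (icst _)).
  rewrite Rintegral_prob_cst !RintegralZl// D0 mulr0 subr0.
  congr (_ - _ * _); under [RHS]eq_Rintegral do rewrite mulrC.
  by rewrite RintegralZl// mulrC.
apply: (le_trans (le_normr_Rintegral measurableT irem)).
rewrite -RintegralZl//; apply: le_Rintegral => //; last by move=> t _; exact: tf.
- by apply: (@integrable_norm _ _ _ _ setT rem).
- exact: iZ.
Qed.

(** The law of a pair of independent variables is a product measure. *)
Lemma indep_integral (U V V' : T -> R) (F : R * R -> \bar R) :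
  measurable_fun setT U -> measurable_fun setT V -> measurable_fun setT V' ->
  (forall A B, measurable A -> measurable B ->
    P (U @^-1` A `&` V @^-1` B) = P (U @^-1` A) * P (V' @^-1` B))%E ->
  measurable_fun setT F -> (forall z, 0 <= F z)%E ->
  (\int[P]_w F (U w, V w) = \int[P]_w \int[P]_t F (U w, V' t))%E.
Proof.
move=> mU mV mV' H mF F0.
pose UV w := (U w, V w).
have mUV : measurable_fun setT UV by exact: measurable_fun_pair.
pose Ur : {RV P >-> R} := mfun_Sub (mem_set mU).
pose V'r : {RV P >-> R} := mfun_Sub (mem_set mV').
pose UVr : {RV P >-> (R * R)%type} := mfun_Sub (mem_set mUV).
have E X : measurable X -> (distribution P Ur \x distribution P V'r)%E X = distribution P UVr X.
  by apply: product_measure_unique => A B mA mB; rewrite -H.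
transitivity (\int[distribution P UVr]_z F z)%E.
  by rewrite ge0_integral_distribution.
transitivity (\int[(distribution P Ur \x distribution P V'r)]_z F z)%E.
  by apply: eq_measure_integral => A mA _; exact/esym/E.
rewrite fubini_tonelli1// /fubini_F.
rewrite ge0_integral_distribution//; last 2 first.
- exact: measurable_fun_fubini_tonelli_F.
- by move=> x; exact: integral_ge0.
apply: eq_integral => w _ /=.
rewrite ge0_integral_distribution//.
by apply: (measurableT_comp mF); exact: measurable_pair1.
Qed.

End averages.

Section gauss_average.
Context (R : realType).
Notation gam := (normal_prob (0 : R) 1).
Implicit Types f : R -> R.

(** The mean of [f] under the normal law with mean [x] and standard deviation
    [s]. Writing it through the standard normal law keeps [s = 0] meaningful,
    where it is [f x]; as a function of [s ^+ 2] this is a semigroup. *)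
Definition gauss_avg (s : R) f x := \int[gam]_u f (x + s * u).

Let mline (x s : R) f : measurable_fun setT f ->
  measurable_fun setT (fun u : R => f (x + s * u)).
Proof.
by move=> mf; apply: (measurableT_comp mf); apply: measurable_funD => //;
  exact: measurable_funM.
Qed.

Lemma gauss_avgE s f x : measurable_fun setT f -> (forall y, `|f y| <= 1) ->
  ((gauss_avg s f x)%:E = \int[gam]_u (f (x + s * u))%:E)%E.
Proof.
move=> mf f1; apply: EFin_Rintegral.
by apply: (@bounded_integrable _ (measurableTypeR R) R gam _ 1 (mline x s mf)) => u; exact: f1.
Qed.

Lemma gauss_avg0 f x : gauss_avg 0 f x = f x.
Proof.
rewrite -[RHS](Rintegral_prob_cst gam); apply: eq_Rintegral => u _.
by rewrite mul0r addr0.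
Qed.

Section unit_interval.
Variables (f : R -> R).
Hypotheses (mf : measurable_fun setT f) (f01 : forall y, 0 <= f y <= 1).

Let f1 y : `|f y| <= 1.
Proof. by case/andP: (f01 y) => ? ?; rewrite ger0_norm. Qed.

Let fE0 y : (0 <= (f y)%:E)%E.
Proof. by rewrite lee_fin; case/andP: (f01 y). Qed.

Lemma gauss_avg_itv s x : 0 <= gauss_avg s f x <= 1.
Proof.
have i1 : gam.-integrable setT (EFin \o (fun u : R => f (x + s * u))).
  by apply: (@bounded_integrable _ (measurableTypeR R) R gam _ 1 (mline x s mf)) => u; exact: f1.
apply/andP; split.
  by apply: Rintegral_ge0 => u _; case/andP: (f01 (x + s * u)).
rewrite -[leRHS](Rintegral_prob_cst gam); apply: le_Rintegral => //.
  exact: finite_measure_integrable_cst.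
by move=> u _; case/andP: (f01 (x + s * u)).
Qed.

Lemma measurable_gauss_avg s : measurable_fun setT (gauss_avg s f).
Proof.
apply: (measurableT_comp (@fine_measurable R setT measurableT)).
apply: (@measurable_fun_fubini_tonelli_F _ _ (measurableTypeR R)
  (measurableTypeR R) R gam (fun p => (f (p.1 + s * p.2))%:E)).
- apply/measurable_EFinP; apply: (measurableT_comp mf).
  by apply: measurable_funD => //; exact: measurable_funM.
- by move=> p.
Qed.

Lemma gauss_avg_comp a b x : 0 <= a -> 0 <= b ->
  gauss_avg a (gauss_avg b f) x = gauss_avg (Num.sqrt (a ^+ 2 + b ^+ 2)) f x.
Proof.
rewrite le_eqVlt => /predU1P[<- b0|a0].
  by rewrite gauss_avg0 expr0n/= add0r sqrtr_sqr ger0_norm.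
rewrite le_eqVlt => /predU1P[<-|b0].
  rewrite [X in Num.sqrt (_ + X)]expr0n/= addr0 sqrtr_sqr gtr0_norm//.
  by apply: eq_Rintegral => u _; rewrite gauss_avg0.
apply: EFin_inj; rewrite gauss_avgE//; last 2 first.
- exact: measurable_gauss_avg.
- by move=> y; have /andP[? ?] := gauss_avg_itv b y; rewrite ger0_norm.
rewrite gauss_avgE//.
have mfE : measurable_fun setT (fun y : R => (f y)%:E) by exact/measurable_EFinP.
rewrite -(normal_convolution x a0 b0 mfE fE0).
by apply: eq_integral => u _; rewrite gauss_avgE.
Qed.

End unit_interval.

(** The remainder of the expansion is uniform in the base point, so it passes to
    averages over translates with the same constant. This is what makes the
    successive replacements of increments cost the same. *)
Lemma gauss_avg_taylor2 s C (B : R) f f1 f2 : measurable_fun setT f ->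
  measurable_fun setT f1 -> measurable_fun setT f2 ->
  (forall y, `|f y| <= B) -> (forall y, `|f1 y| <= B) -> (forall y, `|f2 y| <= B) ->
  taylor2 C f f1 f2 -> taylor2 C (gauss_avg s f) (gauss_avg s f1) (gauss_avg s f2).
Proof.
move=> mf mf1 mf2 fB f1B f2B tf x h.
have i (g : R -> R) y : measurable_fun setT g -> (forall y, `|g y| <= B) ->
    gam.-integrable setT (EFin \o (fun u : R => g (y + s * u))).
  move=> mg gB; apply: (@bounded_integrable _ (measurableTypeR R) R gam _ B (mline y s mg)).
  by move=> u; exact: gB.
have iZ := @integrable_mulrr _ (measurableTypeR R) R gam.
have iB := @integrable_subr _ (measurableTypeR R) R gam.
pose rem u := f (x + h + s * u) - f (x + s * u) - f1 (x + s * u) * h -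
  f2 (x + s * u) * (h ^+ 2 / 2).
have i1 := i f (x + h) mf fB.
have i2 := i f x mf fB.
have i3 := iZ h _ (i f1 x mf1 f1B).
have i4 := iZ (h ^+ 2 / 2) _ (i f2 x mf2 f2B).
have irem : gam.-integrable setT (EFin \o rem).
  exact: (iB _ _ (iB _ _ (iB _ _ i1 i2) i3) i4).
have -> : gauss_avg s f (x + h) - gauss_avg s f x - gauss_avg s f1 x * h -
    gauss_avg s f2 x * (h ^+ 2 / 2) = \int[gam]_u rem u.
  rewrite /rem (RintegralB measurableT (iB _ _ (iB _ _ i1 i2) i3) i4).
  rewrite (RintegralB measurableT (iB _ _ i1 i2) i3) (RintegralB measurableT i1 i2).
  rewrite (RintegralZr _ measurableT (i f1 x mf1 f1B)).
  by rewrite (RintegralZr _ measurableT (i f2 x mf2 f2B)).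
apply: (le_trans (le_normr_Rintegral measurableT irem)).
rewrite -[leRHS](Rintegral_prob_cst gam); apply: le_Rintegral => //.
- exact: (@integrable_norm _ (measurableTypeR R) R gam setT rem irem).
- exact: finite_measure_integrable_cst.
- move=> u _; rewrite /rem; have := tf (x + s * u) h.
  by rewrite (_ : x + s * u + h = x + h + s * u)//; ring.
Qed.

End gauss_average.

(** * A central limit theorem for triangular arrays *)

Section lindeberg.
Context d (T : measurableType d) (R : realType) (P : probability T R).
Notation gam := (normal_prob (0 : R) 1).
Variables (W D : nat -> T -> R).
Hypothesis mW : forall k, measurable_fun setT (W k).
Hypothesis mD : forall k, measurable_fun setT (D k).
Hypothesis W0 : forall w, W 0%N w = 0.
Hypothesis WS : forall k w, W k.+1 w = W k w + D k w.
Hypothesis WD : forall k A B, measurable A -> measurable B ->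
  (P (W k @^-1` A `&` D k @^-1` B) = P (W k @^-1` A) * P (D 0%N @^-1` B))%E.
Hypothesis iDD : P.-integrable setT (fun t => (D 0%N t ^+ 2)%:E).
Hypothesis D_mean : \int[P]_t D 0%N t = 0.

Let v := \int[P]_t (D 0%N t ^+ 2).

Let v0 : 0 <= v. Proof. by apply: Rintegral_ge0 => t _; rewrite sqr_ge0. Qed.

Let e := \int[P]_t omega (D 0%N t) + \int[gam]_u omega (Num.sqrt v * u).

(** Replacing one increment by a normal variable of the same variance: both
    means agree with the same second order expansion, up to the mean of
    [omega] of the increment. *)
Let swap_one (F F1 F2 : R -> R) (C : R) k :
  measurable_fun setT F -> (forall y, 0 <= F y <= 1) -> taylor2 C F F1 F2 ->
  `|\int[P]_w F (W k.+1 w) - \int[P]_w gauss_avg (Num.sqrt v) F (W k w)| <= C * e.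
Proof.
move=> mF F01 tF.
have Fn y : `|F y| <= 1 by case/andP: (F01 y) => ? ?; rewrite ger0_norm.
pose TF x := \int[P]_t F (x + D 0%N t).
have mFD x : measurable_fun setT (fun t => F (x + D 0%N t)).
  by apply: (measurableT_comp mF); exact: measurable_funD.
have iFD x : P.-integrable setT (EFin \o (fun t => F (x + D 0%N t))).
  by apply: (@bounded_integrable _ _ _ P _ 1) => // t; exact: Fn.
have TF01 x : 0 <= TF x <= 1.
  apply/andP; split; first by apply: Rintegral_ge0 => t _; case/andP: (F01 (x + D 0%N t)).
  rewrite -[leRHS](Rintegral_prob_cst P); apply: le_Rintegral => //.
    exact: finite_measure_integrable_cst.
  by move=> t _; case/andP: (F01 (x + D 0%N t)).
have mTF : measurable_fun setT TF.
  apply: (measurableT_comp (@fine_measurable R setT measurableT)).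
  apply: (@measurable_fun_fubini_tonelli_F _ _ R T R P
    (fun p => (F (p.1 + D 0%N p.2))%:E)).
  - apply/measurable_EFinP; apply: (measurableT_comp mF).
    by apply: measurable_funD => //; exact: (measurableT_comp (mD 0)).
  - by move=> p; rewrite lee_fin; case/andP: (F01 (p.1 + D 0%N p.2)).
have iW (G : R -> R) : measurable_fun setT G -> (forall y, 0 <= G y <= 1) ->
    P.-integrable setT (EFin \o (fun w => G (W k w))).
  move=> mG G01; apply: (@bounded_integrable _ _ _ P _ 1).
    by apply: (measurableT_comp mG).
  by move=> t; case/andP: (G01 (W k t)) => ? ?; rewrite ger0_norm.
have -> : \int[P]_w F (W k.+1 w) = \int[P]_w TF (W k w).
  congr fine; under eq_integral do rewrite WS.
  transitivity (\int[P]_w \int[P]_t (F (W k w + D 0%N t))%:E)%E; last first.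
    by apply: eq_integral => w _; rewrite EFin_Rintegral.
  apply: (@indep_integral _ _ _ P (W k) (D k) (D 0%N) (fun p => (F (p.1 + p.2))%:E)) => //.
  - exact: WD.
  - by apply/measurable_EFinP; apply: (measurableT_comp mF); exact: measurable_funD.
  - by move=> p; rewrite lee_fin; case/andP: (F01 (p.1 + p.2)).
have mG := measurable_gauss_avg mF F01 (Num.sqrt v).
have G01 := gauss_avg_itv mF F01 (Num.sqrt v).
have iT := iW _ mTF TF01; have iG := iW _ mG G01.
rewrite -(RintegralB measurableT iT iG).
have iB := integrable_subr iT iG.
apply: (le_trans (le_normr_Rintegral measurableT iB)).
rewrite -[leRHS](Rintegral_prob_cst P); apply: le_Rintegral => //.
- exact: (integrable_norm iB).
- exact: finite_measure_integrable_cst.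
move=> w _; set x := W k w.
have h1 := @taylor2_mean _ _ _ P (D 0%N) C F F1 F2 x mF Fn tF (mD 0) iDD D_mean.
have mu : measurable_fun setT (fun u : measurableTypeR R => Num.sqrt v * u).
  exact: measurable_funM.
have uE (u : R) : (Num.sqrt v * u) ^+ 2 = v * u ^+ 2 by rewrite exprMn sqr_sqrtr.
have iu2 : gam.-integrable setT (EFin \o (fun u : R => u ^+ 2)).
  apply/integrableP; split; first by apply/measurable_EFinP; exact: measurable_funX.
  under eq_integral do rewrite /= ger0_norm ?sqr_ge0//.
  by rewrite normal_second_moment ltry.
have h2 := @taylor2_mean _ (measurableTypeR R) _ gam (fun u => Num.sqrt v * u) C F F1 F2
   x mF Fn tF mu.
have vE : \int[gam]_u ((Num.sqrt v * u) ^+ 2) = v.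
  under eq_Rintegral do rewrite uE.
  rewrite (RintegralZl v measurableT iu2).
  by rewrite /Rintegral normal_second_moment/= mulr1.
rewrite vE in h2.
have h3 := h2 _ _.
have {h3} h3 : `|gauss_avg (Num.sqrt v) F x - F x - F2 x * (v / 2)| <=
    C * \int[gam]_u omega (Num.sqrt v * u).
  apply: h3.
  - apply: (eq_integrable measurableT (EFin \o (fun u : measurableTypeR R => v * u ^+ 2))).
      by move=> u _; rewrite /= uE.
    exact: (@integrable_mulrl _ (measurableTypeR R) R gam v _ iu2).
  - rewrite (RintegralZl _ measurableT (@integrable_normal_id R)).
    by rewrite /Rintegral normal_mean/= mulr0.
rewrite /e mulrDr.
rewrite (_ : TF x - _ = (TF x - F x - F2 x * (v / 2)) -
  (gauss_avg (Num.sqrt v) F x - F x - F2 x * (v / 2))); last by ring.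
by apply: (le_trans (ler_normB _ _)); rewrite lerD.
Qed.

Variables (f f1 f2 : R -> R) (C B : R).
Hypotheses (mf : measurable_fun setT f) (mf1 : measurable_fun setT f1).
Hypothesis mf2 : measurable_fun setT f2.
Hypothesis f01 : forall y, 0 <= f y <= 1.
Hypotheses (f1B : forall y, `|f1 y| <= B) (f2B : forall y, `|f2 y| <= B).
Hypothesis tf : taylor2 C f f1 f2.

Let B1 : forall y, `|f y| <= Num.max 1 B.
Proof. by move=> y; case/andP: (f01 y) => ? ?; rewrite ger0_norm// le_max; apply/orP; left. Qed.

(* Interpolate between the sum of k increments and a normal variable: at each
   stage the last increments are already replaced by one normal variable, of
   variance j * v, with which f is averaged. *)
Let telescope k j :
  `|\int[P]_w gauss_avg (Num.sqrt (j%:R * v)) f (W k w)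
    - gauss_avg (Num.sqrt ((j + k)%:R * v)) f 0| <= k%:R * (C * e).
Proof.
elim: k j => [|k IHk] j.
  under eq_Rintegral do rewrite W0.
  by rewrite Rintegral_prob_cst addn0 subrr normr0 mul0r.
have fmax1 y : `|f1 y| <= Num.max 1 B by rewrite (le_trans (f1B y))// le_max lexx orbT.
have fmax2 y : `|f2 y| <= Num.max 1 B by rewrite (le_trans (f2B y))// le_max lexx orbT.
have tG := gauss_avg_taylor2 (Num.sqrt (j%:R * v)) mf mf1 mf2 B1 fmax1 fmax2 tf.
have := swap_one k (measurable_gauss_avg mf f01 _) (gauss_avg_itv mf f01 _) tG.
have -> : \int[P]_w gauss_avg (Num.sqrt v) (gauss_avg (Num.sqrt (j%:R * v)) f) (W k w) =
    \int[P]_w gauss_avg (Num.sqrt (j.+1%:R * v)) f (W k w).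
  apply: eq_Rintegral => w _; rewrite gauss_avg_comp ?sqrtr_ge0//.
  by rewrite !sqr_sqrtr ?mulr_ge0// -natr1 mulrDl mul1r addrC.
have := IHk j.+1; rewrite addSnnS => h1 h2.
rewrite -natr1 mulrDl mul1r [leRHS]addrC.
by apply: (le_trans _ (lerD h2 h1)); apply: le_trans (ler_normD _ _); rewrite addrA subrK.
Qed.

Lemma lindeberg_swap n :
  `|\int[P]_w f (W n w) - gauss_avg (Num.sqrt (n%:R * v)) f 0| <=
  C * (n%:R * \int[P]_t omega (D 0%N t)
       + n%:R * \int[gam]_u omega (Num.sqrt v * u)).
Proof.
have := telescope n 0; rewrite mul0r sqrtr0 add0n.
under eq_Rintegral do rewrite gauss_avg0.
by rewrite /e mulrCA mulrDr.
Qed.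

End lindeberg.

Lemma cvg_invr_sqrt (R : realType) : (Num.sqrt (n%:R : R))^-1 @[n --> \oo] --> (0 : R).
Proof.
rewrite -(cvg_shiftS (fun n => (Num.sqrt (n%:R : R))^-1)).
have -> : (fun n => (Num.sqrt (n.+1%:R : R))^-1) = Num.sqrt \o (fun n => n.+1%:R^-1).
  by apply/funext => n /=; rewrite sqrtrV.
have H : Num.sqrt (n.+1%:R^-1 : R) @[n --> \oo] --> Num.sqrt (0 : R).
  apply: (@cvg_comp _ _ _ (fun n => n.+1%:R^-1 : R) Num.sqrt _ (nbhs (0 : R))).
    exact: cvg_harmonic.
  exact: sqrt_continuous.
by rewrite sqrtr0 in H.
Qed.

(** Negligibility of the increments: [n * omega (D / sqrt n)] is bounded by
    [N ^ 2] and by [N ^ 3 / sqrt n]. *)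
Lemma lindeberg_negligible d (T : measurableType d) (R : realType)
    (P : probability T R) (N : T -> R) (D : nat -> T -> R) :
  measurable_fun setT N -> P.-integrable setT (EFin \o (fun t => N t ^+ 2)) ->
  (forall n, measurable_fun setT (D n)) -> (forall n t, `|D n t| <= N t) ->
  n%:R * \int[P]_t omega (D n t / Num.sqrt n%:R) @[n --> \oo] --> (0 : R).
Proof.
move=> mN iN mD DN.
have N0 t : 0 <= N t by exact: le_trans (DN 0%N t).
pose h n t := Num.min (N t ^+ 2) (N t ^+ 3 / Num.sqrt n%:R).
have h0 n t : 0 <= h n t.
  by rewrite le_min sqr_ge0 divr_ge0 ?exprn_ge0 ?sqrtr_ge0.
have hN n t : h n t <= N t ^+ 2 by rewrite ge_min lexx.
have mh n : measurable_fun setT (h n).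
  apply: measurable_minr; first exact: measurable_funX.
  by apply: measurable_funM => //; exact: measurable_funX.
have ih n : P.-integrable setT (EFin \o h n).
  by apply: le_integrable_bound iN => // t; rewrite ger0_norm.
have cvgh : \int[P]_t h n t @[n --> \oo] --> (0 : R).
  have [] := @dominated_convergence _ _ _ P setT measurableT
    (fun n => EFin \o h n) (cst 0%E) (EFin \o (fun t => N t ^+ 2)) => //.
  - by move=> n; exact/measurable_EFinP.
  - apply: aeW => t _; apply: cvg_EFin; first by near=> n.
    apply: (@squeeze_cvgr _ _ _ _ (cst 0) (fun n => N t ^+ 3 * (Num.sqrt n%:R)^-1)).
    + by near=> n; rewrite h0/= ge_min lexx orbT.
    + exact: cvg_cst.
    + by rewrite -[X in _ --> X](mulr0 (N t ^+ 3)); apply: cvgM;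
        [exact: cvg_cst|exact: cvg_invr_sqrt].
  - by apply: aeW => t n _ /=; rewrite lee_fin ger0_norm.
  - move=> _ _; rewrite integral_cst// mul0e => /fine_cvgP[_] //.
apply: (@squeeze_cvgr _ _ _ _ (cst 0) (fun n => \int[P]_t h n t)) => //; last exact: cvg_cst.
near=> n.
have n0 : 0 < Num.sqrt (n%:R : R).
  by rewrite sqrtr_gt0 ltr0n; near: n; exact: nbhs_infty_gt.
rewrite mulr_ge0//=; last by apply: Rintegral_ge0 => t _; exact: omega_ge0.
have mDn : measurable_fun setT (fun t => D n t / Num.sqrt n%:R).
  by apply: measurable_funM.
have nE : n%:R = Num.sqrt (n%:R : R) ^+ 2 by rewrite sqr_sqrtr.
have le t : n%:R * omega (D n t / Num.sqrt n%:R) <= h n t.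
  have {}DN := DN n t.
  rewrite /h le_min; apply/andP; split.
    apply: (@le_trans _ _ (n%:R * (D n t / Num.sqrt n%:R) ^+ 2)).
      by rewrite ler_wpM2l// ge_min lexx.
    rewrite exprMn exprVn -nE mulrCA divff ?mulr1 ?gt_eqF//; last first.
      by rewrite nE exprn_gt0.
    by rewrite -[leLHS]real_normK ?num_real// lerXn2r// nnegrE.
  apply: (@le_trans _ _ (n%:R * `|D n t / Num.sqrt n%:R| ^+ 3)).
    by rewrite ler_wpM2l// ge_min lexx orbT.
  rewrite normrM normfV (gtr0_norm n0) [X in X * _ <= _]nE exprMn exprVn.
  have -> : Num.sqrt n%:R ^+ 2 * (`|D n t| ^+ 3 / Num.sqrt n%:R ^+ 3) =
      `|D n t| ^+ 3 / Num.sqrt (n%:R : R) by field; rewrite gt_eqF.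
  by rewrite ler_pM2r ?invr_gt0// lerXn2r// nnegrE.
have io : P.-integrable setT (EFin \o (fun t => n%:R * omega (D n t / Num.sqrt n%:R))).
  apply: le_integrable_bound (ih n).
    by apply: measurable_funM => //; exact: measurable_omega.
  by move=> t; rewrite ger0_norm// mulr_ge0// omega_ge0.
have io' : P.-integrable setT (EFin \o (fun t => omega (D n t / Num.sqrt n%:R))).
  apply: le_integrable_bound io; first exact: measurable_omega.
  move=> t; rewrite ger0_norm ?omega_ge0// ler_peMl ?omega_ge0// ler1n.
  by near: n; exact: nbhs_infty_gt.
by rewrite -(RintegralZl _ measurableT io'); apply: le_Rintegral.
Unshelve. all: by end_near. Qed.

Lemma cvg_gauss_avg (R : realType) (f : R -> R) (s : R ^nat) (s0 : R) :
  continuous f -> (forall y, `|f y| <= 1) -> s @ \oo --> s0 ->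
  gauss_avg (s n) f 0 @[n --> \oo] --> gauss_avg s0 f 0.
Proof.
move=> cf f1 ss0.
pose gam : probability (measurableTypeR R) R := normal_prob (0 : R) 1.
have mf : measurable_fun setT f by exact: continuous_measurable_fun.
have ml (t : R) : measurable_fun setT (fun u : measurableTypeR R => (f (0 + t * u))%:E).
  apply/measurable_EFinP; apply: (measurableT_comp mf).
  by apply: measurable_funD => //; exact: measurable_funM.
have [] := @dominated_convergence _ (measurableTypeR R) _ gam setT measurableT
  (fun n u => (f (0 + s n * u))%:E) (fun u => (f (0 + s0 * u))%:E) (cst 1%:E) => //.
- apply: aeW => u _; apply: cvg_EFin; first by near=> n.
  apply: continuous_cvg; first exact: cf.
  apply: cvgD; first exact: cvg_cst.
  by apply: cvgM => //; exact: cvg_cst.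
- exact: finite_measure_integrable_cst.
- by apply: aeW => u n _; rewrite lee_fin.
- by move=> _ _; rewrite -gauss_avgE// => /fine_cvgP[_].
Unshelve. all: by end_near. Qed.

Section triangular.
Context d (T : measurableType d) (R : realType) (P : probability T R).
Variables (W D : nat -> nat -> T -> R) (N : T -> R) (sigma : R).
Hypothesis mW : forall n k, measurable_fun setT (W n k).
Hypothesis mD : forall n k, measurable_fun setT (D n k).
Hypothesis W0 : forall n w, W n 0%N w = 0.
Hypothesis WS : forall n k w, W n k.+1 w = W n k w + D n k w.
Hypothesis WD : forall n k A B, measurable A -> measurable B ->
  (P (W n k @^-1` A `&` D n k @^-1` B) = P (W n k @^-1` A) * P (D n 0%N @^-1` B))%E.
Hypothesis mN : measurable_fun setT N.
Hypothesis iN : P.-integrable setT (EFin \o (fun t => N t ^+ 2)).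
Hypothesis DN : forall n t, `|D n 0%N t| <= N t.
Hypothesis D_mean : forall n, \int[P]_t D n 0%N t = 0.
Hypothesis D_var : \int[P]_t (D n 0%N t ^+ 2) @[n --> \oo] --> sigma ^+ 2.
Hypothesis sigma0 : 0 <= sigma.

Let iDD n : P.-integrable setT (EFin \o (fun t => D n 0%N t ^+ 2)).
Proof.
apply: le_integrable_bound iN; first exact: measurable_funX.
move=> t; rewrite ger0_norm ?sqr_ge0// -[leLHS]real_normK ?num_real//.
by rewrite lerXn2r// nnegrE (le_trans _ (DN n t)).
Qed.

(** Lindeberg's replacement with [f] a logistic function: the hypothesis [WD]
    says that each increment is independent of the current partial sum and
    distributed as the initial one, which is all that one replacement sees.
    Since [sigma] may be 0, this also yields laws of large numbers. *)
Theorem triangular_clt (l b : R) : 0 < l ->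
  \int[P]_w logistic l b (W n n w / Num.sqrt n%:R) @[n --> \oo] -->
  gauss_avg sigma (logistic l b) 0.
Proof.
move=> l0; pose f := logistic l b; pose gam := normal_prob (0 : R) 1.
have f01 y : 0 <= f y <= 1 by rewrite logistic_ge0 logistic_le1.
have fn y : `|f y| <= 1 by rewrite ger0_norm ?logistic_le1 ?logistic_ge0.
have mf : measurable_fun setT f by exact: measurable_logistic.
have mff : measurable_fun setT (fun x => f x - f x ^+ 2).
  by apply: measurable_funB => //; exact: measurable_funX.
have mf1 : measurable_fun setT (logistic1 l b) by exact: measurable_funM.
have mf2 : measurable_fun setT (logistic2 l b).
  apply: measurable_funM; first exact: measurable_funM.
  by apply: measurable_funB => //; exact: measurable_funM.
have f1B y : `|logistic1 l b y| <= Num.max l (l ^+ 2).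
  rewrite le_max; apply/orP; left; rewrite /logistic1 -/(f y).
  have /andP[y0 y1] := f01 y; move: (f y) y0 y1 => z z0 z1.
  rewrite normrM gtr0_norm// ler_piMr// ?(ltW l0)// ler_norml.
  by apply/andP; split; nra.
have f2B y : `|logistic2 l b y| <= Num.max l (l ^+ 2).
  rewrite le_max; apply/orP; right; rewrite /logistic2 -/(f y).
  have /andP[y0 y1] := f01 y; move: (f y) y0 y1 => z z0 z1.
  rewrite -mulrA normrM gtr0_norm ?exprn_gt0//.
  rewrite ler_piMr ?exprn_ge0// ?(ltW l0)// ler_norml; apply/andP; split; nra.
have tf := logistic_taylor2 b l0; set C := 2 * _ in tf.
pose s2 n := \int[P]_t (D n 0%N t ^+ 2).
have s20 n : 0 <= s2 n by apply: Rintegral_ge0 => t _; exact: sqr_ge0.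
have swap n : (0 < n)%N ->
    `|\int[P]_w f (W n n w / Num.sqrt n%:R) - gauss_avg (Num.sqrt (s2 n)) f 0| <=
    C * (n%:R * \int[P]_t omega (D n 0%N t / Num.sqrt n%:R) +
         n%:R * \int[gam]_u omega (Num.sqrt (s2 n) * u / Num.sqrt n%:R)).
  move=> n0; pose r : R := Num.sqrt n%:R.
  have r0 : 0 < r by rewrite sqrtr_gt0 ltr0n.
  have rr : r ^+ 2 = n%:R by rewrite sqr_sqrtr.
  have mdiv (g : T -> R) : measurable_fun setT g -> measurable_fun setT (fun t => g t / r).
    by move=> mg; exact: measurable_funM.
  have vE : \int[P]_t (D n 0%N t / r) ^+ 2 = s2 n / n%:R.
    rewrite /s2 -RintegralZr//; apply: eq_Rintegral => t _.
    by rewrite exprMn exprVn rr.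
  have pre (g : T -> R) A : (fun t => g t / r) @^-1` A = g @^-1` ((fun y => y / r) @^-1` A) by [].
  have mA (A : set R) : measurable A -> measurable ((fun y : R => y / r) @^-1` A).
    by move=> mA; rewrite -[X in measurable X]setTI;
       apply: (@measurable_funM _ _ _ setT (fun y : R => y) (cst r^-1)).
  have := @lindeberg_swap _ _ _ P (fun k t => W n k t / r) (fun k t => D n k t / r)
    (fun k => mdiv _ (mW n k)) (fun k => mdiv _ (mD n k)) _ _ _ _ _
    f _ _ C _ mf mf1 mf2 f01 f1B f2B tf n.
  rewrite vE (mulrC n%:R (_ / _)) divfK ?pnatr_eq0 -?lt0n//.
  have -> : \int[gam]_u omega (Num.sqrt (s2 n / n%:R) * u) =
      \int[gam]_u omega (Num.sqrt (s2 n) * u / Num.sqrt n%:R).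
    apply: eq_Rintegral => u _; congr omega.
    by rewrite sqrtrM// sqrtrV// mulrAC.
  apply.
  - by move=> w; rewrite W0 mul0r.
  - by move=> k w; rewrite WS mulrDl.
  - by move=> k A B' hA hB; rewrite !pre; apply: WD; exact: mA.
  - have := integrable_mulrr (r ^- 2) (iDD n).
    by apply: eq_integrable => // t _; rewrite /= exprMn exprVn.
  - have mDn : P.-integrable setT (EFin \o D n 0%N).
      by apply: integrable_sqr => //; exact: iDD.
    by rewrite (RintegralZr _ measurableT mDn) D_mean mul0r.
have cvg1 := lindeberg_negligible mN iN (fun n => mD n 0%N) DN.
pose S := Num.sqrt (\int[P]_t N t ^+ 2).
have s2S n : s2 n <= \int[P]_t N t ^+ 2.
  apply: le_Rintegral => //.
  move=> t _; rewrite -[leLHS]real_normK ?num_real//.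
  by rewrite lerXn2r// nnegrE (le_trans _ (DN n t)).
have cvg2 : n%:R * \int[gam]_u omega (Num.sqrt (s2 n) * u / Num.sqrt n%:R)
    @[n --> \oo] --> (0 : R).
  apply: (@lindeberg_negligible _ (measurableTypeR R) R gam (fun u => S * `|u|)
    (fun n u => Num.sqrt (s2 n) * u)).
  - by apply: measurable_funM => //; exact: measurableT_comp.
  - have iu2 : gam.-integrable setT (EFin \o (fun u : R => u ^+ 2)).
      apply/integrableP; split; first by apply/measurable_EFinP; exact: measurable_funX.
      under eq_integral do rewrite /= ger0_norm ?sqr_ge0//.
      by rewrite normal_second_moment ltry.
    have := @integrable_mulrl _ (measurableTypeR R) R gam (S ^+ 2) _ iu2.
    by apply: eq_integrable => // t _; rewrite /= exprMn real_normK ?num_real.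
  - by move=> n; exact: measurable_funM.
  - move=> n u; rewrite normrM ler_wpM2r// ger0_norm ?sqrtr_ge0//.
    exact: ler_wsqrtr.
have cvg3 : gauss_avg (Num.sqrt (s2 n)) f 0 @[n --> \oo] --> gauss_avg sigma f 0.
  apply: cvg_gauss_avg => //; first exact: continuous_logistic.
  rewrite -[sigma]ger0_norm// -sqrtr_sqr.
  by apply: continuous_cvg => //; exact: sqrt_continuous.
have cvgC : C * (n%:R * \int[P]_t omega (D n 0%N t / Num.sqrt n%:R) +
         n%:R * \int[gam]_u omega (Num.sqrt (s2 n) * u / Num.sqrt n%:R))
    @[n --> \oo] --> (0 : R).
  rewrite -[X in _ --> X](mulr0 C); apply: cvgM; first exact: cvg_cst.
  by rewrite -[X in _ --> X](addr0 0); exact: cvgD.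
have cvg0 : \int[P]_w f (W n n w / Num.sqrt n%:R) - gauss_avg (Num.sqrt (s2 n)) f 0
    @[n --> \oo] --> (0 : R).
  apply/norm_cvg0P; apply: (@squeeze_cvgr _ _ _ _ (cst 0)) cvgC; last exact: cvg_cst.
  near=> n; rewrite normr_ge0/=; apply: swap.
  by near: n; exact: nbhs_infty_gt.
exact: (cvg_sub0 cvg0 cvg3).
Unshelve. all: by end_near. Qed.

End triangular.

(** * Convergence in distribution and in probability *)

Section probability_bounds.
Context d (T : measurableType d) (R : realType) (P : probability T R).
Implicit Types (f : T -> R) (A : set T).

Definition prob A : R := fine (P A).

Lemma probE A : measurable A -> ((prob A)%:E = P A)%E.
Proof. by move=> mA; rewrite /prob fineK// fin_num_measure. Qed.

Lemma prob_ge0 A : 0 <= prob A.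
Proof. exact: fine_ge0. Qed.

Lemma prob_le1 A : measurable A -> prob A <= 1.
Proof. by move=> mA; rewrite -lee_fin probE// probability_le1. Qed.

Lemma prob_indic A : measurable A -> prob A = \int[P]_w \1_A w.
Proof. by move=> mA; rewrite /prob /Rintegral integral_indic// setIT. Qed.

Let iindic A : measurable A -> P.-integrable setT (EFin \o (\1_A : T -> R)).
Proof.
move=> mA; apply: (@bounded_integrable _ _ _ P _ 1); first exact: measurable_indic.
by move=> w; rewrite indicE; case: (_ \in _); rewrite ?normr1 ?normr0.
Qed.

Lemma prob_le_Rintegral A f : measurable A -> P.-integrable setT (EFin \o f) ->
  (forall w, 0 <= f w) -> (forall w, A w -> 1 <= f w) -> prob A <= \int[P]_w f w.
Proof.
move=> mA fi f0 Af; rewrite prob_indic//; apply: le_Rintegral => //; first exact: iindic.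
by move=> w _; rewrite indicE; case: (boolP (w \in A)) => //= /set_mem; exact: Af.
Qed.

Lemma Rintegral_le_prob A f (c : R) : measurable A ->
  P.-integrable setT (EFin \o f) -> 0 <= c ->
  (forall w, f w <= 1 + c) -> (forall w, ~ A w -> f w <= c) ->
  \int[P]_w f w <= prob A + c.
Proof.
move=> mA fi c0 f1 fA; rewrite prob_indic// -[X in _ + X](Rintegral_prob_cst P).
have ic : P.-integrable setT (EFin \o (fun _ : T => c)).
  exact: finite_measure_integrable_cst.
rewrite -(RintegralD measurableT (iindic mA) ic).
apply: le_Rintegral => //; first exact: (integrable_addr (iindic mA) ic).
move=> w _; rewrite indicE; case: (boolP (w \in A)) => [_|/negP wA] /=; first exact: f1.
by rewrite add0r; apply: fA => /mem_set.
Qed.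

Lemma prob_le A B : measurable A -> measurable B -> A `<=` B -> prob A <= prob B.
Proof. by move=> mA mB AB; rewrite -lee_fin !probE//; apply: le_measure => //; exact: mem_set. Qed.

Lemma prob_setU A B : measurable A -> measurable B ->
  prob (A `|` B) <= prob A + prob B.
Proof.
move=> mA mB; rewrite -lee_fin EFinD !probE//; last exact: measurableU.
exact: measureU2.
Qed.

Lemma integrable_logistic l b f : measurable_fun setT f ->
  P.-integrable setT (EFin \o (fun w => logistic l b (f w))).
Proof.
move=> mf; apply: (@bounded_integrable _ _ _ P _ 1).
  by apply: (measurableT_comp (measurable_logistic l b)).
by move=> w; rewrite ger0_norm ?logistic_le1// logistic_ge0.
Qed.

Let lset f (z : R) : measurable_fun setT f -> measurable [set w | f w <= z].
Proof.
move=> mf; rewrite -[X in measurable X]setTI.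
by have := mf measurableT `]-oo, z]%classic (measurable_itv _); rewrite set_itvNyc.
Qed.

(** Together with [logistic_le_prob]: up to [(l * e)^-1] and a shift [e], the
    logistic function is the indicator of a half line. *)
Lemma prob_le_logistic f (l z e : R) : measurable_fun setT f -> 0 < l -> 0 < e ->
  prob [set w | f w <= z] <=
  1 - \int[P]_w logistic l (z + e) (f w) + (l * e)^-1.
Proof.
move=> mf l0 e0.
have i1 : P.-integrable setT (EFin \o (fun _ : T => 1 + (l * e)^-1)).
  exact: finite_measure_integrable_cst.
have i2 := integrable_logistic l (z + e) mf.
have le0 : 0 <= (l * e)^-1 by rewrite invr_ge0 mulr_ge0// ltW.
rewrite addrAC -[X in X - _](Rintegral_prob_cst P) -(RintegralB measurableT i1 i2).
apply: prob_le_Rintegral; [exact: lset|exact: integrable_subr|move=> w|move=> w /=].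
  by have := logistic_le1 l (z + e) (f w); lra.
move=> fz; have : f w <= z + e - e by lra.
by move=> /(logistic_le l0 e0); lra.
Qed.

Lemma logistic_le_prob f (l z e : R) : measurable_fun setT f -> 0 < l -> 0 < e ->
  1 - \int[P]_w logistic l (z - e) (f w) <=
  prob [set w | f w <= z] + (l * e)^-1.
Proof.
move=> mf l0 e0.
have i1 : P.-integrable setT (EFin \o (fun _ : T => 1 : R)).
  exact: finite_measure_integrable_cst.
have i2 := integrable_logistic l (z - e) mf.
have le0 : 0 <= (l * e)^-1 by rewrite invr_ge0 mulr_ge0// ltW.
rewrite -[X in X - _](Rintegral_prob_cst P) -(RintegralB measurableT i1 i2).
apply: Rintegral_le_prob => //; [exact: lset|exact: integrable_subr|move=> w|move=> w /=].
  by have := logistic_ge0 l (z - e) (f w); lra.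
move=> /negP; rewrite -ltNge => fz.
have : z - e + e <= f w by lra.
by move=> /(logistic_ge l0 e0); lra.
Qed.

End probability_bounds.

Lemma ae_eq_measure d (T : measurableType d) (R : realType) (P : probability T R)
    (A B : set T) : measurable A -> measurable B ->
  {ae P, forall w, A w <-> B w} -> P A = P B.
Proof.
move=> mA mB AB.
have iE (C : set T) : measurable C -> (P C = \int[P]_w (\1_C w)%:E)%E.
  by move=> mC; rewrite integral_indic// setIT.
rewrite !iE//; apply: ae_eq_integral => //.
- by apply/measurable_EFinP; exact: measurable_indic.
- by apply/measurable_EFinP; exact: measurable_indic.
apply: filterS AB => w AB _; congr (_%:E); rewrite !indicE; congr (_%:R).
congr nat_of_bool.
by apply/idP/idP => /set_mem /AB /mem_set.
Qed.

Section convergence.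
Context d (T : measurableType d) (R : realType) (P : probability T R).
Implicit Types V e : nat -> T -> R.

Definition cvg_in_probability0 e := forall h : R, 0 < h ->
  prob P [set w | h < `|e n w|] @[n --> \oo] --> (0 : R).

Let mgt (f : T -> R) (h : R) : measurable_fun setT f ->
  measurable [set w | h < f w].
Proof.
move=> mf; rewrite -[X in measurable X]setTI.
by have := mf measurableT `]h, +oo[%classic (measurable_itv _); rewrite set_itvoy.
Qed.

Let mle (f : T -> R) (z : R) : measurable_fun setT f -> measurable [set w | f w <= z].
Proof.
move=> mf; rewrite -[X in measurable X]setTI.
by have := mf measurableT `]-oo, z]%classic (measurable_itv _); rewrite set_itvNyc.
Qed.

Let sandwich (F Fp Fm p ap am bp bm x : R) : `|F - Fm| <= x -> `|F - Fp| <= x ->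
  `|ap - bp| <= x -> `|am - bm| <= x -> 1 - ap <= Fp + x -> Fm <= 1 - am + x ->
  p <= 1 - bp + x -> 1 - bm <= p + x -> `|F - p| <= 4 * x.
Proof.
clear; rewrite !ler_norml => /andP[? ?] /andP[? ?] /andP[? ?] /andP[? ?] ? ? ? ?.
by apply/andP; split; lra.
Qed.

Let tail_sandwich (ap am bp bm p1 p2 x : R) : `|ap - bp| <= x -> `|am - bm| <= x ->
  ap <= x -> 1 - x <= am -> p1 <= bp + x -> p2 <= 1 - bm + x -> p1 + p2 <= 6 * x.
Proof. by clear; rewrite !ler_norml => /andP[? ?] /andP[? ?] ? ? ? ?; lra. Qed.

(** Means of logistic functions determine convergence in distribution: they
    separate the events [V n <= z] up to an arbitrarily small shift of [z]. *)
Lemma logistic_cvg_in_distribution V (mu : probability (measurableTypeR R) R) :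
  (forall n, measurable_fun setT (V n)) ->
  (forall l b : R, 0 < l -> \int[P]_w logistic l b (V n w) @[n --> \oo] -->
    \int[mu]_x logistic l b x) ->
  cvg_in_distribution P V mu.
Proof.
move=> mV H z cz.
have mid : measurable_fun setT (fun x : measurableTypeR R => x : R) by [].
have setE (y : R) : [set x : measurableTypeR R | (x : R) <= y] = `]-oo, y]%classic.
  by rewrite set_itvNyc.
apply: cvg_trans (_ : (prob P [set w | V n w <= z])%:E @[n --> \oo] `=>` _).
  by apply: near_eq_cvg; near=> n; rewrite probE//; exact: mle.
have -> : mu `]-oo, z]%classic = (prob mu `]-oo, z]%classic)%:E.
  by rewrite probE.
apply: cvg_EFin; first by near=> n.
apply/cvgrPdist_le => eps eps0.
have e4 : 0 < eps / 4 by rewrite divr_gt0.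
have /fine_cvgP[_ /cvgrPdist_le/(_ _ e4)] : mu `]-oo, y]%classic @[y --> z] -->
    (prob mu `]-oo, z]%classic)%:E by rewrite probE.
move=> /nbhs_ballP[r /= r0 hr].
have [h h0 hE] : exists2 h : R, 0 < h & h = r / 3 by exists (r / 3) => //; rewrite divr_gt0.
have hz2 : ball z r (z + h + h).
  by rewrite /ball/= ltr_norml hE; apply/andP; split; lra.
have hz1 : ball z r (z - h - h).
  by rewrite /ball/= ltr_norml hE; apply/andP; split; lra.
have {hr} := (conj (hr _ hz1) (hr _ hz2)).
rewrite /= -!/(prob mu _) => -[c1 c2].
have [l l0 lh] : exists2 l : R, 0 < l & (l * h)^-1 = eps / 4.
  exists (h * (eps / 4))^-1; first by rewrite invr_gt0 mulr_gt0.
  by field; rewrite !gt_eqF// mulr_gt0.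
have u1 := @logistic_le_prob _ _ _ mu _ l (z + h + h) h mid l0 h0.
have u2 := @prob_le_logistic _ _ _ mu _ l (z - h - h) h mid l0 h0.
rewrite !setE lh addrK in u1; rewrite !setE lh subrK in u2.
have /cvgrPdist_le/(_ _ e4) L1 := H l (z + h) l0.
have /cvgrPdist_le/(_ _ e4) L2 := H l (z - h) l0.
apply: filterS (filterI L1 L2) => n [w1 w2].
have v1 := @prob_le_logistic _ _ _ P _ l z h (mV n) l0 h0.
have v2 := @logistic_le_prob _ _ _ P _ l z h (mV n) l0 h0.
rewrite lh in v1; rewrite lh in v2.
have := sandwich c1 c2 w1 w2 u1 u2 v1 v2.
by rewrite (_ : 4 * (eps / 4) = eps)//; field.
Unshelve. all: by end_near. Qed.

(** Logistic functions being Lipschitz and bounded, a perturbation that vanishes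
    in probability does not change the limit of their means. *)
Lemma logistic_slutsky V e (l b c : R) : 0 < l ->
  (forall n, measurable_fun setT (V n)) -> (forall n, measurable_fun setT (e n)) ->
  cvg_in_probability0 e ->
  \int[P]_w logistic l b (V n w) @[n --> \oo] --> c ->
  \int[P]_w logistic l b (V n w + e n w) @[n --> \oo] --> c.
Proof.
move=> l0 mV me e0 cV.
have mVe n : measurable_fun setT (fun w => V n w + e n w) by exact: measurable_funD.
have i1 n := integrable_logistic P l b (mV n).
have i2 n := integrable_logistic P l b (mVe n).
have key h n : 0 < h ->
    `|\int[P]_w logistic l b (V n w + e n w) - \int[P]_w logistic l b (V n w)| <=
    prob P [set w | h < `|e n w|] + l * h.
  move=> h0; rewrite -(RintegralB measurableT (i2 n) (i1 n)).
  have i3 := integrable_subr (i2 n) (i1 n).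
  apply: (le_trans (le_normr_Rintegral measurableT i3)).
  apply: Rintegral_le_prob.
  - by apply: mgt; exact: measurableT_comp.
  - exact: (integrable_norm i3).
  - by rewrite mulr_ge0// ltW.
  - move=> w; have ? : 0 <= l * h by rewrite mulr_ge0// ltW.
    have := logistic_ge0 l b (V n w + e n w); have := logistic_le1 l b (V n w + e n w).
    have := logistic_ge0 l b (V n w); have := logistic_le1 l b (V n w).
    by move=> ? ? ? ?; rewrite ler_norml; apply/andP; split; lra.
  - move=> w /= /negP; rewrite -leNgt => ew.
    apply: (le_trans (logistic_lip _ _ _ l0)).
    by rewrite addrAC subrr add0r ler_pM2l.
have cd : \int[P]_w logistic l b (V n w + e n w) - \int[P]_w logistic l b (V n w)
    @[n --> \oo] --> (0 : R).
  apply/cvgrPdist_le => eps eps0.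
  have h0 : 0 < eps / 2 / l by rewrite !divr_gt0.
  have /cvgrPdist_le/(_ (eps / 2)) := e0 _ h0.
  rewrite divr_gt0// => /(_ isT) ce.
  near=> n; rewrite sub0r normrN; apply: (le_trans (key _ n h0)).
  have : `|0 - prob P [set w | eps / 2 / l < `|e n w|]| <= eps / 2 by near: n.
  rewrite sub0r normrN ger0_norm ?prob_ge0// => pe.
  by rewrite [l * _]mulrC divfK ?gt_eqF//; lra.
exact: (cvg_sub0 cd cV).
Unshelve. all: by end_near. Qed.

(** Convergence of the means to the value at 0 is convergence in law to the point
    mass at 0. *)
Lemma logistic_cvg_in_probability0 e :
  (forall n, measurable_fun setT (e n)) ->
  (forall l b : R, 0 < l -> \int[P]_w logistic l b (e n w) @[n --> \oo] -->
    logistic l b 0) ->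
  cvg_in_probability0 e.
Proof.
move=> me H h h0; apply/cvgrPdist_le => eps eps0.
have [k k0 kE] : exists2 k : R, 0 < k & h = k + k.
  by exists (h / 2); [rewrite divr_gt0|rewrite -splitr].
have e6 : 0 < eps / 6 by rewrite divr_gt0.
have [l l0 lk] : exists2 l : R, 0 < l & (l * k)^-1 = eps / 6.
  exists (k * (eps / 6))^-1; first by rewrite invr_gt0 mulr_gt0.
  by field; rewrite !gt_eqF// mulr_gt0.
have /cvgrPdist_le/(_ _ e6) L1 := H l k l0.
have /cvgrPdist_le/(_ _ e6) L2 := H l (- k) l0.
apply: filterS (filterI L1 L2) => n [w1 w2]; rewrite sub0r normrN ger0_norm ?prob_ge0//.
have mn := me n.
have mset1 : measurable [set w | h < e n w] by exact: mgt.
have mset2 : measurable [set w | e n w <= - h] by exact: mle.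
apply: (@le_trans _ _ (prob P ([set w | h < e n w] `|` [set w | e n w <= - h]))).
  apply: prob_le; [by apply: mgt; exact: measurableT_comp|exact: measurableU|].
  by move=> w /=; rewrite ltr_normr => /orP[?|?]; [left|right; rewrite lerNr ltW].
apply: (le_trans (prob_setU _ _ _)) => //.
have v2 := @prob_le_logistic _ _ _ P _ l (- h) k mn l0 k0.
rewrite (_ : - h + k = - k) ?lk in v2; last by rewrite kE; ring.
have v1 : prob P [set w | h < e n w] <= \int[P]_w logistic l k (e n w) + eps / 6.
  have i1 : P.-integrable setT (EFin \o (fun _ : T => eps / 6)).
    exact: finite_measure_integrable_cst.
  have i2 := integrable_logistic P l k mn.
  rewrite -[X in _ + X](Rintegral_prob_cst P) -(RintegralD measurableT i2 i1).
  apply: prob_le_Rintegral => //; first exact: integrable_addr.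
    by move=> w; rewrite addr_ge0 ?logistic_ge0 ?ltW.
  move=> w /= hw; have : k + k <= e n w by rewrite -kE ltW.
  by move=> /(logistic_ge l0 k0); rewrite lk; lra.
have a1 : logistic l k 0 <= eps / 6.
  by rewrite -lk; apply: logistic_le; rewrite ?subrr.
have a2 : 1 - eps / 6 <= logistic l (- k) 0.
  by rewrite -lk; apply: logistic_ge; rewrite ?addNr.
have := tail_sandwich w1 w2 a1 a2 v1 v2.
by rewrite (_ : 6 * (eps / 6) = eps)//; field.
Unshelve. all: by end_near. Qed.

Lemma ae_cvg_in_probability0 e :
  (forall n, measurable_fun setT (e n)) ->
  {ae P, forall w, e n w @[n --> \oo] --> (0 : R)} -> cvg_in_probability0 e.
Proof.
move=> me ce h h0.
have ms n : measurable [set w | h < `|e n w|].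
  by apply: mgt; exact: measurableT_comp.
have [] := @dominated_convergence _ _ _ P setT measurableT
  (fun n w => (\1_[set w | h < `|e n w|] w)%:E) (cst 0%E) (cst 1%:E) => //.
- by move=> n; apply/measurable_EFinP; exact: measurable_indic.
- apply: filterS ce => w /cvgrPdist_lt/(_ _ h0) ce _.
  apply: cvg_EFin; first by near=> n.
  apply: cvg_near_cst; near=> n.
  have : `|0 - e n w| < h by near: n.
  rewrite sub0r normrN => /lt_geF hw /=.
  by rewrite indicE memNset//= ltNge; apply/negP; rewrite negbK ltW// ltNge hw.
- exact: finite_measure_integrable_cst.
- apply: aeW => w n _; rewrite lee_fin indicE; case: (_ \in _) => /=;
  by rewrite ?normr1 ?normr0.
- move=> _ _; rewrite integral_cst// mul0e => /fine_cvgP[_] H.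
  apply: cvg_trans H; apply: near_eq_cvg; near=> n.
  by rewrite /= integral_indic//= setIT.
Unshelve. all: by end_near. Qed.

End convergence.

(** * The split chain *)

(** By the layer cake formula the mean of a function with values in [[0, 1]] is an
    average of probabilities of superlevel sets; so a bound in total variation
    bounds the difference of two means without any factor. *)
Lemma le_Rintegral_ccdf d1 (T1 : measurableType d1) d2 (T2 : measurableType d2)
    (R : realType) (P1 : probability T1 R) (P2 : probability T2 R)
    (f1 : T1 -> R) (f2 : T2 -> R) (c : R) :
  measurable_fun setT f1 -> measurable_fun setT f2 ->
  (forall x, 0 <= f1 x <= 1) -> (forall x, 0 <= f2 x) -> 0 <= c ->
  (forall r, P1 [set x | (r < f1 x)%R] <= P2 [set x | (r < f2 x)%R] + c%:E)%E ->
  (\int[P1]_x (f1 x)%:E <= \int[P2]_x (f2 x)%:E + c%:E)%E.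
Proof.
move=> mf1 mf2 f101 f20 c0 H.
pose F1 : {RV P1 >-> R} := mfun_Sub (mem_set mf1).
pose F2 : {RV P2 >-> R} := mfun_Sub (mem_set mf2).
have e1 : (\int[P1]_x (f1 x)%:E = \int[lebesgue_measure]_(r in `[0%R, +oo[) ccdf F1 r)%E.
  rewrite -ge0_expectation_ccdf ?unlock//.
  by move=> x; case/andP: (f101 x).
have e2 : (\int[P2]_x (f2 x)%:E = \int[lebesgue_measure]_(r in `[0%R, +oo[) ccdf F2 r)%E.
  by rewrite -ge0_expectation_ccdf ?unlock//.
have e3 : (c%:E = \int[lebesgue_measure]_(r in `[0%R, +oo[) (c%:E * (\1_(`[0%R, 1%R] : set R) r)%:E))%E.
  rewrite ge0_integralZl//=; last exact/measurable_EFinP/measurable_funTS/measurable_indic.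
  rewrite integral_indic//= setIidl; last first.
    by move=> x /=; rewrite !in_itv/= andbT => /andP[].
  by rewrite lebesgue_measure_itv/= lte01 oppr0 adde0 mule1.
have mi : measurable_fun (`[0%R, +oo[%classic : set R)
    (fun r : R => c%:E * (\1_(`[0%R, 1%R] : set R) r)%:E)%E.
  apply: measurable_funeM; apply/measurable_EFinP/measurable_funTS/measurable_indic.
  exact: measurable_itv.
have i0 (r : R) : (0 <= c%:E * (\1_(`[0%R, 1%R] : set R) r)%:E)%E.
  by rewrite mule_ge0// lee_fin.
rewrite e1 e2 e3 -ge0_integralD//=; last first.
  by apply: measurable_funTS; exact: ccdf_measurable.
apply: ge0_le_integral => //=.
- by apply: measurable_funTS; exact: ccdf_measurable.
- by apply: emeasurable_funD => //; apply: measurable_funTS; exact: ccdf_measurable.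
move=> r; rewrite in_itv/= andbT => r0.
have cE d (T : measurableType d) (P : probability T R) (F : {RV P >-> R}) :
    ccdf F r = P [set x | (r < F x)%R].
  by rewrite /ccdf /distribution/= /pushforward; congr (P _);
    apply/seteqP; split => x /=; rewrite in_itv/= andbT.
rewrite !cE indicE; case: (boolP (r \in _)) => [_|].
  by rewrite mule1; exact: H.
rewrite notin_setE/= in_itv/= r0/= => /negP; rewrite -ltNge => r1.
rewrite (_ : [set x | r < F1 x] = set0) ?measure0//; last first.
  apply/seteqP; split => // x /= rx; have /andP[_ f1x] := f101 x.
  by have := lt_le_trans (lt_trans r1 rx) f1x; rewrite ltxx.
by rewrite mule0 adde0.
Qed.

Section history.
Context d (S : measurableType d) (R : realType).
Context d' (Omega : measurableType d') (Pr : probability Omega R).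
Variables (X : nat -> {RV Pr >-> S}) (delta : nat -> {RV Pr >-> bool}).

Notation hist := (history X delta).

Let gens (i k : nat) : set (set Omega) :=
  (\bigcup_(l in [set l | (l <= i)%N]) preimage_set_system setT (X l) measurable) `|`
  (\bigcup_(l in [set l | (l < k)%N]) preimage_set_system setT (delta l) measurable).

Lemma history_X l i k A : (l <= i)%N -> measurable A -> hist i k (X l @^-1` A).
Proof.
move=> li mA; apply: sub_gen_smallest; left; exists l => //.
by exists A => //; rewrite setTI.
Qed.

Lemma history_delta l i k : (l < k)%N -> hist i k [set w | delta l w].
Proof.
move=> lk; apply: sub_gen_smallest; right; exists l => //.
by exists [set true] => //; rewrite setTI.
Qed.

Lemma history_setI i k A B : hist i k A -> hist i k B -> hist i k (A `&` B).
Proof. exact: (@measurableI _ (g_sigma_algebraType (gens i k))). Qed.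

Lemma history_setU i k A B : hist i k A -> hist i k B -> hist i k (A `|` B).
Proof. exact: (@measurableU _ (g_sigma_algebraType (gens i k))). Qed.

Lemma history_setC i k A : hist i k A -> hist i k (~` A).
Proof. exact: (@measurableC _ (g_sigma_algebraType (gens i k))). Qed.

Lemma history_setT i k : hist i k setT.
Proof. exact: (@measurableT _ (g_sigma_algebraType (gens i k))). Qed.

Lemma history_set0 i k : hist i k set0.
Proof. exact: (@measurable0 _ (g_sigma_algebraType (gens i k))). Qed.

Lemma history_mono i k i' k' A : (i <= i')%N -> (k <= k')%N ->
  hist i k A -> hist i' k' A.
Proof.
move=> ii kk hA; apply: (hA (hist i' k')); split; first exact: smallest_sigma_algebra.
move=> B [[l /= li [C mC <-]]|[l /= lk [C mC <-]]]; apply: sub_gen_smallest.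
  by left; exists l; [exact: leq_trans ii|exists C].
by right; exists l; [exact: leq_trans kk|exists C].
Qed.

Lemma history_measurable i k A : hist i k A -> measurable A.
Proof.
move=> hA; apply: (hA measurable); split; first exact: sigma_algebra_measurable.
move=> B [[l _ [C mC <-]]|[l _ [C mC <-]]]; rewrite setTI.
  by rewrite -[X in measurable X]setTI; exact: measurable_funP.
by rewrite -[X in measurable X]setTI; exact: measurable_funP.
Qed.

End history.

(** * Regeneration *)

Section regeneration.
Context d (S : measurableType d) (R : realType).
Variables (P : R.-pker S ~> S) (pi Q : probability S R) (s : S -> R).
Hypothesis hmin : minorization P pi s Q.
Context d' (Omega : measurableType d') (Pr : probability Omega R).
Variables (X : nat -> {RV Pr >-> S}) (delta : nat -> {RV Pr >-> bool}).
Hypothesis hX : split_chain X delta P s Q Q.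
Local Open Scope ereal_scope.

Notation hist := (history X delta).

Let ms : measurable_fun setT s. Proof. by case: hmin. Qed.

Let s01 x : (0 <= s x <= 1)%R. Proof. by case: hmin. Qed.

Let QP x A : measurable A -> (s x)%:E * Q A <= P x A.
Proof. by case: hmin => _ _ _; exact. Qed.

Lemma measurable_delta i : measurable [set w | delta i w].
Proof.
apply: (history_measurable (X := X) (delta := delta) (i := i) (k := i.+1)).
exact: history_delta.
Qed.

(** The part of the transition without renewal, [(1 - s) * residual]. Unlike the
    residual kernel it needs no case distinction on [s x = 1]. *)
Definition taboo (A : set S) (x : S) : \bar R := P x A - (s x)%:E * Q A.

Let fin_P x A : measurable A -> P x A \is a fin_num.
Proof.
move=> mA; rewrite ge0_fin_numE//; apply: (@le_lt_trans _ _ 1); last exact: ltry.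
by rewrite -(prob_kernel (s := P) x) le_measure ?inE//; exact: mem_set.
Qed.

Let fin_sQ x A : measurable A -> (s x)%:E * Q A \is a fin_num.
Proof. by move=> mA; rewrite fin_numM// fin_num_measure. Qed.

Lemma taboo_ge0 A x : measurable A -> 0 <= taboo A x.
Proof. by move=> mA; rewrite sube_ge0 ?QP// fin_sQ ?orbT. Qed.

Lemma measurable_taboo A : measurable A -> measurable_fun setT (taboo A).
Proof.
move=> mA; apply: emeasurable_funB; first exact: measurable_kernel.
by apply: emeasurable_funM => //; apply/measurable_EFinP.
Qed.

Lemma taboo_add A x : measurable A -> taboo A x + (s x)%:E * Q A = P x A.
Proof. by move=> mA; rewrite /taboo subeK// fin_sQ. Qed.

(* When s x = 1 the minorization forces P x = Q, so both sides vanish. *)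
Let residual_taboo A x : measurable A ->
  residual P s Q x A * (1 - s x)%:E = taboo A x.
Proof.
move=> mA; rewrite /residual; case: ifPn => [s1|].
  have s1' : (1 - s x != 0)%R by rewrite subr_eq0 gt_eqF.
  rewrite -/(taboo A x) -muleA; have -> : (1 - s x)%:E^-1 * (1 - s x)%:E = 1.
    by rewrite inver (negbTE s1') -EFinM mulVf.
  by rewrite mule1.
rewrite -leNgt => s1; have sx : s x = 1%R.
  by apply/eqP; rewrite eq_le s1; case/andP: (s01 x) => _ ->.
rewrite sx subrr mule0 /taboo sx mul1e.
have PA : P x A = Q A.
  apply/eqP; rewrite eq_le; have := QP x mA; rewrite sx mul1e => -> /=.
  have := QP x (measurableC mA); rewrite sx mul1e andbT.
  have -> : Q (~` A) = 1 - Q A by rewrite probability_setC.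
  have <- : P x A + P x (~` A) = 1.
    rewrite -(prob_kernel (s := P) x) -[in RHS](setUv A) measureU//.
      exact: measurableC.
    by rewrite setICr.
  rewrite leeBlDr ?fin_num_measure// => h.
  by move: h; rewrite [X in _ <= X]addeC leeD2rE// fin_P//; exact: measurableC.
by rewrite PA subee// fin_num_measure.
Qed.

Let residual_ge0 A x : measurable A -> 0 <= residual P s Q x A.
Proof.
move=> mA; rewrite /residual; case: ifPn => [s1|_ //].
by rewrite mule_ge0 ?taboo_ge0// inve_ge0 lee_fin subr_ge0 ltW.
Qed.

Let measurable_residual A : measurable A ->
  measurable_fun setT (fun x => residual P s Q x A).
Proof.
move=> mA; rewrite (_ : (fun x => _) = (fun x =>
    if (s x < 1)%R then taboo A x * ((1 - s x)^-1)%:E else Q A)); last first.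
  apply/funext => x; rewrite /residual; case: ifPn => // s1.
  by rewrite inver subr_eq0 gt_eqF.
apply: measurable_fun_ifT => //; first exact: measurable_fun_ltr.
apply: emeasurable_funM; first exact: measurable_taboo.
apply/measurable_EFinP.
rewrite (_ : (fun x => _) = (@powR R ^~ (- 1)%R) \o (fun x => 1 - s x)%R); last first.
  apply/funext => x /=; rewrite powR_inv1// subr_ge0.
  by case/andP: (s01 x).
by apply: (measurableT_comp (measurable_powR _)); exact: measurable_funB.
Qed.

Let mX i : measurable_fun setT (X i). Proof. exact: measurable_funP. Qed.

Let msX i : measurable_fun setT (fun w => s (X i w)).
Proof. exact: measurableT_comp. Qed.

Lemma quiet_mass i E : hist i i E ->
  Pr (E `&` ~` [set w | delta i w]) = \int[Pr]_(w in E) (1 - s (X i w))%:E.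
Proof.
move=> hE; have mE := history_measurable hE.
have md := measurable_delta i.
have h1 : Pr (E `&` ~` [set w | delta i w]) + \int[Pr]_(w in E) (s (X i w))%:E = Pr E.
  case: hX => _ /(_ i E hE) <- _.
  by rewrite -setDE [RHS](measureDI Pr mE md).
have h2 : \int[Pr]_(w in E) (1 - s (X i w))%:E + \int[Pr]_(w in E) (s (X i w))%:E = Pr E.
  rewrite -ge0_integralD//=; last 4 first.
  - by move=> w _; rewrite lee_fin subr_ge0; case/andP: (s01 (X i w)).
  - apply: measurable_funTS; apply/measurable_EFinP.
    by apply: measurable_funB => //; exact: msX.
  - by move=> w _; rewrite lee_fin; case/andP: (s01 (X i w)).
  - by apply: measurable_funTS; apply/measurable_EFinP; exact: msX.
  under eq_integral do rewrite -EFinD subrK.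
  by rewrite integral_cst// mul1e.
have fs : \int[Pr]_(w in E) (s (X i w))%:E \is a fin_num.
  case: hX => _ /(_ i E hE) <- _; rewrite fin_num_measure//.
  exact: measurableI.
by rewrite -(addeK (Pr (E `&` _)) fs) h1 -h2 addeK.
Qed.

(** One step of the split chain on the event that the coin [delta i] shows 0; the
    density [1 - s] of that event cancels the normalisation of the residual. *)
Lemma step_quiet i E A : hist i i E -> measurable A ->
  Pr (E `&` ~` [set w | delta i w] `&` X i.+1 @^-1` A) =
  \int[Pr]_(w in E) taboo A (X i w).
Proof.
move=> hE mA; have mE := history_measurable hE.
have hEd : hist i i.+1 (E `&` ~` [set w | delta i w]).
  apply: history_setI; first exact: (history_mono _ _ hE).
  by apply: history_setC; exact: history_delta.
have mEd := history_measurable hEd.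
case: hX => _ _ /(_ i _ A hEd mA) ->.
transitivity (\int[Pr]_(w in E `&` ~` [set w | delta i w]) residual P s Q (X i w) A).
  by apply: eq_integral => w /set_mem[_ /= /negP/negbTE ->].
rewrite (integral_law_density (mu2 := Pr) mEd mE (mX i) (mX i)
  (p := fun w => (1 - s (X i w))%R) _ _ _ (f := fun x => residual P s Q x A)).
- by apply: eq_integral => w _; rewrite residual_taboo.
- by apply: measurable_funB => //; exact: msX.
- by move=> w; rewrite subr_ge0; case/andP: (s01 (X i w)).
- move=> B mB; rewrite setIAC; apply: quiet_mass.
  by apply: history_setI => //; exact: history_X.
- exact: measurable_residual.
- by move=> x; exact: residual_ge0.
Qed.

Lemma step_renewal i E A : hist i i.+1 E -> E `<=` [set w | delta i w] ->
  measurable A -> Pr (E `&` X i.+1 @^-1` A) = Pr E * Q A.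
Proof.
move=> hE Ed mA; have mE := history_measurable hE.
case: hX => _ _ /(_ i _ A hE mA) ->.
transitivity (\int[Pr]_(w in E) (cst (Q A)) w).
  by apply: eq_integral => w /set_mem/Ed /= ->.
by rewrite integral_cst// muleC.
Qed.

Definition quiet n l : set Omega :=
  [set w | forall i, (n <= i < n + l)%N -> ~~ delta i w].

Definition visits (b : S -> bool) n l (w : Omega) : nat :=
  \sum_(n <= i < n + l) b (X i w).

(** The predicate [p] on the number of visits to [b] is carried along because the
    induction on [l] shifts it when the last state lies in [b]. *)
Definition excursion b n l (p : pred nat) : set Omega :=
  [set w | quiet n l w /\ p (visits b n l w)].

Section visits_to_b.
Variable (b : S -> bool).
Hypothesis mb : measurable [set x | b x].

Lemma excursion0 n p : excursion b n 0 p = if p 0%N then setT else set0.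
Proof.
have q0 w : quiet n 0 w by move=> i; rewrite addn0; case: ltngtP.
case: ifPn => p0; apply/seteqP; split => w //=.
  by move=> _; split => //; rewrite /visits addn0 big_geq.
by rewrite /excursion/= /visits addn0 big_geq// (negbTE p0) => -[].
Qed.

(* The state at time n + l is split off, according to whether it lies in b. *)
Let piece n l (p : pred nat) (B : set S) := excursion b n l p `&` X (n + l)%N @^-1` B.

Let visitsS n l w : visits b n l.+1 w = (visits b n l w + b (X (n + l)%N w))%N.
Proof. by rewrite /visits addnS big_nat_recr//= leq_addr. Qed.

Let quietS n l : quiet n l.+1 = quiet n l `&` ~` [set w | delta (n + l)%N w].
Proof.
apply/seteqP; split => w /=.
  move=> H; split; first by move=> i /andP[ni il]; apply: H; rewrite ni addnS ltnS ltnW.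
  by apply/negP; apply: H; rewrite leq_addr addnS ltnSn.
move=> [H /negP dl] i /andP[ni]; rewrite addnS ltnS leq_eqVlt => /predU1P[->//|il].
by apply: H; rewrite ni.
Qed.

Let pieces n l (p : pred nat) : [set w | quiet n l w /\ p (visits b n l.+1 w)] =
  piece n l (fun c => p c.+1) [set x | b x] `|` piece n l p (~` [set x | b x]).
Proof.
apply/seteqP; split => w /=; rewrite visitsS.
  by move=> [qw]; case: (boolP (b _)) => bw; rewrite ?addn1 ?addn0 => pw;
    [left|right]; split => //; exact/negP.
by move=> [[[qw pw] /= ->]|[[qw pw] /= /negP/negbTE ->]]; rewrite ?addn1 ?addn0.
Qed.

Let pieces_disj n l (p p' : pred nat) :
  piece n l p [set x | b x] `&` piece n l p' (~` [set x | b x]) = set0.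
Proof. by apply/seteqP; split => // w [[_ /= ?] [_ /= ?]]. Qed.

Let excursionS n l p : excursion b n l.+1 p =
  (piece n l (fun c => p c.+1) [set x | b x] `|` piece n l p (~` [set x | b x]))
  `&` ~` [set w | delta (n + l)%N w].
Proof.
rewrite -pieces /excursion quietS; apply/seteqP; split => w /=.
  by move=> [[]].
by move=> [[]].
Qed.

Lemma history_excursion n l p : hist (n + l) (n + l) (excursion b n l p).
Proof.
elim: l p => [|l IHl] p.
  by rewrite excursion0; case: ifP => _; [exact: history_setT|exact: history_set0].
have hmono E : hist (n + l) (n + l) E -> hist (n + l.+1) (n + l.+1) E.
  by apply: history_mono; rewrite leq_add2l.
rewrite excursionS; apply: history_setI; last first.
  by apply: history_setC; apply: history_delta; rewrite addnS.
apply: history_setU; apply: hmono; apply: history_setI; try exact: IHl.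
  exact: history_X.
by apply: history_X => //; exact: measurableC.
Qed.

Let history_piece n l p B : measurable B -> hist (n + l) (n + l) (piece n l p B).
Proof.
by move=> mB; apply: history_setI; [exact: history_excursion|exact: history_X].
Qed.

(** Abstracts from the ways to know that the chain is renewed at time [n]: the
    initial time, a coin showing 1 at time [n.-1], or a whole sequence of tours. *)
Definition regenerates n (E : set Omega) := hist n n E /\
  forall A, measurable A -> Pr (E `&` X n @^-1` A) = Pr E * Q A.

Lemma regenerates_setT : regenerates 0 setT.
Proof.
split; first exact: history_setT.
move=> A mA; rewrite setTI probability_setT mul1e.
by case: hX => <-.
Qed.

Let disj_pr (E A B C : set Omega) : measurable E -> measurable A -> measurable B ->
  measurable C -> A `&` B = set0 ->
  Pr (E `&` ((A `|` B) `&` C)) = Pr (E `&` A `&` C) + Pr (E `&` B `&` C).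
Proof.
move=> mE mA mB mC AB; rewrite setIA setIUr setIUl measureU//.
- by apply: measurableI => //; exact: measurableI.
- by apply: measurableI => //; exact: measurableI.
- by apply/seteqP; split => // w [[[_ ?] _] [[_ ?] _]]; rewrite -AB; split.
Qed.

(* The equality of laws of the state at the end of the excursion, integrated
   against f; for f = taboo A it gives the next step, for f = s its end. *)
Let piece_law n E l p B :
  (forall A, measurable A ->
    Pr (E `&` excursion b n l p `&` X (n + l)%N @^-1` A) =
    Pr E * Pr (excursion b 0 l p `&` X l @^-1` A)) ->
  hist n n E -> measurable B ->
  forall f, measurable_fun setT f -> (forall x, 0 <= f x) ->
  \int[Pr]_(w in E `&` piece n l p B) f (X (n + l)%N w) =
  Pr E * \int[Pr]_(w in piece 0 l p B) f (X l w).
Proof.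
move=> IH hE mB f mf f0.
have mE := history_measurable hE.
have mp k := history_measurable (@history_piece k l p B mB).
have -> : Pr E = (fine (Pr E))%:E by rewrite fineK// fin_num_measure.
have mXp k : measurable_fun (piece 0 l p B) (fun w => f (X k w)).
  by apply: measurable_funTS; exact: measurableT_comp.
rewrite -ge0_integralZl_EFin//; last exact: fine_ge0.
under [RHS]eq_integral do rewrite muleC.
apply: (@integral_law_density _ _ _ _ _ Pr _ _ Pr _ _ (X (n + l)%N) (X l)
  (cst (fine (Pr E)))) => //.
- exact: measurableI.
- by move=> w; exact: fine_ge0.
- move=> A mA; transitivity (Pr E * Pr (piece 0 l p B `&` X l @^-1` A)); last first.
    have mPA : measurable (piece 0 l p B `&` X l @^-1` A).
      by apply: measurableI => //; rewrite -[X in measurable X]setTI; exact: mX.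
    by have := @integral_cst _ _ _ Pr _ mPA (fine (Pr E))%:E; rewrite fineK ?fin_num_measure.
  have H := IH (B `&` A) (measurableI _ _ mB mA).
  transitivity (Pr (E `&` excursion b n l p `&` X (n + l)%N @^-1` (B `&` A))).
    by congr (Pr _); apply/seteqP; split=> w /= => [[[? [? ?]] ?]|[[? ?] [? ?]]].
  rewrite H; congr (_ * Pr _).
  by apply/seteqP; split=> w /= => [[? [? ?]]|[[? ?] ?]].
Qed.

(** The regeneration property: given a renewal at time [n], what follows is
    independent of the past and distributed as from time 0. The induction goes
    one quiet step at a time, splitting according to whether the current state
    lies in [b]. *)
Lemma excursion_law n E : regenerates n E -> forall l p A, measurable A ->
  Pr (E `&` excursion b n l p `&` X (n + l)%N @^-1` A) =
  Pr E * Pr (excursion b 0 l p `&` X l @^-1` A).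
Proof.
move=> [hE EQ]; have mE := history_measurable hE.
elim=> [|l IHl] p A mA.
  rewrite !excursion0; case: ifP => _; last by rewrite setI0 !set0I measure0 mule0.
  rewrite setIT addn0 EQ// setTI; congr (_ * _).
  by case: hX => <-.
have mp k p' B (mB : measurable B) := history_measurable (@history_piece k l p' B mB).
have key p' B : measurable B ->
    Pr (E `&` piece n l p' B `&` (~` [set w | delta (n + l)%N w] `&` X (n + l).+1 @^-1` A)) =
    Pr E * Pr (piece 0 l p' B `&` (~` [set w | delta l w] `&` X l.+1 @^-1` A)).
  move=> mB; rewrite (setIA (E `&` piece n l p' B)) (setIA (piece 0 l p' B)) step_quiet//; last first.
    apply: history_setI; last exact: history_piece.
    by apply: history_mono hE; rewrite leq_addr.
  rewrite step_quiet//; last exact: (@history_piece 0 l p' B mB).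
  apply: (@piece_law n E l p' B _ hE mB (taboo A)).
  - by move=> B' mB'; exact: IHl.
  - exact: measurable_taboo.
  - by move=> x; exact: taboo_ge0.
have mdX k i : measurable (~` [set w | delta k w] `&` X i @^-1` A).
  apply: measurableI; first by apply: measurableC; exact: measurable_delta.
  by rewrite -[X in measurable X]setTI; exact: mX.
have mCb : measurable (~` [set x | b x]) by exact: measurableC.
rewrite -setIA addnS excursionS -[X in E `&` X]setIA disj_pr//; try by apply: mp.
rewrite !key//.
have -> : excursion b 0 l.+1 p `&` X l.+1 @^-1` A = setT `&`
    ((piece 0 l (fun c => p c.+1) [set x | b x] `|` piece 0 l p (~` [set x | b x]))
     `&` (~` [set w | delta l w] `&` X l.+1 @^-1` A)).
  by rewrite setTI setIA excursionS.
rewrite disj_pr//; try by apply: mp.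
by rewrite !setTI ge0_muleDr.
Qed.

(** The coin that ends the tour is the one of time [n + l], so the next renewal is
    at time [(n + l).+1] and the state at time [n + l] still counts as visited. *)
Definition tour n l (p : pred nat) : set Omega :=
  [set w | quiet n l w /\ p (visits b n l.+1 w)] `&` [set w | delta (n + l)%N w].

Lemma history_tour n l p : hist (n + l) (n + l).+1 (tour n l p).
Proof.
rewrite /tour pieces; apply: history_setI; last exact: history_delta.
by apply: (@history_mono _ _ _ _ _ _ _ _ (n + l) (n + l)) => //;
  apply: history_setU; apply: history_piece => //; exact: measurableC.
Qed.

Lemma tour_law n E l p : regenerates n E ->
  Pr (E `&` tour n l p) = Pr E * Pr (tour 0 l p).
Proof.
move=> hr; have [hE EQ] := hr; have mE := history_measurable hE.
have mp k p' B (mB : measurable B) := history_measurable (@history_piece k l p' B mB).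
have key p' B : measurable B ->
    Pr (E `&` piece n l p' B `&` [set w | delta (n + l)%N w]) =
    Pr E * Pr (piece 0 l p' B `&` [set w | delta l w]).
  move=> mB; case: hX => _ Hd _.
  rewrite Hd; last first.
    apply: history_setI; last exact: history_piece.
    by apply: history_mono hE; rewrite leq_addr.
  rewrite Hd; last exact: (@history_piece 0 l p' B mB).
  apply: (@piece_law n E l p' B _ hE mB (EFin \o s)).
  - by move=> A mA; exact: excursion_law.
  - exact/measurable_EFinP.
  - by move=> x; rewrite lee_fin; case/andP: (s01 x).
have mCb : measurable (~` [set x | b x]) by exact: measurableC.
have md k : measurable [set w | delta k w] by exact: measurable_delta.
rewrite /tour !pieces disj_pr//; [|by apply: mp..].
rewrite !key// -[X in _ = _ * Pr X]setTI disj_pr//; [|by apply: mp..].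
by rewrite !setTI ge0_muleDr.
Qed.

Lemma tour_regenerates n E l p : regenerates n E ->
  regenerates (n + l).+1 (E `&` tour n l p).
Proof.
move=> [hE EQ].
have hEt : hist (n + l) (n + l).+1 (E `&` tour n l p).
  apply: history_setI; last exact: history_tour.
  by apply: history_mono hE; rewrite ?leqW// leq_addr.
split; first exact: history_mono hEt.
by move=> A mA; apply: step_renewal => // w [_ []].
Qed.

End visits_to_b.

Lemma delta_regenerates n : regenerates n.+1 [set w | delta n w].
Proof.
split; first by apply: history_delta.
by move=> A mA; apply: step_renewal => //; exact: history_delta.
Qed.

End regeneration.

(** * Summability of the renewal mass and the stationary cycle formula *)

(** Compare with the increments of [k ^ (1 - m)], by the mean value theorem. *)
Lemma powR_sum_le (R : realType) (m : R) : 1 < m ->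
  exists C : R, forall n, \sum_(1 <= k < n) k%:R `^ (- m) <= C.
Proof.
move=> m1; have m0 : 0 < m - 1 by rewrite subr_gt0.
have step k : (0 < k)%N -> (m - 1) * k.+1%:R `^ (- m) <= k%:R `^ (1 - m) - k.+1%:R `^ (1 - m) :> R.
  move=> k0; have k0' : 0 < k%:R :> R by rewrite ltr0n.
  have kk : k%:R < k.+1%:R :> R by rewrite ltr_nat.
  have dR (x : R) : 0 < x -> is_derive x 1 (fun x : R => x `^ (1 - m)) ((1 - m) * x `^ (- m)).
    move=> x0; have := is_derive1_powR (1 - m) x0.
    by rewrite (_ : 1 - m - 1 = - m)//; ring.
  have [||c] := @MVT R (fun x : R => x `^ (1 - m)) (fun c => (1 - m) * c `^ (- m)) _ _ kk.
  - move=> x; rewrite in_itv/= => /andP[kx _]; apply: dR; exact: lt_trans kx.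
  - apply: derivable_within_continuous => x; rewrite in_itv/= => /andP[kx _].
    by case: (dR x (lt_le_trans k0' kx)).
  rewrite in_itv/= => /andP[kc ck] e.
  rewrite -[leRHS]opprB e (_ : k.+1%:R - k%:R = 1); last by rewrite -natr1; ring.
  rewrite mulr1 -mulNr opprB ler_pM2l// !powRN lef_pV2 ?posrE ?powR_gt0//; last exact: lt_trans kc.
  by rewrite ge0_ler_powR ?nnegrE//; [lra|exact/ltW/(lt_trans k0')|exact: ltW].
exists (1 + (m - 1)^-1) => -[|[|n]]; first by rewrite big_geq// addr_ge0// invr_ge0 ltW.
  by rewrite big_geq// addr_ge0// invr_ge0 ltW.
rewrite big_nat_recl//= powR1 lerD2l.
suff H : (m - 1) * \sum_(1 <= i < n.+1) i.+1%:R `^ (- m) <= 1 - n.+1%:R `^ (1 - m).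
  rewrite -(ler_pM2l m0) mulfV ?gt_eqF// (le_trans H)// lerBlDr lerDl; exact: powR_ge0.
elim: n => [|n IHn]; first by rewrite big_geq// mulr0 powR1 subrr.
rewrite big_nat_recr//= mulrDr (le_trans (lerD IHn (step n.+1 _)))//.
by rewrite addrA subrK.
Qed.

Section stationarity.
Context d (S : measurableType d) (R : realType).
Variables (P : R.-pker S ~> S) (pi Q : probability S R) (s : S -> R).
Hypothesis hmin : minorization P pi s Q.
Hypothesis hinv : Pilot.Defs.invariant P pi.
Context d' (Omega : measurableType d') (Pr : probability Omega R).
Variables (X : nat -> {RV Pr >-> S}) (delta : nat -> {RV Pr >-> bool}).
Hypothesis hX : split_chain X delta P s Q Q.
Local Open Scope ereal_scope.

Let ms : measurable_fun setT s. Proof. by case: hmin. Qed.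

Let s01 x : (0 <= s x <= 1)%R. Proof. by case: hmin. Qed.

Let s0 x : (0 <= s x)%R. Proof. by case/andP: (s01 x). Qed.

Let mX i : measurable_fun setT (X i). Proof. exact: measurable_funP. Qed.

Let mXf i (f : S -> \bar R) (D : set Omega) :
  measurable_fun setT f -> measurable_fun D (fun w => f (X i w)).
Proof. by move=> mf; apply: measurable_funTS; exact: measurableT_comp. Qed.

Let mXA i A : measurable A -> measurable (X i @^-1` A).
Proof. by move=> mA; rewrite -[X in measurable X]setTI; exact: mX. Qed.

Lemma X0_law A : measurable A -> Pr (X 0%N @^-1` A) = Q A.
Proof. by move=> mA; case: hX => <-. Qed.

Lemma delta_mass i : Pr [set w | delta i w] = \int[Pr]_w (s (X i w))%:E.
Proof.
case: hX => _ /(_ i setT (@history_setT _ _ _ _ _ _ X delta i i)) <- _.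
by rewrite setTI.
Qed.

(** Forgetting the coins, the split chain moves according to [P]. *)
Lemma marginal_step i A : measurable A ->
  Pr (X i.+1 @^-1` A) = \int[Pr]_w P (X i w) A.
Proof.
move=> mA; have md := measurable_delta X delta i.
have -> : \int[Pr]_w P (X i w) A =
    \int[Pr]_w (taboo P Q s A (X i w) + (s (X i w))%:E * Q A).
  by apply: eq_integral => w _; rewrite taboo_add.
have msX : measurable_fun setT (fun w => (s (X i w))%:E).
  by apply/measurable_EFinP; exact: measurableT_comp.
rewrite ge0_integralD//; last 4 first.
- by move=> w _; exact: (taboo_ge0 hmin).
- by apply: measurableT_comp => //; exact: (measurable_taboo hmin).
- by move=> w _; rewrite mule_ge0// lee_fin.
- exact: emeasurable_funM.
rewrite -(step_quiet hmin hX (@history_setT _ _ _ _ _ _ X delta i i) mA) ge0_integralZr//; last first.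
  by move=> w _; rewrite lee_fin.
have hd := @history_delta _ _ _ _ _ _ X delta i i i.+1 (ltnSn i).
rewrite -delta_mass -(@step_renewal _ _ _ _ _ _ _ _ _ _ _ hX i _ _ hd _ mA)//.
rewrite setTI -measureU; last 3 first.
- by apply: measurableI; [exact: measurableC|exact: mXA].
- by apply: measurableI => //; exact: mXA.
- by apply/seteqP; split => // w [[? _] []].
by rewrite -setIUl setUC setUv setTI.
Qed.

Let measurable_kernel_integral (f : S -> \bar R) : measurable_fun setT f ->
  (forall x, 0 <= f x) -> measurable_fun setT (fun x => \int[P x]_y f y).
Proof.
move=> mf f0; apply: measurable_fun_integral_kernel => // U mU.
exact: measurable_kernel.
Qed.

Lemma marginal_step_integral i (f : S -> \bar R) :
  measurable_fun setT f -> (forall x, 0 <= f x) ->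
  \int[Pr]_w f (X i.+1 w) = \int[Pr]_w \int[P (X i w)]_y f y.
Proof.
move: f; apply: ge0_measurable_ind.
- move=> A mA; transitivity (Pr (X i.+1 @^-1` A)).
    by rewrite integral_preimage_indic// setTI.
  rewrite marginal_step//.
  by apply: eq_integral => w _; rewrite integral_indic// setIT.
- move=> k f k0 mf f0 IH.
  rewrite ge0_integralZl_EFin//; last exact: mXf.
  rewrite IH -ge0_integralZl_EFin//; last 2 first.
  + by move=> w _; exact: integral_ge0.
  + exact: (mXf i (measurable_kernel_integral mf f0)).
  by apply: eq_integral => w _; rewrite ge0_integralZl_EFin.
- move=> f g mf f0 IHf mg g0 IHg.
  rewrite (ge0_integralD _ measurableT (fun w _ => f0 _) (mXf i.+1 mf) (fun w _ => g0 _) (mXf i.+1 mg)).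
  have k0 (k : S -> \bar R) (k0 : forall x, 0 <= k x) w (_ : [set: Omega] w) :
      0 <= \int[P (X i w)]_y k y by exact: integral_ge0.
  rewrite IHf IHg.
  rewrite -(ge0_integralD _ measurableT (k0 f f0)
    (mXf i (measurable_kernel_integral mf f0)) (k0 g g0)
    (mXf i (measurable_kernel_integral mg g0))).
  apply: eq_integral => w _.
  by rewrite (ge0_integralD _ measurableT (fun y _ => f0 y) mf (fun y _ => g0 y) mg).
- move=> u mu u0 ndu IH.
  rewrite (@monotone_convergence _ _ _ Pr _ measurableT (fun n w => u n (X i.+1 w)))//;
    [|first [by move=> w _; exact: ndu|by move=> n; exact: mXf]..].
  under eq_fun do rewrite IH.
  rewrite -(@monotone_convergence _ _ _ Pr _ measurableT (fun n w => \int[P (X i w)]_y u n y))//; last first.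
  + by move=> w _ p q pq; apply: ge0_le_integral => // y _; exact: ndu.
  + by move=> n w _; exact: integral_ge0.
  + by move=> n; exact: (mXf i (measurable_kernel_integral (mu n) (u0 n))).
  by apply: eq_integral => w _; rewrite monotone_convergence// => y _; exact: ndu.
Qed.

Lemma kernel_iter_ge0 n x A : 0 <= kernel_iter P n x A.
Proof.
by elim: n x => [|n IHn] x //=; apply: integral_ge0 => y _; exact: IHn.
Qed.

Lemma measurable_kernel_iter n A : measurable A ->
  measurable_fun setT (fun x => kernel_iter P n x A).
Proof.
move=> mA; elim: n => [|n IHn] /=.
  by apply/measurable_EFinP; exact: measurable_indic.
by apply: measurable_kernel_integral => // x; exact: kernel_iter_ge0.
Qed.

Lemma marginal_iter n i A : measurable A ->
  Pr (X (i + n)%N @^-1` A) = \int[Pr]_w kernel_iter P n (X i w) A.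
Proof.
move=> mA; elim: n i => [|n IHn] i /=.
  rewrite addn0 -[in LHS](setTI (_ @^-1` _)) -integral_preimage_indic//.
rewrite addnS -addSn IHn.
rewrite (@marginal_step_integral i (fun x => kernel_iter P n x A))//.
  exact: measurable_kernel_iter.
by move=> x; exact: kernel_iter_ge0.
Qed.

Let fin_int_s : \int[pi]_x (s x)%:E \is a fin_num.
Proof.
rewrite ge0_fin_numE; last by apply: integral_ge0 => x _; rewrite lee_fin.
apply: (@le_lt_trans _ _ (\int[pi]_x (cst 1) x)).
  apply: ge0_le_integral => //; [|exact/measurable_EFinP|].
    by move=> x _; rewrite lee_fin.
  by move=> x _; rewrite lee_fin; case/andP: (s01 x).
rewrite integral_cst// mul1e.
by apply: le_lt_trans (probability_le1 pi measurableT) (ltry _).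
Qed.

Definition renewal_rate : R := fine (\int[pi]_x (s x)%:E).

Local Notation beta := renewal_rate.

Let betaE : beta%:E = \int[pi]_x (s x)%:E. Proof. by rewrite fineK. Qed.

Lemma renewal_rate_gt0 : (0 < beta)%R.
Proof. by rewrite -lte_fin betaE; case: hmin. Qed.

Lemma invariant_taboo A : measurable A ->
  \int[pi]_x taboo P Q s A x + beta%:E * Q A = pi A.
Proof.
move=> mA; rewrite -hinv//.
have -> : \int[pi]_x P x A = \int[pi]_x (taboo P Q s A x + (s x)%:E * Q A).
  by apply: eq_integral => w _; rewrite taboo_add.
have msE : measurable_fun setT (fun w => (s w)%:E) by exact/measurable_EFinP.
rewrite [RHS]ge0_integralD//; last 4 first.
- by move=> w _; exact: (taboo_ge0 hmin).
- exact: (measurable_taboo hmin).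
- by move=> w _; rewrite mule_ge0// lee_fin.
- exact: emeasurable_funM.
by rewrite ge0_integralZr// ?betaE// => w _; rewrite lee_fin.
Qed.

(** The stationary chain renews at rate [beta], so [pi] dominates [beta * Q]; this
    is how the integrability of [M] passes from [pi] to the initial law [Q]. *)
Lemma Q_le_pi A : measurable A -> beta%:E * Q A <= pi A.
Proof.
move=> mA; rewrite -invariant_taboo//; apply: leeDr.
by apply: integral_ge0 => x _; exact: (taboo_ge0 hmin).
Qed.

Lemma integral_X0_le (f : S -> \bar R) : measurable_fun setT f ->
  (forall x, 0 <= f x) -> beta%:E * \int[Pr]_w f (X 0%N w) <= \int[pi]_x f x.
Proof.
move=> mf f0; have b0 := renewal_rate_gt0.
rewrite -(ge0_integral_distribution (X 0%N) mf f0).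
have -> : beta = (NngNum (ltW b0))%:num by [].
rewrite -(ge0_integral_mscale (distribution Pr (X 0%N)) measurableT (NngNum (ltW b0)))//.
apply: le_measure_integral => // A mA.
by have := Q_le_pi mA; rewrite -X0_law.
Qed.

Let excursionT n l : excursion X delta xpredT n l predT = quiet delta n l.
Proof. by apply/seteqP; split => w //= -[]. Qed.

Let mT : measurable [set x : S | xpredT x].
Proof. by rewrite (_ : [set x | _] = setT)//; apply/seteqP; split. Qed.

Lemma history_quiet n l : history X delta (n + l) (n + l) (quiet delta n l).
Proof. by rewrite -excursionT; exact: history_excursion. Qed.

Lemma measurable_quiet n l : measurable (quiet delta n l).
Proof.
by have H := @history_quiet n l; exact: (history_measurable H).
Qed.

Lemma quiet_law n E l A : regenerates Q X delta n E -> measurable A ->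
  Pr (E `&` quiet delta n l `&` X (n + l)%N @^-1` A) =
  Pr E * Pr (quiet delta 0 l `&` X l @^-1` A).
Proof.
move=> hE mA; rewrite -!excursionT.
exact: (excursion_law hmin hX).
Qed.

Lemma quiet_lawT n E l : regenerates Q X delta n E ->
  Pr (E `&` quiet delta n l) = Pr E * Pr (quiet delta 0 l).
Proof.
move=> hE; have := quiet_law l hE measurableT.
by rewrite (_ : X (n + l)%N @^-1` setT = setT)// (_ : X l @^-1` setT = setT)// !setIT.
Qed.

Let quietS n l : quiet delta n l.+1 = quiet delta n l `&` ~` [set w | delta (n + l)%N w].
Proof.
apply/seteqP; split => w /=.
  move=> H; split; first by move=> i /andP[ni il]; apply: H; rewrite ni addnS ltnS ltnW.
  by apply/negP; apply: H; rewrite leq_addr addnS ltnSn.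
move=> [H /negP dl] i /andP[ni]; rewrite addnS ltnS leq_eqVlt => /predU1P[->//|il].
by apply: H; rewrite ni.
Qed.

Let quiet0 n : quiet delta n 0 = setT.
Proof. by apply/seteqP; split => w //= _ i; rewrite addn0; case: ltngtP. Qed.

(** Iterate [pi = pi taboo + beta Q]: each substitution of the identity into
    itself uncovers one more term of the mean occupation of a tour. *)
Lemma excursion_le_pi n A : measurable A ->
  beta%:E * \sum_(0 <= i < n) Pr (quiet delta 0 i `&` X i @^-1` A) <= pi A.
Proof.
have b0 := renewal_rate_gt0.
elim: n A => [|n IHn] A mA; first by rewrite big_geq// mule0.
have IH : forall f : S -> \bar R, measurable_fun setT f -> (forall x, 0 <= f x) ->
    beta%:E * \sum_(0 <= i < n) \int[Pr]_(w in quiet delta 0 i) f (X i w) <= \int[pi]_x f x.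
  apply: ge0_measurable_ind.
  - move=> B mB; rewrite integral_indic// setIT (le_trans _ (IHn B mB))//.
    under eq_bigr do rewrite (integral_preimage_indic _ (measurable_quiet _ _))//.
    exact: lexx.
  - move=> k f k0 mf f0 IH; rewrite ge0_integralZl_EFin//.
    under eq_bigr => i _ do rewrite (ge0_integralZl_EFin _ (measurable_quiet 0 i) _ (mXf i mf) k0)//.
    rewrite -ge0_sume_distrr; last by move=> i _; exact: integral_ge0.
    by rewrite muleCA lee_wpmul2l// lee_fin.
  - move=> f g mf f0 IHf mg g0 IHg; rewrite ge0_integralD//.
    under eq_bigr => i _ do rewrite (ge0_integralD _ (measurable_quiet 0 i) _ (mXf i mf) _ (mXf i mg))//.
    rewrite big_split/= ge0_muleDr; last 2 first.
      by apply: sume_ge0 => i _; exact: integral_ge0.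
      by apply: sume_ge0 => i _; exact: integral_ge0.
    exact: leeD.
  - move=> u mu u0 ndu IH.
    have -> : \sum_(0 <= i < n) \int[Pr]_(w in quiet delta 0 i) limn (u^~ (X i w)) =
        limn (fun k => \sum_(0 <= i < n) \int[Pr]_(w in quiet delta 0 i) u k (X i w)).
      apply/esym/cvg_lim => //; apply: cvg_nnesum => i _.
        by apply: nearW => k; exact: integral_ge0.
      apply: cvg_monotone_convergence => //.
      + exact: measurable_quiet.
      + by move=> k; exact: mXf.
    rewrite -limeMl//; last first.
      apply: ereal_nondecreasing_is_cvgn => p q pq; apply: lee_sum => i _.
      by apply: ge0_le_integral => //;
        [exact: measurable_quiet|exact: mXf|exact: mXf|move=> w _; exact: ndu].
    apply: lime_le.
      apply: ereal_nondecreasing_is_cvgn => p q pq; apply: lee_wpmul2l.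
        by rewrite lee_fin ltW.
      apply: lee_sum => i _.
      by apply: ge0_le_integral => //;
        [exact: measurable_quiet|exact: mXf|exact: mXf|move=> w _; exact: ndu].
    apply: nearW => k; apply: (le_trans (IH k)).
    apply: ge0_le_integral => //.
      by apply: (emeasurable_fun_cvg u) => // x _; apply: ereal_nondecreasing_is_cvgn; exact: ndu.
    move=> x _; rewrite (cvg_lim _ (ereal_nondecreasing_cvgn (ndu x)))//.
    by apply: ereal_sup_ubound; exists k.
rewrite big_nat_recl//= -(invariant_taboo mA) addeC ge0_muleDr//; last first.
  exact: sume_ge0.
rewrite quiet0 setTI X0_law// leeD2l// (le_trans _ (IH _ (measurable_taboo hmin mA) _))//; last first.
  by move=> x; exact: (taboo_ge0 hmin).
apply: lee_wpmul2l; first by rewrite lee_fin ltW.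
apply: lee_sum => i _.
rewrite quietS add0n.
by rewrite (step_quiet hmin hX (@history_quiet 0 i)).
Qed.

Let h l := prob Pr (quiet delta 0 l).

(* The event of a renewal at time n; the initial law being Q, time 0 is one. *)
Let renewed (n : nat) : set Omega :=
  if n is n'.+1 then [set w | delta n' w] else setT.

Let v n := prob Pr (renewed n).

Let renewed_regenerates n : regenerates Q X delta n (renewed n).
Proof.
case: n => [|n]; [exact: (regenerates_setT hX)|exact: (delta_regenerates hX)].
Qed.

Let measurable_renewed n : measurable (renewed n).
Proof. by case: n => [|n] //=; exact: (measurable_delta X delta n). Qed.

Let last_regeneration n E : measurable E ->
  Pr E = \sum_(0 <= i < n.+1) Pr (E `&` (renewed i `&` quiet delta i (n - i))).
Proof.
elim: n E => [|n IHn] E mE; first by rewrite big_nat1/= quiet0 !setIT.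
have md := measurable_delta X delta n.
rewrite big_nat_recr//= subnn quiet0 setIT.
have -> : Pr E = Pr (E `&` ~` [set w | delta n w]) + Pr (E `&` [set w | delta n w]).
  by rewrite -setDE; exact: measureDI.
congr (_ + _); rewrite IHn; last by apply: measurableI => //; exact: measurableC.
apply: eq_big_nat => i /andP[_ lin]; rewrite subSn// quietS subnKC//.
by rewrite -!setIA; congr (Pr (_ `&` _)); rewrite setIC -!setIA.
Qed.

Let vE n : (v n)%:E = Pr (renewed n).
Proof. exact/probE/measurable_renewed. Qed.

Lemma renewal_equation n : (\sum_(0 <= k < n.+1) h k * v (n - k)%N = 1)%R.
Proof.
apply: EFin_inj; have <- := probability_setT Pr.
rewrite (last_regeneration n measurableT) big_nat_rev/= -sumEFin.
rewrite add0n; apply: eq_big_nat => k /andP[_ kn].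
rewrite subSS setTI EFinM vE probE//; last exact: measurable_quiet.
by rewrite (quiet_lawT _ (renewed_regenerates k)) subKn// muleC.
Qed.

Variable m : R.
Hypothesis m1 : (1 < m)%R.
Hypothesis hpoly : polynomially_ergodic P pi m.

(* With mu_n the law of X n: the distance between mu_n and pi is at most the
   Q-mean of M times n^-m, and that mean is finite by domination by pi. *)
Let marginal_cvg : exists2 C : R, (0 <= C)%R & forall n A, (0 < n)%N -> measurable A ->
  Pr (X n @^-1` A) <= pi A + (C * n%:R `^ (- m))%:E /\
  pi A <= Pr (X n @^-1` A) + (C * n%:R `^ (- m))%:E.
Proof.
have [_ [M [M0 iM hM]]] := hpoly.
have mM : measurable_fun setT M by apply/measurable_EFinP; case/integrableP: iM.
have ME x : 0 <= (M x)%:E by rewrite lee_fin.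
have fM : \int[Pr]_w (M (X 0%N w))%:E \is a fin_num.
  rewrite ge0_fin_numE; last by apply: integral_ge0 => w _; exact: ME.
  have b0 := renewal_rate_gt0.
  rewrite -(@lte_pmul2l _ beta%:E) ?lte_fin// mulry gtr0_sg// mul1e.
  have mME : measurable_fun setT (EFin \o M) by exact/measurable_EFinP.
  apply: (le_lt_trans (integral_X0_le mME ME)).
  case/integrableP: iM => _; under eq_integral do rewrite gee0_abs ?ME//.
  by [].
exists (fine (\int[Pr]_w (M (X 0%N w))%:E)); first exact/fine_ge0/integral_ge0.
move=> n A n0 mA; set r := (n%:R `^ (- m))%R.
have r0 : (0 <= r)%R := powR_ge0 _ _.
have fpi : pi A \is a fin_num by exact: fin_num_measure.
have bound x : kernel_iter P n x A <= pi A + (M x * r)%:E /\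
    pi A <= kernel_iter P n x A + (M x * r)%:E.
  have : `|kernel_iter P n x A - pi A| <= (M x * r)%:E.
    apply: le_trans (hM x n n0); apply: ereal_sup_ubound.
    by exists A.
  rewrite -(fineK fpi); case: (kernel_iter P n x A) => [a| |] //=.
  by rewrite -!EFinD !lee_fin ler_norml => /andP[]; lra.
have mMX : measurable_fun setT (fun w => (M (X 0%N w) * r)%:E).
  apply/measurable_EFinP; apply: measurable_funM => //.
  exact: measurableT_comp.
have MX0 w : 0 <= (M (X 0%N w) * r)%:E by rewrite lee_fin mulr_ge0.
have iMX : \int[Pr]_w (M (X 0%N w) * r)%:E = (fine (\int[Pr]_w (M (X 0%N w))%:E) * r)%:E.
  under eq_integral do rewrite EFinM.
  rewrite ge0_integralZr//; last by apply/measurable_EFinP; exact: measurableT_comp.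
  by rewrite EFinM fineK.
have mk := measurable_kernel_iter n mA.
have k0 x := kernel_iter_ge0 n x A.
have cstpi : \int[Pr]_w (cst (pi A) w) = pi A.
  by rewrite integral_cst// [X in _ * X](probability_setT Pr) mule1.
have -> : Pr (X n @^-1` A) = \int[Pr]_w kernel_iter P n (X 0%N w) A.
  exact: (marginal_iter n 0 mA).
split.
  rewrite -iMX -[X in _ <= X + _]cstpi -ge0_integralD//.
  apply: ge0_le_integral => //.
  - exact: (mXf 0 mk).
  - by apply: emeasurable_funD => //; exact: measurable_cst.
  - by move=> w _; case: (bound (X 0%N w)).
rewrite -iMX -[X in X <= _]cstpi -ge0_integralD//; last exact: (mXf 0 mk).
apply: ge0_le_integral => //.
- by apply: emeasurable_funD => //; exact: (mXf 0 mk).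
- by move=> w _; case: (bound (X 0%N w)).
Qed.

(* The renewal probabilities converge to beta summably fast, as m > 1. *)
Let vb : exists c : R, forall n, (\sum_(0 <= k < n) `|v k - beta| <= c)%R.
Proof.
have [C C0 HC] := marginal_cvg.
have [C' HC'] := powR_sum_le m1.
have C'0 : (0 <= C')%R by have := HC' 0%N; rewrite big_geq.
have step k : (`|v k.+2 - beta| <= C * k.+1%:R `^ (- m))%R.
  have c0 : (0 <= C * k.+1%:R `^ (- m))%R by rewrite mulr_ge0// powR_ge0.
  have vk : (v k.+2)%:E = \int[Pr]_w (s (X k.+1 w))%:E by rewrite vE/= delta_mass.
  have msX : measurable_fun setT (fun w => s (X k.+1 w)) by exact: measurableT_comp.
  have mr r : measurable [set x | (r < s x)%R].
    by rewrite -[X in measurable X]setTI; apply: (measurable_fun_ltr _ ms).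
  rewrite ler_norml; apply/andP; split.
    rewrite lerNl opprB lerBlDr addrC -lee_fin EFinD vk betaE.
    apply: le_Rintegral_ccdf => // r.
    by have [_] := HC k.+1 _ (ltn0Sn k) (mr r).
  rewrite lerBlDr addrC -lee_fin EFinD vk betaE.
  apply: le_Rintegral_ccdf => // r.
  by have [] := HC k.+1 _ (ltn0Sn k) (mr r).
exists (`|v 0 - beta| + (`|v 1 - beta| + C * C'))%R => -[|[|n]].
- by rewrite big_geq// !addr_ge0// mulr_ge0.
- by rewrite big_nat1 lerDl addr_ge0// mulr_ge0.
rewrite 2?big_nat_recl//= !lerD2l; apply: (le_trans (ler_sum _ (fun k _ => step k))).
by rewrite -mulr_sumr ler_wpM2l// (le_trans _ (HC' n.+1))// big_add1.
Qed.

Let h01 k : (0 <= h k <= 1)%R.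
Proof. by rewrite prob_ge0 prob_le1//; exact: measurable_quiet. Qed.

Lemma quiet_sum : (\sum_(0 <= k < n) prob Pr (quiet delta 0 k))%R @[n --> \oo] --> (beta^-1)%R.
Proof.
have [c hc] := vb.
exact: (renewal_sum renewal_rate_gt0 h01 renewal_equation hc).
Qed.

Lemma quiet_moment : exists c : R, forall n,
  (\sum_(0 <= k < n) k%:R * prob Pr (quiet delta 0 k) <= c)%R.
Proof.
have [c hc] := vb; eexists => n.
exact: (renewal_moment renewal_rate_gt0 h01 renewal_equation hc).
Qed.

Lemma quiet_cvg0 : prob Pr (quiet delta 0 k) @[k --> \oo] --> (0 : R)%R.
Proof.
apply: cvg_series_cvg_0; apply/cvg_ex; exists (beta^-1)%R; exact: quiet_sum.
Qed.

(** The mean occupation of a tour is [pi / beta]: the inequality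
    [excursion_le_pi] for [A] and for its complement, with equality of the total
    masses by [quiet_sum], leaves no room. *)
Lemma occupation_cvg A : measurable A ->
  (\sum_(0 <= i < n) prob Pr (quiet delta 0 i `&` X i @^-1` A))%R @[n --> \oo] -->
  (prob pi A / beta)%R.
Proof.
have b0 := renewal_rate_gt0.
have mqX i B : measurable B -> measurable (quiet delta 0 i `&` X i @^-1` B).
  by move=> mB; apply: measurableI; [exact: measurable_quiet|exact: mXA].
have le B n : measurable B ->
    (\sum_(0 <= i < n) prob Pr (quiet delta 0 i `&` X i @^-1` B) <= prob pi B / beta)%R.
  move=> mB; rewrite ler_pdivlMr// mulrC -lee_fin EFinM -sumEFin probE//.
  rewrite (eq_bigr _ (fun i _ => probE Pr (mqX i B mB))).
  exact: excursion_le_pi.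
move=> mA; have mCA := measurableC mA.
apply: (@squeeze_cvgr _ _ _ _ (fun n => \sum_(0 <= k < n) h k - (1 - prob pi A) / beta)%R
  (fun=> (prob pi A / beta)%R)).
- apply: nearW => n; rewrite le// andbT lerBlDr.
  have -> : (1 - prob pi A = prob pi (~` A))%R.
    by apply: EFin_inj; rewrite EFinB !probE// probability_setC.
  rewrite (le_trans _ (lerD (lexx _) (le _ n mCA)))// -big_split/= ler_sum// => i _.
  apply: le_trans (prob_setU Pr (mqX i A mA) (mqX i _ mCA)).
  by rewrite -setIUr -preimage_setU setUv (_ : X i @^-1` setT = setT)// setIT.
- have -> : (prob pi A / beta = beta^-1 - (1 - prob pi A) / beta)%R by ring.
  by apply: cvgB; [exact: quiet_sum|exact: cvg_cst].
- exact: cvg_cst.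
Qed.

End stationarity.

(** * Tours *)

Section discrete.
Context d (T : measurableType d) (I : countType).

(** Measurability of a random element of a countable set, stated through its atoms
    so that it applies to sequences of pairs of numbers as well as to numbers. *)
Definition discrete (u : T -> I) := forall i, measurable (u @^-1` [set i]).

Lemma discrete_cst i0 : discrete (fun=> i0).
Proof.
move=> i; have [->|i0i] := eqVneq i0 i.
  by rewrite (_ : _ @^-1` _ = setT)//; apply/seteqP; split.
by rewrite (_ : _ @^-1` _ = set0)//; apply/seteqP; split => // w /= /eqP; rewrite (negbTE i0i).
Qed.

Lemma measurable_index (u : T -> I) (A : I -> set T) :
  discrete u -> (forall i, measurable (A i)) -> measurable [set w | A (u w) w].
Proof.
move=> du mA.
rewrite (_ : [set w | _] = \bigcup_n
    (if choice.unpickle n is Some i then u @^-1` [set i] `&` A i else set0)); last first.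
  apply/seteqP; split => w /=.
    by move=> Aw; exists (choice.pickle (u w)) => //; rewrite choice.pickleK.
  by move=> [n _]; case: (choice.unpickle n) => [i [/= <-]|].
by apply: bigcupT_measurable => n; case: (choice.unpickle n) => // i; exact: measurableI.
Qed.

Lemma discrete_preimage (u : T -> I) (K : set I) : discrete u -> measurable (u @^-1` K).
Proof.
move=> du; have := @measurable_index u (fun i => [set _ | K i]) du; apply => i.
have [Ki|nKi] := pselect (K i).
  by rewrite (_ : [set _ | _] = setT)//; apply/seteqP; split.
by rewrite (_ : [set _ | _] = set0)//; apply/seteqP; split.
Qed.

Lemma discrete_measurable_comp d' (T' : measurableType d') (u : T -> I) (f : I -> T') :
  discrete u -> measurable_fun setT (fun w => f (u w)).
Proof.
move=> du _ B mB; rewrite setTI; exact: (discrete_preimage (f @^-1` B) du).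
Qed.

Lemma measurable_fun_index d' (T' : measurableType d') (u : T -> I) (F : I -> T -> T') :
  discrete u -> (forall i, measurable_fun setT (F i)) ->
  measurable_fun setT (fun w => F (u w) w).
Proof.
move=> du mF _ B mB; rewrite setTI.
apply: (@measurable_index u (fun i => F i @^-1` B)) => // i.
by rewrite -[X in measurable X]setTI; exact: mF.
Qed.

(** The law of a discrete random element, also relative to an event, is
    determined by the atoms. *)
Lemma discrete_law (R : realType) (Pr : probability T R) (u u' : T -> I) (E E' : set T) (c : \bar R) :
  discrete u -> discrete u' -> measurable E -> measurable E' -> c \is a fin_num ->
  (forall i, Pr (E `&` u @^-1` [set i]) = c * Pr (E' `&` u' @^-1` [set i]))%E ->
  forall K, (Pr (E `&` u @^-1` K) = c * Pr (E' `&` u' @^-1` K))%E.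
Proof.
move=> du du' mE mE' fc H K.
pose atom (v : T -> I) (F : set T) n : set T :=
  if choice.unpickle n is Some i then if choice.pickle i == n then
    if i \in K then F `&` v @^-1` [set i] else set0 else set0 else set0.
have matom v F n : discrete v -> measurable F -> measurable (atom v F n).
  move=> dv mF; rewrite /atom; case: (choice.unpickle n) => // i; do 2?case: ifP => // _.
  exact: measurableI.
have atomE v F : F `&` v @^-1` K = \bigcup_n atom v F n.
  apply/seteqP; split => w /=.
    move=> [Fw Kw]; exists (choice.pickle (v w)) => //.
    by rewrite /atom choice.pickleK eqxx (mem_set Kw).
  move=> [n _]; rewrite /atom; case: (choice.unpickle n) => // i.
  by do 2?case: ifP => // ; move=> /set_mem Ki _ [Fw /= ->].
have tatom v F : trivIset setT (atom v F).
  apply/trivIsetP => m n _ _ mn; apply/seteqP; split => // w [].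
  rewrite /atom; case em : (choice.unpickle m) => [i|//]; case en : (choice.unpickle n) => [k|//].
  do 4?case: ifP => //; move=> _ /eqP kn _ /eqP im [_ /= wi] [_ /= wk].
  by move: mn; rewrite -im -kn -wi -wk eqxx.
rewrite !atomE !measure_bigcup//; [|by move=> n _; exact: matom..].
rewrite -[c in RHS]fineK// -nneseriesZl//.
apply: eq_eseriesr => n _; rewrite fineK// /atom.
case: (choice.unpickle n) => [i|]; last by rewrite !measure0 mule0.
case: ifP => _; last by rewrite !measure0 mule0.
by case: ifP => _; [exact: H|rewrite !measure0 mule0].
Qed.

End discrete.

Lemma discrete_pair d (T : measurableType d) (I J : countType) (u : T -> I) (v : T -> J) :
  discrete u -> discrete v -> discrete (fun w => (u w, v w)).
Proof.
move=> du dv [i k]; rewrite (_ : _ @^-1` _ = u @^-1` [set i] `&` v @^-1` [set k]).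
  exact: measurableI.
by apply/seteqP; split => w /=; [case=> -> ->|case=> -> ->].
Qed.

Lemma discrete_natr d (T : measurableType d) (R : realType) (u : T -> nat) :
  measurable_fun setT (fun w => (u w)%:R : R) -> discrete u.
Proof.
move=> mu n; rewrite (_ : u @^-1` [set n] = (fun w => (u w)%:R : R) @^-1` [set n%:R]).
  by rewrite -[X in measurable X]setTI; exact: mu.
apply/seteqP; split => w /=; first by move=> ->.
by move/eqP; rewrite eqr_nat => /eqP.
Qed.

Section next_regeneration.
Variable dl : nat -> bool.

Lemma next_regenerationE k l : (forall i, (k <= i < k + l)%N -> ~~ dl i) ->
  dl (k + l)%N -> next_regeneration dl k = (k + l).+1.
Proof.
move=> H dkl; rewrite /next_regeneration; case: pselect => [ex|[]]; last first.
  by exists (k + l).+1; rewrite ltnS leq_addr.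
case: ex_minnP => n /andP[kn dn] min; apply/eqP; rewrite eqn_leq min ?ltnS ?leq_addr//=.
case: n kn dn {min} => // n; rewrite !ltnS => kn dn.
by rewrite leqNgt; apply/negP => nl; have := H n; rewrite kn nl => /(_ isT); rewrite dn.
Qed.

Lemma next_regeneration_ex k : (exists2 i, (k <= i)%N & dl i) ->
  exists l, [/\ forall i, (k <= i < k + l)%N -> ~~ dl i, dl (k + l)%N &
    next_regeneration dl k = (k + l).+1].
Proof.
move=> [i ki di].
have ex : exists n, (fun n => dl (k + n)%N) n by exists (i - k)%N; rewrite subnKC.
case: (ex_minnP ex) => l dkl min.
have H n : (k <= n < k + l)%N -> ~~ dl n.
  move=> /andP[kn nl]; apply/negP => dn.
  have := min (n - k)%N; rewrite subnKC// => /(_ dn).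
  by rewrite leqNgt ltn_subLR// nl.
by exists l; split => //; exact: next_regenerationE.
Qed.

Lemma next_regeneration_dflt k : (forall i, (k <= i)%N -> ~~ dl i) ->
  next_regeneration dl k = k.
Proof.
move=> H; rewrite /next_regeneration; case: pselect => // ex; exfalso; case: ex => -[|i] //=.
by rewrite ltnS => /andP[ki di]; have := H i ki; rewrite di.
Qed.

Lemma next_regeneration_ge k : (k <= next_regeneration dl k)%N.
Proof.
rewrite /next_regeneration; case: pselect => // ex.
by case: ex_minnP => n /andP[/ltnW].
Qed.

Lemma regeneration_timeS r : regeneration_time dl r.+1 =
  next_regeneration dl (regeneration_time dl r).
Proof. by []. Qed.

Lemma regeneration_time_le r : (regeneration_time dl r <= regeneration_time dl r.+1)%N.
Proof. exact: next_regeneration_ge. Qed.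

Lemma sum_tour_length r :
  (\sum_(0 <= k < r) tour_length dl k.+1)%N = regeneration_time dl r.
Proof.
elim: r => [|r IHr]; first by rewrite big_geq.
by rewrite big_nat_recr//= IHr /tour_length subnKC// regeneration_time_le.
Qed.

End next_regeneration.

Section chain_tours.
Context d (S : measurableType d) (R : realType).
Variables (P : R.-pker S ~> S) (pi Q : probability S R) (s : S -> R).
Hypothesis hmin : minorization P pi s Q.
Hypothesis hinv : Pilot.Defs.invariant P pi.
Context d' (Omega : measurableType d') (Pr : probability Omega R).
Variables (X : nat -> {RV Pr >-> S}) (delta : nat -> {RV Pr >-> bool}).
Hypothesis hX : split_chain X delta P s Q Q.
Variable m : R.
Hypothesis m1 : 1 < m.
Hypothesis hpoly : polynomially_ergodic P pi m.

Let dl w : nat -> bool := delta ^~ w.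

Let md i : measurable [set w | delta i w]. Proof. exact: (measurable_delta X). Qed.

Let mq n l : measurable (quiet delta n l). Proof. exact: (measurable_quiet X). Qed.

(** Off this almost sure event the dummy value of [next_regeneration] may occur. *)
Definition recurring : set Omega := [set w | forall k, exists2 i, (k <= i)%N & delta i w].

Let silent k : set Omega := \bigcap_l quiet delta k l.

Let silentE k w : silent k w <-> (forall i, (k <= i)%N -> ~~ delta i w).
Proof.
split=> [H i ki|H l _ i /andP[ki _]]; last exact: H.
by apply: (H (i - k).+1 I); rewrite ki addnS subnKC ?leqnn.
Qed.

Let msilent k : measurable (silent k). Proof. exact: bigcapT_measurable. Qed.

(* After a renewal the probability of silence during l steps is the one from
   time 0, which tends to 0. *)
Let silent_regenerates n E : regenerates Q X delta n E -> Pr (E `&` silent n) = 0%E.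
Proof.
move=> hE; have mE := history_measurable hE.1.
apply/eqP; rewrite eq_le measure_ge0 andbT.
have le l : (Pr (E `&` silent n) <= (prob Pr (quiet delta 0 l))%:E)%E.
  apply: (@le_trans _ _ (Pr (E `&` quiet delta n l))).
    apply: le_measure; rewrite ?inE; [exact/mem_set/measurableI|exact/mem_set/measurableI|].
    by apply: setIS => w; exact.
  rewrite (quiet_lawT hmin hX _ hE) probE// -[leRHS]mul1e.
  by apply: lee_wpmul2r => //; exact: probability_le1.
have cv : (prob Pr (quiet delta 0 l))%:E @[l --> \oo] --> 0%E.
  by apply: cvg_EFin; [exact: nearW|exact: (quiet_cvg0 hmin hinv hX m1 hpoly)].
by rewrite -(cvg_lim _ cv)//; apply: lime_ge; [exact/cvgP/cv|exact: nearW].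
Qed.

Let silent0 k : Pr (silent k) = 0%E.
Proof.
elim: k => [|k IHk]; first by rewrite -[silent 0]setTI (silent_regenerates (regenerates_setT hX)).
apply/eqP; rewrite eq_le measure_ge0 andbT.
rewrite (@le_trans _ _ (Pr (silent k `|` ([set w | delta k w] `&` silent k.+1))))//.
  apply: le_measure; rewrite ?inE; [exact: mem_set| |].
    by apply: mem_set; apply: measurableU => //; exact: measurableI.
  move=> w sw; case: (boolP (delta k w)) => dk; [by right|left].
  apply/silentE => i; rewrite leq_eqVlt => /predU1P[<-//|ki].
  by move/silentE: sw; exact.
rewrite (le_trans (measureU2 _ _ _))//; first exact: measurableI.
rewrite [X in (X + _)%E]IHk [X in (_ + X)%E](silent_regenerates (delta_regenerates hX k)).
by rewrite adde0.
Qed.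

Let recurringE : recurring = ~` \bigcup_k silent k.
Proof.
apply/seteqP; split => w /=.
  by move=> H [k _ /silentE sk]; have [i ki] := H k; apply/negP/sk.
move=> H k; apply: contrapT => nk; apply: H; exists k => //; apply/silentE => i ki.
by apply/negP => di; apply: nk; exists i.
Qed.

Lemma measurable_recurring : measurable recurring.
Proof. by rewrite recurringE; apply: measurableC; exact: bigcupT_measurable. Qed.

Lemma recurring_ae : Pr (~` recurring) = 0%E.
Proof.
rewrite recurringE setCK; apply/eqP; rewrite eq_le measure_ge0 andbT.
have := measure_sigma_subadditive Pr msilent (bigcupT_measurable _ msilent) (@subset_refl _ _).
by rewrite eseries0// => i _ _; exact: silent0.
Qed.

Lemma recurring_pr A B : measurable A -> measurable B ->
  A `&` recurring = B `&` recurring -> Pr A = Pr B.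
Proof.
move=> mA mB AB; apply: ae_eq_measure => //; exists (~` recurring); split.
- by apply: measurableC; exact: measurable_recurring.
- exact: recurring_ae.
- move=> w /= nAB rw; apply: nAB; split=> h.
    have [] : (B `&` recurring) w by rewrite -AB.
    by [].
  have [] : (A `&` recurring) w by rewrite AB.
  by [].
Qed.

Let discrete_next k : discrete (fun w => next_regeneration (dl w) k).
Proof.
have E l : measurable (quiet delta k l `&` [set w | delta (k + l)%N w]) by exact: measurableI.
move=> n; case: (ltngtP n k) => [nk|kn|->].
- rewrite (_ : _ @^-1` _ = set0)//; apply/seteqP; split => // w /= e.
  by move: nk; rewrite -e ltnNge next_regeneration_ge.
- rewrite (_ : _ @^-1` _ = quiet delta k (n - k.+1) `&` [set w | delta (k + (n - k.+1))%N w])//.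
  have kk : (k + (n - k.+1)).+1 = n by rewrite -addSn subnKC.
  apply/seteqP; split => w /=; last by move=> [qw dw]; rewrite (@next_regenerationE (dl w) k _ qw dw).
  have [[i ki di]|nex] := pselect (exists2 i, (k <= i)%N & dl w i).
    have [l [H dkl ->]] := next_regeneration_ex (ex_intro2 _ _ i ki di).
    by move=> e; have -> : (n - k.+1)%N = l by rewrite -e -addSn addKn.
  rewrite next_regeneration_dflt; first by move=> e; move: kn; rewrite e ltnn.
  by move=> i ki; apply/negP => di; apply: nex; exists i.
rewrite (_ : _ @^-1` _ = silent k)//; apply/seteqP; split => w /=; last first.
  by move/silentE => H; exact: next_regeneration_dflt.
move=> e; apply/silentE => i ki; apply/negP => di.
have [l [_ _]] := next_regeneration_ex (ex_intro2 _ _ i ki (di : dl w i)).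
by rewrite e => /eqP; rewrite -addnS -[X in X == _]addn0 eqn_add2l.
Qed.

Lemma discrete_regeneration_time r : discrete (fun w => regeneration_time (dl w) r).
Proof.
elim: r => [|r IHr] n.
  exact: discrete_cst.
apply: (@measurable_index _ _ _ (fun w => regeneration_time (dl w) r)
  (fun k => [set w | next_regeneration (dl w) k = n])) => // k.
exact: discrete_next.
Qed.

Lemma discrete_tour_length k : discrete (fun w => tour_length (dl w) k).
Proof.
have := discrete_pair (discrete_regeneration_time k) (discrete_regeneration_time k.-1).
move=> H n; exact: (discrete_preimage (fun p => p.1 - p.2 = n)%N H).
Qed.

Section visits.
Variable b : S -> bool.
Hypothesis mb : measurable [set x | b x].

Definition tour_visits (k : nat) (w : Omega) : nat :=
  \sum_(regeneration_time (dl w) k <= i < regeneration_time (dl w) k.+1) b (X i w).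

Let measurable_b i : measurable_fun setT (fun w => (b (X i w))%:R : R).
Proof.
rewrite (_ : (fun w => _) = (\1_[set x | b x] : S -> R) \o X i).
  by apply: measurableT_comp => //; exact: measurable_indic.
apply/funext => w /=; rewrite indicE.
by case: (boolP (b _)) => bX; [rewrite mem_set|rewrite memNset//; exact/negP].
Qed.

Lemma discrete_tour_visits k : discrete (tour_visits k).
Proof.
apply: (@discrete_natr _ _ R).
have H n n' : measurable_fun setT (fun w => (\sum_(n <= i < n') b (X i w))%:R : R).
  under eq_fun do rewrite natr_sum.
  by apply: measurable_sum => i; exact: measurable_b.
apply: (measurable_fun_index (u := fun w => regeneration_time (dl w) k)
  (F := fun n w => (\sum_(n <= i < regeneration_time (dl w) k.+1) b (X i w))%:R : R)).
  exact: discrete_regeneration_time.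
move=> n; apply: (measurable_fun_index (u := fun w => regeneration_time (dl w) k.+1)
  (F := fun n' w => (\sum_(n <= i < n') b (X i w))%:R : R)) => //.
exact: discrete_regeneration_time.
Qed.

(** All statistics of the tour number [k] that enter the limit theorems. *)
Definition tour_code k w : nat * nat := (tour_length (dl w) k.+1, tour_visits k w).

(* The codes of the tours before tour k, the latest first. *)
Fixpoint codes k w : seq (nat * nat) :=
  if k is k'.+1 then tour_code k' w :: codes k' w else [::].

Definition total (c : seq (nat * nat)) : nat := \sum_(x <- c) x.1.

(** The event that the first tours are those described by [c], again the latest
    first, in terms of the coins alone; it agrees with [codes] being [c] on the
    event [recurring]. A tour of length 0 is impossible there. *)
Fixpoint cylinder (c : seq (nat * nat)) : set Omega :=
  if c is x :: c' then
    if x.1 is l.+1 then cylinder c' `&` tour X delta b (total c') l (pred1 x.2) else set0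
  else setT.

Lemma discrete_tour_code k : discrete (tour_code k).
Proof.
by apply: discrete_pair; [exact: discrete_tour_length|exact: discrete_tour_visits].
Qed.

Lemma discrete_codes k : discrete (codes k).
Proof.
elim: k => [|k IHk]; first exact: discrete_cst.
move=> c; have := discrete_pair (discrete_tour_code k) IHk.
by move=> H; exact: (discrete_preimage (fun p => p.1 :: p.2 = c) H).
Qed.

Lemma cylinder_regenerates c : regenerates Q X delta (total c) (cylinder c).
Proof.
elim: c => [|[l n] c IHc]; first by rewrite /total big_nil; exact: (regenerates_setT hX).
rewrite /total big_cons/= -/(total c); case: l => [|l].
  split; first exact: history_set0.
  by move=> A mA; rewrite set0I measure0 mul0e.
by rewrite addSn addnC -/(total c); exact: (tour_regenerates hX).
Qed.

Let measurable_cylinder c : measurable (cylinder c).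
Proof. exact: (history_measurable (cylinder_regenerates c).1). Qed.

Let size_codes k w : size (codes k w) = k.
Proof. by elim: k => //= k ->. Qed.

Let total_codes k w : total (codes k w) = regeneration_time (dl w) k.
Proof.
rewrite -sum_tour_length; elim: k => [|k IHk] /=; first by rewrite /total big_nil big_geq.
by rewrite /total big_cons -/(total _) IHk big_nat_recr//= addnC.
Qed.

Let cylinder_codes c w : cylinder c w -> codes (size c) w = c.
Proof.
elim: c => [|[[|l] n] c IHc] //= [/IHc cw].
move=> [[qw /eqP vw] dw].
have tc : total c = regeneration_time (dl w) (size c) by rewrite -cw total_codes size_codes.
have ts : regeneration_time (dl w) (size c).+1 = (total c + l).+1.
  by rewrite regeneration_timeS -tc; exact: next_regenerationE.
rewrite cw /tour_code /tour_length ts /= -tc -addnS addKn; congr ((_, _) :: _).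
by rewrite /tour_visits ts -tc -addnS.
Qed.

Let codes_cylinder k w : recurring w -> cylinder (codes k w) w.
Proof.
move=> rw; elim: k => [//|k IHk] /=.
have [l [qw dw]] := next_regeneration_ex (rw (regeneration_time (dl w) k)).
rewrite -regeneration_timeS => ts.
have -> : tour_length (dl w) k.+1 = l.+1 by rewrite /tour_length ts -addnS addKn.
split => //; rewrite total_codes; split => //; split => //=.
by rewrite /tour_visits ts -addnS.
Qed.

Let codes_event k c : Pr (codes k @^-1` [set c]) =
  if size c == k then Pr (cylinder c) else 0%E.
Proof.
case: eqP => [ck|nck]; last first.
  rewrite (_ : _ @^-1` _ = set0) ?measure0//; apply/seteqP; split => // w /= e.
  by apply: nck; rewrite -e size_codes.
apply: recurring_pr => //; first exact: discrete_codes.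
apply/seteqP; split => w /= [H rw]; split => //.
  by rewrite -H; exact: codes_cylinder.
by rewrite -ck; exact: cylinder_codes.
Qed.

Let tour0 (x : nat * nat) : set Omega :=
  if x.1 is l.+1 then tour X delta b 0 l (pred1 x.2) else set0.

Let tour_code0 x : Pr (tour_code 0 @^-1` [set x]) = Pr (tour0 x).
Proof.
have <- : codes 1 @^-1` [set [:: x]] = tour_code 0 @^-1` [set x].
  by apply/seteqP; split => w /=; [case|move=> ->].
rewrite codes_event/=; case: x => [[|l] n] //=.
by rewrite /total big_nil setTI.
Qed.

(** The tours are independent and identically distributed. Their codes are
    discrete, so it suffices to compare atoms, and these are cylinders, for which
    [tour_law] applies. *)
Lemma tours_independent k (K : set (seq (nat * nat))) (L : set (nat * nat)) :
  Pr (codes k @^-1` K `&` tour_code k @^-1` L) =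
  (Pr (codes k @^-1` K) * Pr (tour_code 0%N @^-1` L))%E.
Proof.
have dc := discrete_codes k; have dt := discrete_tour_code.
have mK (K' : set (seq (nat * nat))) : measurable (codes k @^-1` K') := discrete_preimage K' dc.
have mL i (L' : set (nat * nat)) : measurable (tour_code i @^-1` L') :=
  discrete_preimage L' (dt i).
rewrite setIC muleC -[X in (_ * Pr X)%E](setTI (codes k @^-1` K)).
apply: discrete_law => //; first by rewrite fin_num_measure.
move=> c; rewrite setTI setIC muleC -[X in (_ * Pr X)%E](setTI (tour_code 0 @^-1` L)).
apply: discrete_law => //; first by rewrite fin_num_measure.
move=> x; rewrite setTI tour_code0.
have -> : codes k @^-1` [set c] `&` tour_code k @^-1` [set x] = codes k.+1 @^-1` [set x :: c].
  by apply/seteqP; split => w /=; [move=> [-> ->]|case=> -> ->].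
rewrite !codes_event/= eqSS; case: eqP => // _; last by rewrite mul0e.
rewrite /tour0; case: x => [[|l] n] /=; first by rewrite measure0 mule0.
exact: (tour_law hmin hX mb _ _ (cylinder_regenerates c)).
Qed.

Lemma tour_visits_le k w : (tour_visits k w <= tour_length (dl w) k.+1)%N.
Proof.
rewrite /tour_visits /tour_length -[leqRHS]mul1n mulnC -sum_nat_const_nat.
by apply: leq_sum => i _; case: (b _).
Qed.

Lemma sum_tour_visits r w : (\sum_(0 <= k < r) tour_visits k w)%N =
  (\sum_(0 <= i < regeneration_time (dl w) r) b (X i w))%N.
Proof.
elim: r => [|r IHr]; first by rewrite !big_geq.
by rewrite big_nat_recr//= IHr -big_cat_nat// regeneration_time_le.
Qed.

End visits.

Let beta := renewal_rate pi s.

Let N1 w := tour_length (dl w) 1.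

Let quiet_first w l : recurring w -> (l < N1 w)%N <-> quiet delta 0 l w.
Proof.
move=> rw; have [n [qn dn ts]] := next_regeneration_ex (rw 0%N).
rewrite /N1 /tour_length /= subn0 /regeneration_time /= ts add0n ltnS.
split=> [ln i /andP[_ il]|ql].
  by apply: qn; rewrite (leq_trans il).
by rewrite leqNgt; apply/negP => nl; move/negP: (ql n nl); apply.
Qed.

(** Almost surely the time [l] belongs to the first tour exactly on the event
    [quiet delta 0 l], so the sum over the tour is a series of integrals. *)
Lemma first_tour_expectation (f : nat -> S -> \bar R) :
  (forall l, measurable_fun setT (f l)) -> (forall l x, 0 <= f l x)%E ->
  (\int[Pr]_w (\sum_(0 <= l < N1 w) f l (X l w)) =
   \sum_(0 <= l <oo) \int[Pr]_(w in quiet delta 0 l) f l (X l w))%E.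
Proof.
move=> mf f0.
have mfX l : measurable_fun setT (fun w => f l (X l w)) by exact: measurableT_comp.
have mF : measurable_fun setT (fun w => \sum_(0 <= l < N1 w) f l (X l w))%E.
  apply: (measurable_fun_index (u := N1) (F := fun n w => \sum_(0 <= l < n) f l (X l w))%E).
    exact: discrete_tour_length.
  by move=> n; exact: emeasurable_sum.
have mfq l : measurable_fun setT (fun w => f l (X l w) * (\1_(quiet delta 0 l) w)%:E)%E.
  by apply: emeasurable_funM => //; apply/measurable_EFinP; exact: measurable_indic.
have mr := measurable_recurring.
transitivity (\int[Pr]_(w in recurring) (\sum_(0 <= l < N1 w) f l (X l w)))%E.
  rewrite (@ge0_negligible_integral _ _ _ Pr setT (~` recurring))//; last 2 first.
  - by move=> w _; exact: sume_ge0.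
  - exact: recurring_ae.
  - by rewrite setTD setCK.
  - exact: measurableC.
transitivity (\int[Pr]_(w in recurring)
    \sum_(0 <= l <oo) (f l (X l w) * (\1_(quiet delta 0 l) w)%:E))%E.
  apply: eq_integral => w /set_mem rw.
  rewrite (nneseries_split 0 (N1 w)); last by move=> l _; rewrite mule_ge0.
  rewrite add0n eseries0 ?adde0; last first.
    move=> l Nl _; rewrite indicE memNset ?mule0// => /(quiet_first _ rw).
    by rewrite ltnNge Nl.
  apply: eq_big_nat => l /andP[_ lN].
  by rewrite indicE mem_set ?mule1//; apply/(quiet_first _ rw).
rewrite integral_nneseries//; last 2 first.
- by move=> l; exact: measurable_funTS.
- by move=> l w _; rewrite mule_ge0.
apply: eq_eseriesr => l _.
rewrite [RHS]integral_mkcond.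
transitivity (\int[Pr]_w (f l (X l w) * (\1_(quiet delta 0 l) w)%:E))%E; last first.
  apply: eq_integral => w _; rewrite patchE indicE.
  by case: ifP => _; rewrite ?mule1 ?mule0.
rewrite [RHS](@ge0_negligible_integral _ _ _ Pr setT (~` recurring))//.
- by rewrite setTD setCK.
- exact: measurableC.
- by move=> w _; rewrite mule_ge0.
- exact: recurring_ae.
Qed.

Let series_cvg (u : nat -> R) (l : R) : (\sum_(0 <= k < n) u k)%R @[n --> \oo] --> l ->
  (\sum_(0 <= k <oo) (u k)%:E = l%:E)%E.
Proof.
move=> ul; apply/cvg_lim => //.
have -> : (fun n => \sum_(0 <= k < n) (u k)%:E)%E = (fun n => (\sum_(0 <= k < n) u k)%:E).
  by apply/funext => n; rewrite sumEFin.
by apply: cvg_EFin ul; exact: nearW.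
Qed.

(** Kac's formula: the mean length is the sum over [l] of the probabilities that
    the tour is longer than [l], hence the inverse rate by [quiet_sum]. *)
Lemma tour_length_mean : (\int[Pr]_w (N1 w)%:R%:E = (beta^-1)%:E)%E.
Proof.
rewrite -(series_cvg (quiet_sum hmin hinv hX m1 hpoly)).
transitivity (\int[Pr]_w (\sum_(0 <= l < N1 w) cst 1%E (X l w)))%E.
  by apply: eq_integral => w _; rewrite /= sumEFin big_const_nat iter_addr addr0 subn0.
rewrite (first_tour_expectation (f := fun _ => cst 1%E))//.
by apply: eq_eseriesr => l _; rewrite integral_cst// mul1e probE.
Qed.

Lemma tour_visits_mean (b : S -> bool) : measurable [set x | b x] ->
  (\int[Pr]_w (tour_visits b 0 w)%:R%:E = (prob pi [set x | b x] / beta)%:E)%E.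
Proof.
move=> mb; rewrite -(series_cvg (occupation_cvg hmin hinv hX m1 hpoly mb)).
transitivity (\int[Pr]_w (\sum_(0 <= l < N1 w) (\1_[set x | b x] (X l w))%:E))%E.
  apply: eq_integral => w _; rewrite sumEFin /tour_visits /N1 /tour_length subn0 natr_sum.
  congr (_%:E); apply: eq_bigr => i _; rewrite indicE.
  by case: (boolP (b _)) => bX; [rewrite mem_set|rewrite memNset//; exact/negP].
rewrite (first_tour_expectation (f := fun _ x => (\1_[set x | b x] x)%:E)); last 2 first.
- by move=> l; apply/measurable_EFinP; exact: measurable_indic.
- by move=> l x; rewrite lee_fin.
apply: eq_eseriesr => l _.
rewrite integral_preimage_indic// probE//; apply: measurableI => //.
by rewrite -[X in measurable X]setTI; exact: measurable_funP.
Qed.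

(** The square of the length is the sum of [2 l + 1] over the times [l] of the
    tour, so [quiet_moment] bounds its mean. *)
Lemma tour_length_sqr_integrable : Pr.-integrable setT (EFin \o (fun w => (N1 w)%:R ^+ 2)).
Proof.
have mN : measurable_fun setT (fun w => (N1 w)%:R ^+ 2 : R).
  apply: (discrete_measurable_comp (fun n : nat => n%:R ^+ 2 : R)).
  exact: discrete_tour_length.
apply/integrableP; split; first exact/measurable_EFinP.
have [c hc] := quiet_moment hmin hinv hX m1 hpoly.
under eq_integral => w _ do rewrite /= normrX normr_nat.
have -> : (\int[Pr]_w ((N1 w)%:R ^+ 2)%:E =
    \int[Pr]_w (\sum_(0 <= l < N1 w) cst (2 * l%:R + 1)%R%:E (X l w)))%E.
  apply: eq_integral => w _; rewrite /= sumEFin; congr (_%:E).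
  elim: (N1 w) => [|n IHn]; first by rewrite big_geq// expr0n.
  by rewrite big_nat_recr//= -IHn -natr1; ring.
rewrite (first_tour_expectation (f := fun l => cst (2 * l%:R + 1)%R%:E))//; last first.
  by move=> l x; rewrite lee_fin; rewrite addr_ge0// mulr_ge0.
have e l : (\int[Pr]_(w in quiet delta 0 l) cst (2 * l%:R + 1)%R%:E (X l w) =
    ((2 * l%:R + 1) * prob Pr (quiet delta 0 l))%:E)%E.
  by rewrite EFinM probE// -integral_cst.
rewrite (eq_eseriesr (fun l _ => e l)).
have h0 l : (0 <= prob Pr (quiet delta 0 l)) := prob_ge0 _ _.
apply: (@le_lt_trans _ _ (2 * c + beta^-1)%:E); last exact: ltry.
apply: lime_le.
  by apply: is_cvg_nneseries => l _ _; rewrite lee_fin mulr_ge0// addr_ge0// mulr_ge0.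
apply: nearW => n; rewrite sumEFin lee_fin.
under eq_bigr do rewrite mulrDl mul1r -mulrA.
rewrite big_split/= -mulr_sumr lerD//; first by rewrite ler_wpM2l.
have cv := quiet_sum hmin hinv hX m1 hpoly.
rewrite -(cvg_lim _ cv)//; apply: nondecreasing_cvgn_le; last exact/cvgP/cv.
by apply/nondecreasing_seqP => k; rewrite [leRHS]big_nat_recr//= lerDl.
Qed.

(** The central limit theorem for sums over tours of a function [psi n] of the
    length of the tour and of its number of visits to a set [b n], where both
    may depend on the number [n] of tours. *)
Lemma tours_clt (b : nat -> S -> bool) (psi : nat -> nat * nat -> R) (c sigma : R) :
  (forall n, measurable [set x | b n x]) ->
  (forall n p, (p.2 <= p.1)%N -> `|psi n p| <= c * (1 + p.1%:R)) ->
  (forall n, \int[Pr]_w psi n (tour_code (b n) 0 w) = 0) ->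
  \int[Pr]_w (psi n (tour_code (b n) 0 w)) ^+ 2 @[n --> \oo] --> sigma ^+ 2 ->
  0 <= sigma -> forall l a, 0 < l ->
  \int[Pr]_w logistic l a ((\sum_(0 <= k < n) psi n (tour_code (b n) k w)) / Num.sqrt n%:R)
    @[n --> \oo] --> gauss_avg sigma (logistic l a) 0.
Proof.
move=> mb psi_le psi0 psi2 s0 l a l0.
pose D n k w := psi n (tour_code (b n) k w).
pose W n k w := \sum_(0 <= i < k) D n i w.
have mD n k : measurable_fun setT (D n k).
  by apply: (discrete_measurable_comp (psi n)); exact: discrete_tour_code.
have WE n k w : W n k w = \sum_(p <- codes (b n) k w) psi n p.
  rewrite /W; elim: k => [|k IHk]; first by rewrite big_geq//= big_nil.
  by rewrite big_nat_recr//= IHk big_cons addrC.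
have mN : measurable_fun setT (fun w => (N1 w)%:R : R).
  by apply: (discrete_measurable_comp (fun n : nat => n%:R : R)); exact: discrete_tour_length.
apply: (@triangular_clt _ _ _ Pr W D (fun w => c * (1 + (N1 w)%:R)) sigma) => //.
- by move=> n k; exact: measurable_sum.
- by move=> n w; rewrite /W big_geq.
- by move=> n k w; rewrite /W big_nat_recr.
- move=> n k A B mA mB.
  have := tours_independent (mb n) k (fun s => (\sum_(p <- s) psi n p) \in A)
    (psi n @^-1` B).
  have -> : codes (b n) k @^-1` (fun s => (\sum_(p <- s) psi n p) \in A) = W n k @^-1` A.
    by apply/seteqP; split => w /=; rewrite WE; [exact: set_mem|exact: mem_set].
  exact.
- by apply: measurable_funM => //; exact: measurable_funD.
- apply: (@le_integrable_bound _ _ _ Pr _ (fun w => c ^+ 2 * (2 + 2 * (N1 w)%:R ^+ 2))).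
  + by apply: measurable_funX; apply: measurable_funM => //; exact: measurable_funD.
  + move=> w; rewrite normrX real_normK ?num_real// exprMn.
    apply: ler_wpM2l; first exact: sqr_ge0.
    rewrite -subr_ge0 (_ : _ - _ = (1 - (N1 w)%:R) ^+ 2) ?sqr_ge0//; ring.
  + apply: integrable_mulrl; apply: integrable_addr.
      exact: finite_measure_integrable_cst.
    by apply: integrable_mulrl; exact: tour_length_sqr_integrable.
- by move=> n w; apply: psi_le; exact: tour_visits_le.
Qed.

End chain_tours.

(** * Order statistics and quantiles *)

(** In the sorted list the entry at position [j.-1] is at most [v] exactly when
    more than [j.-1] entries are. The second branch is the default value of
    [nth]; keeping it makes the equation hold for every [j], which the exact
    measurability of the order statistic needs. *)
Lemma order_statistic_le (R : realType) (Y : nat -> R) (n j : nat) (v : R) :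
  (order_statistic Y n j <= v) =
  if (j.-1 < n)%N then (j.-1 < \sum_(0 <= i < n) (Y i <= v)%R)%N else (0 <= v).
Proof.
have sz : size (sort <=%R [seq Y i | i <- iota 0 n]) = n.
  by rewrite size_sort size_map size_iota.
have cE : (\sum_(0 <= i < n) (Y i <= v)%R)%N =
    count (<= v) (sort <=%R [seq Y i | i <- iota 0 n]).
  rewrite (permP (permEl (perm_sort _ _))) count_map -sum1_count [RHS]big_mkcond.
  by rewrite /index_iota subn0; apply: eq_bigr => i _ /=; case: (_ <= _).
rewrite /order_statistic cE; case: ltnP => jn; last by rewrite nth_default// sz.
have ss : sorted <=%R (sort <=%R [seq Y i | i <- iota 0 n]) by exact: sort_le_sorted.
apply/idP/idP => [H|]; last exact: nth_count_le.
rewrite ltnNge; apply/negP => cj.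
have := @nth_count_gt _ _ v 0 _ j.-1 ss; rewrite cj sz jn => /(_ isT).
by rewrite ltNge H.
Qed.

Section distribution_function.
Context d (S : measurableType d) (R : realType) (pi : probability S R).
Variable g : {RV pi >-> R}.

Local Notation F := (cdfR g).

Lemma measurable_sublevel v : measurable [set x | g x <= v].
Proof.
rewrite -[X in measurable X]setTI.
have mg : measurable_fun setT g by exact: measurable_funP.
by have := mg measurableT `]-oo, v]%classic (measurable_itv _); rewrite set_itvNyc.
Qed.

Lemma cdfRE v : cdfR g v = prob pi [set x | g x <= v].
Proof. by rewrite /cdfR /cdf /distribution /pushforward set_itvNyc. Qed.

Lemma cdfR_itv v : 0 <= F v <= 1.
Proof. by rewrite cdfRE prob_ge0 prob_le1//; exact: measurable_sublevel. Qed.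

Lemma cdfR_homo u v : u <= v -> F u <= F v.
Proof.
move=> uv; rewrite !cdfRE; apply: prob_le; [exact: measurable_sublevel..|].
by move=> x /= gu; exact: le_trans uv.
Qed.

Variable f : R -> R.
Hypothesis hf : has_continuous_density F f.

Lemma is_derive_cdfR (x : R) : is_derive x 1 F (f x).
Proof.
have [cf f0 hF] := hf.
have FE : F = fun v => \int[lebesgue_measure]_(t in `]-oo, v]) f t.
  by apply/funext => v; rewrite /Rintegral -hF.
have xx1 : x < x + 1 by rewrite ltrDl.
have mf : measurable_fun setT f by exact: continuous_measurable_fun.
have fi : (@lebesgue_measure R).-integrable `]-oo, x + 1] (EFin \o f).
  apply/integrableP; split; first by apply/measurable_EFinP; exact: measurable_funTS.
  under eq_integral do rewrite /= ger0_norm//.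
  by rewrite -hF ltry.
have [|dF eF] := @continuous_FTC1 R f -oo%O x (x + 1) xx1 fi _ (cf x).
  by rewrite /Order.lt/=.
rewrite -FE in dF eF; apply: DeriveDef => //.
by rewrite -derive1E.
Qed.

Lemma continuous_cdfR : continuous F.
Proof.
move=> x; apply: differentiable_continuous; apply/derivable1_diffP.
by case: (is_derive_cdfR x).
Qed.

(** Continuity excludes a jump at the quantile. *)
Lemma cdfR_quantile (q : R) : 0 < q < 1 -> F (quantile F q) = q.
Proof.
move=> /andP[q0 q1]; set A := [set v | q <= F v].
have cdfE : cdf g = fun v => (F v)%:E.
  apply/funext => v; rewrite cdfRE probE; last exact: measurable_sublevel.
  by rewrite /cdf /distribution /pushforward set_itvNyc.
have [a Fa] : exists a, F a < q.
  have := cvg_cdfNy0 g; rewrite cdfE => /fine_cvgP[_ /cvgrPdist_lt/(_ _ q0)] [a [_ ha]]; exists (a - 1).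
  have := ha (a - 1); rewrite ltrBlDr ltrDl ltr01 => /(_ isT) /=.
  by rewrite sub0r normrN ger0_norm//; case/andP: (cdfR_itv (a - 1)).
have [c Fc] : exists c, q < F c.
  have := cvg_cdfy1 g; rewrite cdfE.
  have q1' : 0 < 1 - q by rewrite subr_gt0.
  move=> /fine_cvgP[_ /cvgrPdist_lt/(_ _ q1')] [c [_ hc]]; exists (c + 1).
  have := hc (c + 1); rewrite ltrDl ltr01 => /(_ isT) /=.
  by move=> /ltr_normlW; lra.
have A0 : A !=set0 by exists c; rewrite /A/= ltW.
have Alb : has_inf A.
  split => //; exists a => v /= qv; rewrite leNgt; apply/negP => va.
  by have := lt_le_trans (le_lt_trans (cdfR_homo (ltW va)) Fa) qv; rewrite ltxx.
have Fx := continuous_cdfR.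
apply/eqP; rewrite eq_le; apply/andP; split; rewrite leNgt; apply/negP => h.
  have /cvgrPdist_lt := Fx (quantile F q).
  have h0 : 0 < F (quantile F q) - q by rewrite subr_gt0.
  move=> /(_ _ h0) /nbhs_ballP[e /= e0 he].
  have := he (quantile F q - e / 2); rewrite /ball/= opprB addrC subrK.
  rewrite gtr0_norm ?divr_gt0// ltr_pdivrMr// ltr_pMr// ltr1n => /(_ isT) /ltr_normlW.
  rewrite ltrD2l ltrN2 => qF.
  have := @ge_inf _ A Alb.2 (quantile F q - e / 2) (ltW qF).
  by rewrite -/(quantile F q) lerBrDr gerDl leNgt divr_gt0.
have /cvgrPdist_lt := Fx (quantile F q).
have h0 : 0 < q - F (quantile F q) by rewrite subr_gt0.
move=> /(_ _ h0) /nbhs_ballP[e /= e0 he].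
have [v Av ve] := inf_adherent e0 Alb.
have xv : quantile F q <= v by exact: ge_inf Alb.2 _ Av.
have := he v; rewrite /ball/= distrC ger0_norm ?subr_ge0// ltrBlDl => /(_ ve).
rewrite distrC => /ltr_normlW; rewrite ltrBlDr subrK => Fv.
by have := lt_le_trans Fv Av; rewrite ltxx.
Qed.

Lemma atomless v : prob pi [set x | g x == v] = 0.
Proof.
have mA : measurable [set x | g x == v].
  rewrite (_ : [set x | _] = g @^-1` [set v]).
    by rewrite -[X in measurable X]setTI; exact: measurable_funP.
  by apply/seteqP; split => x /=; [move/eqP|move=> ->].
apply/eqP; rewrite eq_le prob_ge0 andbT; apply/ler_addgt0Pr => e e0; rewrite add0r.
have Fx := continuous_cdfR.
have /cvgrPdist_lt/(_ _ e0)/nbhs_ballP[h /= h0 hh] := Fx v.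
have := hh (v - h / 2); rewrite /ball/= opprB addrC subrK.
rewrite gtr0_norm ?divr_gt0// ltr_pdivrMr// ltr_pMr// ltr1n => /(_ isT) /ltr_normlW.
move=> /ltW; apply: le_trans; rewrite lerBrDr !cdfRE -lee_fin EFinD !probE//; try exact: measurable_sublevel.
rewrite -measureU//; [|exact: measurable_sublevel|].
  apply: le_measure; rewrite ?inE; [apply: mem_set|apply: mem_set|].
  - by apply: measurableU => //; exact: measurable_sublevel.
  - exact: measurable_sublevel.
  - move=> x /= [/eqP ->//|/le_trans]; apply.
    by rewrite gerBl divr_ge0// ltW.
apply/seteqP; split => // x /= [/eqP -> ].
by rewrite lerBrDr gerDl leNgt divr_gt0.
Qed.

End distribution_function.

Lemma cvg_local_increment (R : realType) (F : R -> R) (x z a : R) : is_derive x 1 F a ->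
  Num.sqrt n%:R * (F (x + z / Num.sqrt n%:R) - F x) @[n --> \oo] --> a * z.
Proof.
move=> [dF <-]; have [->|z0] := eqVneq z 0.
  under eq_fun do rewrite mul0r addr0 subrr mulr0.
  by rewrite mulr0; exact: cvg_cst.
have hn : z / Num.sqrt (n%:R : R) @[n --> \oo] --> (0 : R).
  by rewrite -(mulr0 z); apply: cvgM; [exact: cvg_cst|exact: cvg_invr_sqrt].
have hn' : z / Num.sqrt (n%:R : R) @[n --> \oo] --> (0 : R)^'.
  move=> A /= [e e0 he]; have /cvgrPdist_lt/(_ _ e0) := hn.
  apply: filterS2 (nbhs_infty_gt 0) => n n0 hb; apply: he => //=.
  by rewrite mulf_neq0// invr_eq0 sqrtr_eq0 -ltNge ltr0n.
have := cvg_comp _ _ hn' dF; rewrite -/('D_1 F x) => c.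
have c' := @cvgM _ _ _ eventually_filter _ _ _ _ c (cvg_cst z).
apply: cvg_trans (c' eventually_filter); apply: near_eq_cvg; near=> n.
have n0 : Num.sqrt n%:R != 0 :> R.
  by rewrite sqrtr_eq0 -ltNge ltr0n; near: n; exact: nbhs_infty_gt.
rewrite /= [_ *: 1]mulr1 [z / _ + x]addrC; rewrite /GRing.scale/=.
by field; rewrite n0 z0.
Unshelve. all: by end_near. Qed.

(** * The limit theorem for the order statistic *)

Section quantile_clt.
Context d (S : measurableType d) (R : realType).
Variables (P : R.-pker S ~> S) (pi Q : probability S R) (s : S -> R).
Hypothesis hmin : minorization P pi s Q.
Hypothesis hinv : Pilot.Defs.invariant P pi.
Context d' (Omega : measurableType d') (Pr : probability Omega R).
Variables (X : nat -> {RV Pr >-> S}) (delta : nat -> {RV Pr >-> bool}).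
Hypothesis hX : split_chain X delta P s Q Q.
Variable m : R.
Hypothesis m1 : 1 < m.
Hypothesis hpoly : polynomially_ergodic P pi m.
Variables (g : {RV pi >-> R}) (q : R) (fV : R -> R).
Hypothesis hq : 0 < q < 1.
Hypothesis hf : has_continuous_density (cdfR g) fV.

Local Notation F := (cdfR g).
Local Notation xi := (quantile F q).

Hypothesis hf0 : 0 < fV xi.

Let beta := renewal_rate pi s.

Let beta0 : 0 < beta. Proof. exact: (renewal_rate_gt0 hmin). Qed.

Let Fxi : F xi = q. Proof. exact: (cdfR_quantile hf). Qed.

Let dl w : nat -> bool := delta ^~ w.

Let tau r w := regeneration_time (dl w) r.

Let dtau r : discrete (tau r). Proof. exact: (discrete_regeneration_time X delta r). Qed.

Let N w : R := (tour_length (dl w) 1)%:R.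

Let mN : measurable_fun setT N.
Proof.
apply: (discrete_measurable_comp (fun n : nat => n%:R : R)).
exact: (discrete_tour_length X).
Qed.

Let N0 w : 0 <= N w. Proof. exact: ler0n. Qed.

Let iN2 : Pr.-integrable setT (EFin \o (fun w => N w ^+ 2)).
Proof. exact: (tour_length_sqr_integrable hmin hinv hX m1 hpoly). Qed.

Let iN : Pr.-integrable setT (EFin \o N).
Proof.
apply: (le_integrable_bound mN) iN2 => w; rewrite /N ger0_norm// -natrX ler_nat.
by case: (tour_length _ _) => // n; rewrite leq_pmulr.
Qed.

Let EN : \int[Pr]_w N w = beta^-1.
Proof.
apply: EFin_inj; rewrite EFin_Rintegral//.
exact: (tour_length_mean hmin hinv hX m1 hpoly).
Qed.

Section count.
Variable b : S -> bool.
Hypothesis mb : measurable [set x | b x].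

Lemma measurable_tour_visits :
  measurable_fun setT (fun w => (tour_visits X delta b 0 w)%:R : R).
Proof.
apply: (discrete_measurable_comp (fun n : nat => n%:R : R)).
exact: discrete_tour_visits.
Qed.

Lemma tour_visits_le_length w : (tour_visits X delta b 0 w)%:R <= N w.
Proof. by rewrite ler_nat; exact: tour_visits_le. Qed.

Lemma integrable_tour_visits :
  Pr.-integrable setT (EFin \o (fun w => (tour_visits X delta b 0 w)%:R : R)).
Proof.
apply: (le_integrable_bound measurable_tour_visits) iN => w.
by rewrite ger0_norm// tour_visits_le_length.
Qed.

Lemma tour_visits_Rmean :
  \int[Pr]_w (tour_visits X delta b 0 w)%:R = prob pi [set x | b x] / beta.
Proof.
apply: EFin_inj; rewrite EFin_Rintegral; last exact: integrable_tour_visits.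
exact: (tour_visits_mean hmin hinv hX m1 hpoly).
Qed.

End count.

Let T r w : R := (tau r w)%:R / r%:R - beta^-1.

Let mT r : measurable_fun setT (T r).
Proof. exact: (discrete_measurable_comp (fun n : nat => n%:R / r%:R - beta^-1 : R)). Qed.

(** The increments divided by [sqrt n] have variances tending to 0; so the limit
    law in [tours_clt] is the point mass at 0. *)
Lemma regeneration_time_lln : cvg_in_probability0 Pr T.
Proof.
apply: logistic_cvg_in_probability0 => // l a l0.
pose psi (n : nat) (p : nat * nat) : R := (p.1%:R - beta^-1) / Num.sqrt n%:R.
have psiE n w : (0 < n)%N -> T n w =
    (\sum_(0 <= k < n) psi n (tour_code X delta xpredT k w)) / Num.sqrt n%:R.
  move=> n0; rewrite /psi -mulr_suml sumrB -natr_sum (sum_tour_length (dl w)).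
  rewrite big_const_nat subn0 iter_addr addr0 -mulrA -invfM -expr2 sqr_sqrtr//.
  by rewrite mulrBl -[beta^-1 *+ n]mulr_natr mulfK// pnatr_eq0 -lt0n.
have iK : Pr.-integrable setT (EFin \o (fun w => N w - beta^-1)).
  by apply: integrable_subr => //; exact: finite_measure_integrable_cst.
have iK2 : Pr.-integrable setT (EFin \o (fun w => (N w - beta^-1) ^+ 2)).
  apply: (@le_integrable_bound _ _ _ Pr _ (fun w => 2 * N w ^+ 2 + 2 * beta^-1 ^+ 2)).
  - by apply: measurable_funX; exact: measurable_funB.
  - move=> w; rewrite ger0_norm ?sqr_ge0// -subr_ge0.
    by rewrite (_ : _ - _ = (N w + beta^-1) ^+ 2) ?sqr_ge0//; ring.
  - apply: integrable_addr; first exact: integrable_mulrl.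
    exact: finite_measure_integrable_cst.
have H : \int[Pr]_w logistic l a ((\sum_(0 <= k < n) psi n (tour_code X delta xpredT k w))
    / Num.sqrt n%:R) @[n --> \oo] --> gauss_avg 0 (logistic l a) 0.
  apply: (tours_clt hmin hinv hX m1 hpoly (b := fun _ => xpredT) (psi := psi) (c := 1 + beta^-1)) => //.
  - by move=> _; rewrite (_ : [set x | _] = setT)//; apply/seteqP; split.
  - move=> n p _; rewrite /psi normrM.
    have b0 : 0 <= beta^-1 by rewrite invr_ge0 ltW.
    have p0 : 0 <= p.1%:R :> R by [].
    have s1 : `|(Num.sqrt (n%:R : R))^-1| <= 1.
      rewrite ger0_norm ?invr_ge0 ?sqrtr_ge0//; case: n => [|n].
        by rewrite sqrtr0 invr0.
      by rewrite invf_le1 ?sqrtr_gt0 ?ltr0n// -[leLHS]sqrtr1 ler_wsqrtr// ler1n.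
    apply: (@le_trans _ _ (p.1%:R + beta^-1)).
      apply: le_trans (ler_wpM2l (normr_ge0 _) s1) _; rewrite mulr1.
      by rewrite (le_trans (ler_normB _ _))// !ger0_norm.
    have h : 0 <= beta^-1 * p.1%:R by rewrite mulr_ge0.
    by rewrite mulrDl mul1r mulrDr mulr1; lra.
  - move=> n; rewrite /psi /= -/(dl _).
    rewrite (RintegralZr _ measurableT iK) RintegralB//; last exact: finite_measure_integrable_cst.
    by rewrite -/(N _) EN Rintegral_prob_cst subrr mul0r.
  - have -> : (0 : R) ^+ 2 = \int[Pr]_w (N w - beta^-1) ^+ 2 * 0 by rewrite expr0n mulr0.
    have -> : (fun n => \int[Pr]_w psi n (tour_code X delta xpredT 0 w) ^+ 2) =
        (fun n => \int[Pr]_w (N w - beta^-1) ^+ 2 * n%:R^-1).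
      apply/funext => n; rewrite -(RintegralZr _ measurableT iK2).
      apply: eq_Rintegral => w _; rewrite /psi /= exprMn exprVn sqr_sqrtr//.
    apply: cvgM; first exact: cvg_cst.
    have c : (Num.sqrt (n%:R : R))^-1 * (Num.sqrt (n%:R : R))^-1 @[n --> \oo] --> (0 * 0 : R).
      by apply: cvgM; exact: cvg_invr_sqrt.
    rewrite mulr0 in c; apply: cvg_trans c; apply: near_eq_cvg; apply: nearW => n /=.
    by rewrite -invfM -expr2 sqr_sqrtr.
rewrite gauss_avg0 in H; apply: cvg_trans H; apply: near_eq_cvg.
apply: filterS (nbhs_infty_gt 0) => n n0.
by apply: eq_Rintegral => w _; rewrite psiE.
Qed.

(** The normalised order statistic is at most [z] exactly when the order statistic
    is at most the level [y r], that is, when [j r] is at most the number of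
    observations up to that level. *)
Section level.
Variable z : R.

Let y (r : nat) : R := xi + z / Num.sqrt r%:R.

Let y_cvg : y r @[r --> \oo] --> (xi : R).
Proof.
rewrite -[X in _ --> X]addr0 -(mulr0 z).
by apply: cvgD; [exact: cvg_cst|apply: cvgM; [exact: cvg_cst|exact: cvg_invr_sqrt]].
Qed.

Let Fy_cvg : F (y r) @[r --> \oo] --> (q : R).
Proof.
rewrite -Fxi; have Fx := continuous_cdfR hf.
exact: (cvg_comp _ _ y_cvg (Fx xi)).
Qed.

Let b (r : nat) (x : S) : bool := g x <= y r.

Let b0 (x : S) : bool := g x <= xi.

Let mb r : measurable [set x | b r x]. Proof. exact: measurable_sublevel. Qed.

Let mb0 : measurable [set x | b0 x]. Proof. exact: measurable_sublevel. Qed.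

Let kappa := fV xi / beta.

Let kappa0 : 0 < kappa. Proof. exact: divr_gt0. Qed.

(* The contribution of one tour to the count at level y r, centred, and scaled
   by the limit kappa of the slope of the count per tour, with the sign of the
   order statistic. *)
Let psi r (p : nat * nat) : R := - (p.2%:R - F (y r) * p.1%:R) / kappa.

Let D w : R := (tour_visits X delta b0 0 w)%:R - q * N w.

Let sigma := Num.sqrt (\int[Pr]_w D w ^+ 2) / kappa.

Let abs_le (p : nat * nat) (F0 : R) : (p.2 <= p.1)%N -> 0 <= F0 <= 1 ->
  `|p.2%:R - F0 * p.1%:R| <= p.1%:R.
Proof.
move=> p21 /andP[F00 F01]; have p0 : 0 <= p.1%:R :> R by [].
have p2 : p.2%:R <= p.1%:R :> R by rewrite ler_nat.
have p20 : 0 <= p.2%:R :> R by [].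
have h1 : 0 <= F0 * p.1%:R by rewrite mulr_ge0.
have h2 : F0 * p.1%:R <= p.1%:R by rewrite ler_piMl.
by rewrite ler_norml; apply/andP; split; lra.
Qed.

(* Observations equal to the quantile, at which the indicator of being at most
   y r would not converge, do not occur in the first tour. *)
Let no_atom : {ae Pr, forall w, tour_visits X delta (fun x => g x == xi) 0 w = 0%N}.
Proof.
have mA : measurable [set x | g x == xi].
  rewrite (_ : [set x | _] = g @^-1` [set xi]).
    by rewrite -[X in measurable X]setTI; exact: measurable_funP.
  by apply/seteqP; split => x /=; [move/eqP|move=> ->].
have dv := discrete_tour_visits X delta mA 0.
have mB : measurable [set w | (0 < tour_visits X delta (fun x => g x == xi) 0 w)%N].
  exact: (discrete_preimage (fun n => 0 < n)%N dv).
exists [set w | (0 < tour_visits X delta (fun x => g x == xi) 0 w)%N]; split => //.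
  rewrite -probE//; congr (_%:E); apply/eqP; rewrite eq_le prob_ge0 andbT.
  have := tour_visits_Rmean mA; rewrite (atomless hf) mul0r => <-.
  apply: prob_le_Rintegral => //; first exact: integrable_tour_visits.
  by move=> w /=; rewrite ler1n.
by move=> w /= /eqP; rewrite -lt0n.
Qed.

Let visits_near w : tour_visits X delta (fun x => g x == xi) 0 w = 0%N ->
  \forall r \near \oo, tour_visits X delta (b r) 0 w = tour_visits X delta b0 0 w.
Proof.
rewrite /tour_visits; move: (regeneration_time _ 1) => n.
rewrite (_ : regeneration_time _ 0 = 0%N)//.
elim: n => [|n IHn]; first by move=> _; apply: nearW => r; rewrite !big_geq.
rewrite big_nat_recr//= => /eqP; rewrite addn_eq0 => /andP[/eqP/IHn IH].
rewrite eqb0 => gx; apply: filterS2 IH (_ : \forall r \near \oo, b r (X n w) = b0 (X n w)).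
  by move=> r IH bE; rewrite !(@big_nat_recr _ _ _ n)//= IH bE.
have e0 : 0 < `|g (X n w) - xi| by rewrite normr_gt0 subr_eq0.
have /cvgrPdist_lt/(_ _ e0) := y_cvg.
apply: filterS => r; rewrite /b /b0 => h; apply/idP/idP => H.
  rewrite leNgt; apply/negP => xg; move: h.
  rewrite [X in _ < X]gtr0_norm ?subr_gt0// distrC => /ltr_normlW.
  by rewrite ltrD2r ltNge H.
rewrite leNgt; apply/negP => yg; move: h.
by rewrite [X in _ < X]distrC [X in _ < X]ger0_norm ?subr_ge0// => /ltr_normlW;
  rewrite ltrD2l ltrN2 ltNge (ltW yg).
Qed.

Let mpsi r : measurable_fun setT (fun w => psi r (tour_code X delta (b r) 0 w)).
Proof. by apply: (discrete_measurable_comp (psi r)); exact: discrete_tour_code. Qed.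

Let psi_le r p : (p.2 <= p.1)%N -> `|psi r p| <= kappa^-1 * p.1%:R.
Proof.
move=> p21; rewrite /psi mulNr normrN normrM mulrC normfV (gtr0_norm kappa0).
by rewrite ler_pM2l ?invr_gt0// abs_le// cdfR_itv.
Qed.

Let mD : measurable_fun setT D.
Proof.
apply: measurable_funB; first exact: measurable_tour_visits.
exact: measurable_funM.
Qed.

Let D_le w : `|D w| <= N w.
Proof.
have q01 : 0 <= q <= 1 by case/andP: hq => ? ?; rewrite !ltW.
by apply: (abs_le (p := (tour_length (dl w) 1, tour_visits X delta b0 0 w))) => //=;
  exact: tour_visits_le.
Qed.

Let iD2 : Pr.-integrable setT (EFin \o (fun w => D w ^+ 2)).
Proof.
apply: (le_integrable_bound _ _ iN2); first exact: measurable_funX.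
by move=> w; rewrite normrX ler_pXn2r// nnegrE.
Qed.

(* Dominated convergence, with the square of the length of the tour as bound. *)
Let psi_var : \int[Pr]_w psi r (tour_code X delta (b r) 0 w) ^+ 2 @[r --> \oo] --> sigma ^+ 2.
Proof.
have I0 : 0 <= \int[Pr]_w D w ^+ 2 by apply: Rintegral_ge0 => w _; exact: sqr_ge0.
have -> : sigma ^+ 2 = \int[Pr]_w (D w ^+ 2 * kappa^-1 ^+ 2).
  by rewrite RintegralZr// /sigma exprMn sqr_sqrtr.
have iDk : Pr.-integrable setT (EFin \o (fun w => D w ^+ 2 * kappa^-1 ^+ 2)).
  exact: integrable_mulrr.
have [] := @dominated_convergence _ _ _ Pr setT measurableT
  (fun r w => (psi r (tour_code X delta (b r) 0 w) ^+ 2)%:E)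
  (fun w => (D w ^+ 2 * kappa^-1 ^+ 2)%:E) (fun w => (kappa^-1 ^+ 2 * N w ^+ 2)%:E).
- by move=> r; apply/measurable_EFinP; exact: measurable_funX.
- by apply/measurable_EFinP; apply: measurable_funM => //; exact: measurable_funX.
- apply: filterS no_atom => w /visits_near Hw _.
  apply: cvg_EFin; first exact: nearW.
  have -> : D w ^+ 2 * kappa^-1 ^+ 2 = (- D w / kappa) ^+ 2 by rewrite exprMn sqrrN.
  have c : - ((tour_visits X delta b0 0 w)%:R - F (y r) * N w) / kappa @[r --> \oo] -->
      - D w / kappa.
    apply: cvgM; last exact: cvg_cst; apply: cvgN; apply: cvgB; first exact: cvg_cst.
    by apply: cvgM => //; exact: cvg_cst.
  have c2 : (- ((tour_visits X delta b0 0 w)%:R - F (y r) * N w) / kappa) ^+ 2 @[r --> \oo] -->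
      (- D w / kappa) ^+ 2 by rewrite expr2; apply: cvgM; exact: c.
  apply: cvg_trans c2; apply: near_eq_cvg.
  by apply: filterS Hw => r Hr; rewrite /psi /= Hr.
- exact: integrable_mulrl.
- apply: aeW => w r _; rewrite lee_fin ger0_norm ?sqr_ge0// -exprMn -[leLHS]real_normK ?num_real//.
  rewrite ler_pXn2r ?nnegrE// ?mulr_ge0// ?invr_ge0 ?(ltW kappa0)//.
  by apply: psi_le; exact: tour_visits_le.
move=> _ _; rewrite -EFin_Rintegral// => /fine_cvgP[_].
exact.
Qed.

Let U r w : R := (\sum_(0 <= k < r) psi r (tour_code X delta (b r) k w)) / Num.sqrt r%:R.

Let U_clt l a : 0 < l -> \int[Pr]_w logistic l a (U r w) @[r --> \oo] -->
  gauss_avg sigma (logistic l a) 0.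
Proof.
move=> l0; have kV : 0 <= kappa^-1 by rewrite invr_ge0 ltW.
apply: (tours_clt hmin hinv hX m1 hpoly (c := kappa^-1)) => //.
- by move=> r p /(psi_le r) h; rewrite (le_trans h)// ler_wpM2l// lerDr.
- move=> r; rewrite /psi /=.
  have i1 := integrable_tour_visits (mb r).
  have i2 : Pr.-integrable setT (EFin \o (fun w => F (y r) * N w)) by exact: integrable_mulrl.
  under eq_Rintegral do rewrite mulNr -mulrN.
  rewrite RintegralZr//; last exact: integrable_subr.
  rewrite RintegralB// RintegralZl// EN tour_visits_Rmean//.
  by rewrite /b -cdfRE subrr mul0r.
- by rewrite divr_ge0 ?sqrtr_ge0// ltW.
Qed.

Variable j : nat -> {RV Pr >-> nat}.
Hypothesis hjq : {ae Pr, forall w,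
  ((j r w)%:R - (tau r w)%:R * q) / Num.sqrt (tau r w)%:R @[r --> \oo] --> (0 : R)}.

Let dj r : discrete (j r).
Proof.
move=> n; rewrite -[X in measurable X]setTI.
exact: (measurable_funP (j r) measurableT).
Qed.

Let A r w : R := ((j r w)%:R - (tau r w)%:R * q) / Num.sqrt (tau r w)%:R.

Let mA r : measurable_fun setT (A r).
Proof.
exact: (discrete_measurable_comp (fun p : nat * nat =>
  (p.1%:R - p.2%:R * q) / Num.sqrt p.2%:R : R) (discrete_pair (dj r) (dtau r))).
Qed.

Let a (r : nat) : R := Num.sqrt r%:R * (F (y r) - q).

Let a_cvg : a r @[r --> \oo] --> fV xi * z.
Proof. by have := cvg_local_increment (z := z) (is_derive_cdfR hf xi); rewrite Fxi. Qed.

(* The difference between z + (j - C) / (kappa sqrt r), with C the count at level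
   y r, and its main term U: what remains once the count is centred at
   F (y r) * tau. *)
Let E r w : R := z + (A r w * Num.sqrt ((tau r w)%:R / r%:R) - a r * ((tau r w)%:R / r%:R)) / kappa.

Let mE r : measurable_fun setT (E r).
Proof.
exact: (discrete_measurable_comp (fun p : nat * nat =>
  z + ((p.1%:R - p.2%:R * q) / Num.sqrt p.2%:R * Num.sqrt (p.2%:R / r%:R)
    - a r * (p.2%:R / r%:R)) / kappa : R) (discrete_pair (dj r) (dtau r))).
Qed.

Let cvg_prob0 (u v : nat -> R) : (\forall r \near \oo, 0 <= v r <= u r) ->
  u r @[r --> \oo] --> (0 : R) -> v r @[r --> \oo] --> (0 : R).
Proof.
move=> H cu; apply: (@squeeze_cvgr _ _ _ _ (fun=> 0) u) => //; exact: cvg_cst.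
Qed.

(* The terms z and a * (tau / r) / kappa cancel in the limit, as tau / r tends to
   beta^-1 and a to fV xi * z; the other one is the hypothesis on j, up to the
   bounded factor sqrt (tau / r). *)
Let E_cvg0 : cvg_in_probability0 Pr E.
Proof.
move=> h h0; have h3 : 0 < h / 3 by rewrite divr_gt0.
have c1 : z - a r / (kappa * beta) @[r --> \oo] --> (0 : R).
  have -> : 0 = z - fV xi * z / (kappa * beta).
    by rewrite /kappa divfK ?gt_eqF// [fV xi * z]mulrC mulfK ?gt_eqF// subrr.
  by apply: cvgB; [exact: cvg_cst|apply: cvgM; [exact: a_cvg|exact: cvg_cst]].
have [B B0 hB] : exists2 B : R, 0 < B & \forall r \near \oo, `|a r| <= B.
  exists (`|fV xi * z| + 1); first by rewrite ltr_wpDl.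
  have /cvgrPdist_le/(_ _ ltr01) := a_cvg; apply: filterS => r ar.
  rewrite -[a r](subrK (fV xi * z)) (le_trans (ler_normD _ _))// addrC lerD2l.
  by rewrite distrC.
pose K := Num.sqrt (1 + beta^-1).
have K0 : 0 < K by rewrite sqrtr_gt0 addr_gt0// invr_gt0.
have [h1 h10 h1E] : exists2 h1 : R, 0 < h1 & h1 * K / kappa = h / 3.
  exists (h / 3 * kappa / K); first by rewrite divr_gt0// mulr_gt0.
  by field; rewrite !gt_eqF.
have [h2 /andP[h20 h21] h2E] : exists2 h2 : R, 0 < h2 <= 1 & B * h2 / kappa <= h / 3.
  exists (Num.min 1 (h / 3 * kappa / B)).
    by rewrite lt_min ltr01 ge_min lexx/= divr_gt0// mulr_gt0.
  rewrite ler_pdivrMr// mulrC -ler_pdivlMr//.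
  by rewrite ge_min lexx orbT.
have cA : cvg_in_probability0 Pr A by exact: ae_cvg_in_probability0.
have mgt (f : Omega -> R) (c : R) : measurable_fun setT f -> measurable [set w | c < `|f w|].
  move=> mf; rewrite -[X in measurable X]setTI.
  by apply: measurable_fun_ltr => //; exact: measurableT_comp.
apply: (cvg_prob0 (u := fun r => prob Pr [set w | h1 < `|A r w|] + prob Pr [set w | h2 < `|T r w|])).
  have /cvgrPdist_le/(_ _ h3) N1 := c1.
  apply: filterS (filterI N1 hB) => r [r1 rB].
  rewrite prob_ge0 (le_trans _ (prob_setU Pr (mgt _ _ (mA r)) (mgt _ _ (mT r))))//.
  apply: prob_le; [exact: mgt|by apply: measurableU; exact: mgt|].
  move=> w /=; apply: contraPP => /not_orP[/negP + /negP]; rewrite -!leNgt => Aw Tw.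
  apply/negP; rewrite -leNgt.
  pose t : R := (tau r w)%:R / r%:R.
  have tE : t = T r w + beta^-1 by rewrite /T subrK.
  have t1 : t <= 1 + beta^-1.
    by rewrite tE lerD2r (le_trans (ler_norm _))// (le_trans Tw).
  have -> : E r w = (z - a r / (kappa * beta)) + (A r w * Num.sqrt t / kappa - a r * T r w / kappa).
    by rewrite /E -/t tE; field; rewrite !gt_eqF.
  rewrite sub0r normrN in r1.
  have i1 : `|A r w * Num.sqrt t / kappa| <= h / 3.
    rewrite -h1E normrM (normrM (A r w)) normfV (gtr0_norm kappa0) ler_pM2r ?invr_gt0//.
    by apply: ler_pM => //; rewrite ger0_norm ?sqrtr_ge0// ler_wsqrtr.
  have i2 : `|a r * T r w / kappa| <= h / 3.
    apply: le_trans h2E; rewrite normrM (normrM (a r)) normfV (gtr0_norm kappa0) ler_pM2r ?invr_gt0//.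
    exact: ler_pM.
  rewrite (le_trans (ler_normD _ _))// (le_trans (lerD r1 (ler_normB _ _)))//.
  by rewrite (le_trans (lerD (lexx _) (lerD i1 i2)))//; lra.
rewrite -(addr0 0); apply: cvgD; first exact: cA.
exact: regeneration_time_lln.
Qed.

Hypothesis hj : {ae Pr, forall w, forall r : nat, (0 < r)%N -> (1 <= j r w <= tau r w)%N}.

Let C r w : nat := \sum_(0 <= i < tau r w) (g (X i w) <= y r)%R.

Let mO r v : measurable
  [set w | order_statistic (fun i => g (X i w)) (tau r w) (j r w) <= v].
Proof.
have msum n : discrete (fun w => (\sum_(0 <= i < n) (g (X i w) <= v)%R)%N).
  apply: (@discrete_natr _ _ R); under eq_fun do rewrite natr_sum.
  apply: measurable_sum => i.
  rewrite (_ : (fun w => _) = (\1_[set x | g x <= v] : S -> R) \o X i).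
    by apply: measurableT_comp => //; apply: measurable_indic; exact: measurable_sublevel.
  apply/funext => w /=; rewrite indicE.
  by case: (boolP (g _ <= v)) => gv; [rewrite mem_set|rewrite memNset//; exact/negP].
apply: (measurable_index (A := fun p : nat * nat =>
    [set w | order_statistic (fun i => g (X i w)) p.1 p.2 <= v])
  (discrete_pair (dtau r) (dj r))) => -[n i] /=.
under eq_set do rewrite order_statistic_le.
case: (i.-1 < n)%N; first exact: (discrete_preimage (fun c => i.-1 < c)%N (msum n)).
case: (0 <= v).
  by rewrite (_ : [set _ | _] = setT)//; apply/seteqP; split.
by rewrite (_ : [set _ | _] = set0)//; apply/seteqP; split.
Qed.

Let mU r : measurable_fun setT (U r).
Proof.
apply: measurable_funM => //; apply: measurable_sum => k.
by apply: (discrete_measurable_comp (psi r)); exact: discrete_tour_code.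
Qed.

Lemma order_statistic_event r : (0 < r)%N ->
  Pr [set w | Num.sqrt r%:R *
    (order_statistic (fun i => g (X i w)) (tau r w) (j r w) - xi) <= z] =
  Pr [set w | U r w + E r w <= z].
Proof.
move=> r0; have sr : 0 < Num.sqrt r%:R :> R by rewrite sqrtr_gt0 ltr0n.
have eO w : (Num.sqrt r%:R *
    (order_statistic (fun i => g (X i w)) (tau r w) (j r w) - xi) <= z) =
    (order_statistic (fun i => g (X i w)) (tau r w) (j r w) <= y r).
  by rewrite mulrC -ler_pdivlMr// lerBlDl.
under eq_set do rewrite eO.
apply: ae_eq_measure; first exact: mO.
  rewrite -[X in measurable X]setTI; apply: measurable_fun_ler => //.
  exact: measurable_funD.
apply: filterS hj => w /(_ r r0) /andP[j1 jt] /=.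
have jE : (j r w).-1.+1 = j r w by rewrite prednK.
have t0 : 0 < Num.sqrt (tau r w)%:R :> R.
  by rewrite sqrtr_gt0 ltr0n (leq_trans j1).
have UE : U r w = - ((C r w)%:R - F (y r) * (tau r w)%:R) / kappa / Num.sqrt r%:R.
  rewrite /U /psi -mulr_suml sumrN sumrB -mulr_sumr -!natr_sum.
  by rewrite (sum_tour_visits X delta) (sum_tour_length (dl w)).
have AE : A r w * Num.sqrt ((tau r w)%:R / r%:R) =
    ((j r w)%:R - (tau r w)%:R * q) / Num.sqrt r%:R.
  by rewrite /A sqrtrM// sqrtrV// mulrA divfK ?gt_eqF.
have aE : a r * ((tau r w)%:R / r%:R) = (F (y r) - q) * (tau r w)%:R / Num.sqrt r%:R.
  rewrite /a -[in X in _ / X](sqr_sqrtr (ler0n R r)) expr2.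
  by field; rewrite gt_eqF.
have VE : U r w + E r w = z + ((j r w)%:R - (C r w)%:R) / (kappa * Num.sqrt r%:R).
  by rewrite UE /E AE aE; field; rewrite !gt_eqF.
rewrite VE gerDl.
rewrite pmulr_lle0; last by rewrite invr_gt0 mulr_gt0.
rewrite subr_le0 ler_nat.
by rewrite order_statistic_le jE jt.
Qed.

Lemma tour_variance_fin : (\int[Pr]_w (D w ^+ 2)%:E = (\int[Pr]_w D w ^+ 2)%:E)%E.
Proof. by rewrite EFin_Rintegral. Qed.

Lemma order_statistic_cvg (mu : probability (measurableTypeR R) R) :
  (forall l c, 0 < l -> \int[mu]_x logistic l c x = gauss_avg sigma (logistic l c) 0) ->
  {for z, continuous (fun v : R => mu `]-oo, v]%classic)} ->
  Pr [set w | Num.sqrt r%:R *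
    (order_statistic (fun i => g (X i w)) (tau r w) (j r w) - xi) <= z] @[r --> \oo] -->
  mu `]-oo, z]%classic.
Proof.
move=> hmu cz.
have H := @logistic_cvg_in_distribution _ _ _ Pr (fun r w => U r w + E r w) mu.
apply: cvg_trans (H _ _ z cz).
- apply: near_eq_cvg; apply: filterS (nbhs_infty_gt 0) => r r0 /=.
  by rewrite order_statistic_event.
- by move=> r; exact: measurable_funD.
- move=> l c l0; rewrite hmu//; apply: logistic_slutsky => //.
  exact: U_clt.
Qed.

End level.

End quantile_clt.

Theorem theorem6 (R : realType) (d : nat) (hd : (0 < d)%N)
  (* the state space, a Borel subset of R^d *)
  (D : set (d.-tuple R)) (mD : measurable D) (D0 : D !=set0)
  (P : R.-pker (trace_space D0) ~> (trace_space D0))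
  (pi Q : probability (trace_space D0) R) (s : trace_space D0 -> R)
  (hP : harris_ergodic P pi) (hmin : minorization P pi s Q)
  (m : R) (hm : 1 < m) (hpoly : polynomially_ergodic P pi m)
  (g : {RV pi >-> R}) (q : R) (hq : 0 < q < 1) (fV : R -> R)
  (hf : has_continuous_density (cdfR g) fV)
  (hf0 : 0 < fV (quantile (cdfR g) q))
  (* the split chain started with X_0 ~ Q *)
  (dO : measure_display) (Omega : measurableType dO) (Pr : probability Omega R)
  (X : nat -> {RV Pr >-> trace_space D0}) (delta : nat -> {RV Pr >-> bool})
  (hX : split_chain X delta P s Q Q)
  (j : nat -> {RV Pr >-> nat})
  (hj : {ae Pr, forall w, forall r : nat, (0 < r)%N ->
          (1 <= j r w <= regeneration_time (delta ^~ w) r)%N})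
  (hjq : {ae Pr, forall w,
          ((j r w)%:R - (regeneration_time (delta ^~ w) r)%:R * q)
            / Num.sqrt (regeneration_time (delta ^~ w) r)%:R
          @[r --> \oo] --> (0 : R)}) :
  let xi := quantile (cdfR g) q in
  let Y i w := g (X i w) in
  let G := Gamma Pr (fun i w => delta i w) Y (cdfR g) xi in
  G \is a fin_num /\
  cvg_in_distribution Pr
    (fun r w => Num.sqrt r%:R *
       (order_statistic (Y ^~ w) (regeneration_time (delta ^~ w) r) (j r w) - xi))
    (centered_normal (fine G / fV xi ^+ 2)).
Proof.
move=> xi Y G; have hinv : Pilot.Defs.invariant P pi by case: hP.
have beta0 := renewal_rate_gt0 hmin; set beta := renewal_rate pi s in beta0 *.
have Fxi : cdfR g xi = q := cdfR_quantile hf hq.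
pose V := \int[Pr]_w ((tour_visits X delta (fun x => g x <= xi) 0 w)%:R -
  q * (tour_length (delta ^~ w) 1)%:R) ^+ 2.
have V0 : 0 <= V by apply: Rintegral_ge0 => w _; exact: sqr_ge0.
have GE : G = (V * beta ^+ 2)%:E.
  rewrite /G /Gamma Fxi !unlock.
  have -> : (\int[Pr]_w (tour_length (delta ^~ w) 1)%:R%:E)%E = (beta^-1)%:E :> \bar R.
    exact: (tour_length_mean hmin hinv hX hm hpoly).
  have -> : (\int[Pr]_w (((tour_count (delta ^~ w) (Y ^~ w) 1 xi)%:R -
      q * (tour_length (delta ^~ w) 1)%:R) ^+ 2)%:E)%E = V%:E.
    exact: (tour_variance_fin hmin hinv hX hm hpoly).
  rewrite -EFin_expe inver sqrf_eq0 invr_eq0 gt_eqF// -EFinM.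
  by rewrite exprVn invrK.
(* V is the variance per tour; Gamma divides it by the square of the mean
   length beta^-1 of a tour. *)
have vE : fine G / fV xi ^+ 2 = (Num.sqrt V / (fV xi / beta)) ^+ 2.
  by rewrite GE/= exprMn sqr_sqrtr// exprVn expr_div_n; field; rewrite !gt_eqF.
split; first by rewrite GE.
have S0 : 0 <= Num.sqrt V / (fV xi / beta).
  by rewrite divr_ge0 ?sqrtr_ge0// ltW// divr_gt0.
move=> z; rewrite /centered_normal vE sqrf_eq0 sqrtr_sqr ger0_norm//.
case: eqVneq => [e0|ne0] cz.
  apply: (order_statistic_cvg hmin hinv hX hm hpoly hq hf hf0 hjq hj
    (mu := \d_(0 : measurableTypeR R))) => //.
  move=> l c l0; rewrite -/V [X in gauss_avg X]e0 gauss_avg0 /Rintegral integral_dirac//.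
    by rewrite diracT mul1e.
  by apply/measurable_EFinP; exact: measurable_logistic.
have S1 : 0 < Num.sqrt V / (fV xi / beta) by rewrite lt_neqAle eq_sym ne0.
have hmu l c : 0 < l ->
    \int[normal_prob 0 (Num.sqrt V / (fV xi / beta))]_x logistic l c x =
    gauss_avg (Num.sqrt V / (fV xi / beta)) (logistic l c) 0.
  move=> l0; rewrite /gauss_avg /Rintegral (integral_normal_affine _ S1)//.
    by apply/measurable_EFinP; exact: measurable_logistic.
  by move=> x; rewrite lee_fin logistic_ge0.
have H := @order_statistic_cvg _ _ _ _ _ _ _ hmin hinv _ _ _ _ _ hX _ hm hpoly _ _ _
  hq hf hf0 z j hjq hj (normal_prob 0 (Num.sqrt V / (fV xi / beta))).
exact: H hmu cz.
Qed.
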